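(* The following eight conditions are equivalent for each bounded operator $T$ on $C_0[0,\omega_1)$: (a) $T$ belongs to the Loy--Willis ideal $\mathscr{M}$; (b) there is a closed and unbounded subset $D$ of $[0,\omega_1)$ such that $T_{\alpha,\alpha}=0$ for each $\alpha\in D$, where $T_{\alpha,\alpha}$ denotes the $\alpha$-th diagonal entry of the matrix associated with $T$; (c) $T$ belongs to the kernel of the Alspach--Benyamini character $\varphi$; (d) $T$ factors through the Banach space $C_0(L_0)$; (e) the range of $T$ is contained in a Hilbert-generated subspace of $C_0[0,\omega_1)$; (f) the range of $T$ is contained in a weakly compactly generated subspace of $C_0[0,\omega_1)$; (g) $T$ does not fix a copy of $C_0[0,\omega_1)$; (h) the identity operator on $C_0[0,\omega_1)$ does not factor through $T$.
   Context: Scalars are in $\mathbb{K}=\mathbb{R}$ or $\mathbb{K}=\mathbb{C}$; operators are bounded and linear. $\omega_1$ is the first uncountable ordinal; ordinal intervals carry the order topology. For a locally compact Hausdorff space $L$, $C_0(L)$ is the Banach space (supremum norm) of continuous scalar-valued functions on $L$ vanishing at infinity; $C_0[0,\omega_1)$ consists of the continuous functions on $[0,\omega_1)$ that vanish eventually. $\mathscr{B}(X)$ is the algebra of bounded operators on $X$. Matrix: for a non-zero ordinal $\alpha$, every functional in $C_0[0,\alpha)^*$ has a unique representation $\sum_{\beta<\alpha}g(\beta)\delta_\beta$ with $\sum_{\beta<\alpha}|g(\beta)|<\infty$, where $\delta_\beta$ is the point evaluation at $\beta$. The matrix $(T_{\beta,\gamma})_{\beta,\gamma<\alpha}$ of an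 operator $T$ on $C_0[0,\alpha)$ is defined by $T^*\delta_\beta=\sum_{\gamma<\alpha}T_{\beta,\gamma}\delta_\gamma$. Loy--Willis ideal: for $\alpha=\omega_1+1$ one has $C_0[0,\omega_1+1)=C[0,\omega_1]$, and the original Loy--Willis ideal of $\mathscr{B}(C[0,\omega_1])$ is the set of $T\in\mathscr{B}(C[0,\omega_1])$ such that the function $\beta\mapsto T_{\beta,\omega_1}$ on $[0,\omega_1]$ is continuous at $\omega_1$; it is a two-sided ideal of codimension one. The Loy--Willis ideal $\mathscr{M}$ of $\mathscr{B}(C_0[0,\omega_1))$ consists of those $T\in\mathscr{B}(C_0[0,\omega_1))$ for which $U^{-1}TU$ belongs to the original Loy--Willis ideal, where $U$ is an isomorphism of $C[0,\omega_1]$ onto $C_0[0,\omega_1)$ (the definition is independent of the choice of $U$). Alspach--Benyamini character: for each $T\in\mathscr{B}(C_0[0,\omega_1))$, $\varphi(T)$ is the unique scalar for which there is a closed and unbounded subset $D$ of $[0,\omega_1)$ with $(Tf)(\alpha)=\varphi(T)f(\alpha)$ for all $f\in C_0[0,\omega_1)$ and $\alpha\in D$; the map $\varphi$ is a character. $L_0=\bigcup_{\alpha<\omega_1}[0,\alpha]\times\{\alpha+1\}$, a locally compact Hausdorff space in the topology inherited from the product topology on $[0,\omega_1)^2$. A Banach space $X$ is weakly compactly generated if it contains a weakly compact subset whose linear span is dense in $X$; it is Hilbert-generated if there is a bounded operator from a Hilbert space onto a dense subspace of $X$. Subspaces in (e) and (f) are closed. An operator $S\colon W\to X$ factors through an operator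 $T\colon Y\to Z$ if $S=UTR$ for some bounded operators $R\colon W\to Y$, $U\colon Z\to X$; $S\colon W\to X$ factors through a Banach space $Y$ if $S=UR$ for some bounded operators $R\colon W\to Y$, $U\colon Y\to X$. An operator $T$ fixes a copy of a Banach space $Z$ if there is a closed subspace $W$ of its domain, isomorphic to $Z$, such that $T|_W$ is bounded below (an isomorphism onto its range). *)

(* Defs.v *)
From HB Require Import structures.
From mathcomp Require Import all_boot all_order all_algebra finmap.
From mathcomp Require Import sesquilinear complex.
From mathcomp Require Import all_classical all_reals topology normedtype.
From mathcomp Require Import wochoice summability.

Set Implicit Arguments.
Unset Strict Implicit.
Unset Printing Implicit Defensive.

Import Order.TTheory GRing.Theory Num.Theory.
Import numFieldNormedType.Exports.

Local Open Scope classical_set_scope.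
Local Open Scope ring_scope.

Variant scalar_kind := RealScalars | ComplexScalars.

Definition scalars (R : realType) (k : scalar_kind) : numFieldType :=
  match k with RealScalars => R | ComplexScalars => R[i] end.

Definition scalar_conj (R : realType) (k : scalar_kind) :
    scalars R k -> scalars R k :=
  match k with RealScalars => id | ComplexScalars => @conjc R end.

Record bounded_op (K : numFieldType) (X Y : normedModType K) := BoundedOp {
  op_fun :> {linear X -> Y};
  op_bounded : bounded_near op_fun (nbhs (0 : X))
}.

HB.instance Definition _ (K : numFieldType) (X Y : normedModType K) :=
  gen_eqMixin (bounded_op X Y).
HB.instance Definition _ (K : numFieldType) (X Y : normedModType K) :=
  gen_choiceMixin (bounded_op X Y).

Definition functional (K : numFieldType) (X : normedModType K) :=
  bounded_op X (K^o).

Section operators.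
Variable K : numFieldType.

Lemma comp_op_bounded (X Y Z : normedModType K)
    (S : bounded_op Y Z) (T : bounded_op X Y) :
  bounded_near (S \o T) (nbhs (0 : X)).
Proof.
apply/linear_bounded_continuous => x; apply: continuous_comp.
  by apply: bounded_linear_continuous; exact: op_bounded.
by apply: bounded_linear_continuous; exact: op_bounded.
Qed.

Definition comp_op (X Y Z : normedModType K)
    (S : bounded_op Y Z) (T : bounded_op X Y) : bounded_op X Z :=
  BoundedOp (comp_op_bounded S T).

Definition factors_through_op (W X Y Z : normedModType K)
    (S : W -> X) (T : Y -> Z) : Prop :=
  exists (R : bounded_op W Y) (U : bounded_op Z X), S = U \o T \o R.

Definition factors_through (W X : normedModType K) (S : W -> X)
    (Y : normedModType K) : Prop :=
  exists (R : bounded_op W Y) (U : bounded_op Y X), S = U \o R.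

Definition isomorphism (X Y : normedModType K)
    (U : bounded_op X Y) (V : bounded_op Y X) : Prop :=
  cancel U V /\ cancel V U.

Definition isomorphic (X Y : normedModType K) : Prop :=
  exists (U : bounded_op X Y) (V : bounded_op Y X), isomorphism U V.

Definition bounded_below (X Y : normedModType K) (f : X -> Y) : Prop :=
  exists2 c : K, 0 < c & forall x, c * `|x| <= `|f x|.

End operators.

Record closed_subspace (K : numFieldType) (X : normedModType K) :=
  ClosedSubspace {
    subspace_pred :> submodClosed X;
    subspace_closed : closed [set x | x \in subspace_pred]
  }.

(* The carrier of a closed subspace, to be equipped with the induced norm. *)
Record subspace_elt (K : numFieldType) (X : normedModType K)
    (W : closed_subspace X) := SubspaceElt {
  subspace_val : X;
  subspace_valP : subspace_val \in (W : {pred X})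
}.

Section subspace_normed.
Variables (K : numFieldType) (X : normedModType K) (W : closed_subspace X).

HB.instance Definition _ := [isSub for @subspace_val K X W].
HB.instance Definition _ := [Choice of subspace_elt W by <:].
HB.instance Definition _ :=
  [SubChoice_isSubLmodule of subspace_elt W by <:].

Let nrm (x : subspace_elt W) : K := `|\val x|.

Lemma subspace_normD x y : nrm (x + y) <= nrm x + nrm y.
Proof. by rewrite /nrm raddfD/= ler_normD. Qed.

Lemma subspace_normZ (a : K) x : nrm (a *: x) = `|a| * nrm x.
Proof. by rewrite /nrm linearZ/= normrZ. Qed.

Lemma subspace_norm0 x : nrm x = 0 -> x = 0.
Proof. by move=> /normr0_eq0 x0; apply/val_inj; rewrite x0 raddf0. Qed.

HB.instance Definition _ := Lmodule_isNormed.Build K (subspace_elt W)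
  subspace_normD subspace_normZ subspace_norm0.

End subspace_normed.

Section generated_spaces.
Variable K : numFieldType.

(* An initial topology rather than a sup_topology: [X] is mapped into the product
   of copies of [K] indexed by its bounded functionals. *)
Definition weak (X : normedModType K) : topologicalType :=
  initial_topology
    ((fun (x : X) (phi : functional X) => phi x) : X -> {ptws functional X -> K^o}).

Definition weakly_compact (X : normedModType K) (A : set X) : Prop :=
  @compact (weak X) A.

Definition linear_span (X : normedModType K) (A : set X) : set X :=
  [set x | exists (n : nat) (a : 'I_n -> K) (v : 'I_n -> X),
     (forall i, A (v i)) /\ x = \sum_(i < n) a i *: v i].

Definition weakly_compactly_generated (X : normedModType K) : Prop :=
  exists2 A : set X, weakly_compact A & dense (linear_span A).

Definition is_hilbert (conj : K -> K) (H : completeNormedModType K) : Prop :=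
  exists ip : {dot H for conj}, forall x, ip x x = `|x| ^+ 2.

Definition hilbert_generated (conj : K -> K) (X : normedModType K) : Prop :=
  exists (H : completeNormedModType K) (S : bounded_op H X),
    is_hilbert conj H /\ dense (range S).

Definition fixes_copy (X Y : normedModType K) (T : X -> Y)
    (Z : normedModType K) : Prop :=
  exists W : closed_subspace X,
    isomorphic (subspace_elt W) Z /\
    bounded_below (fun w : subspace_elt W => T (\val w)).

End generated_spaces.

Definition vanishes_at_infinity (K : numFieldType) (L : topologicalType)
    (f : L -> K^o) : Prop :=
  forall e : K, 0 < e -> exists2 A : set L, compact A &
    forall x, ~ A x -> `|f x| < e.

Definition C0_pred (K : numFieldType) (L : topologicalType) :
    {pred (L -> K^o)} :=
  [pred f | `[< continuous (f : L -> K^o) /\ vanishes_at_infinity f >]].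

Arguments C0_pred : clear implicits.

Record C0 (K : numFieldType) (L : topologicalType) := MkC0 {
  C0_fun :> L -> K^o;
  C0_funP : C0_fun \in C0_pred K L
}.

Section C0_normed.
Variables (K : numFieldType) (L : topologicalType).

Lemma C0_predP (f : L -> K^o) :
  reflect (continuous f /\ vanishes_at_infinity f) (f \in C0_pred K L).
Proof. exact: asboolP. Qed.

Lemma C0_submod_closed : subsemimod_closed (C0_pred K L).
Proof.
split; first split.
- apply/C0_predP; split; first by move=> x; exact: cvg_cst.
  by move=> e e0; exists set0; [exact: compact0|move=> x _; rewrite normr0].
- move=> f g /C0_predP[cf vf] /C0_predP[cg vg]; apply/C0_predP; split.
    by move=> x; apply: cvgD; [exact: cf|exact: cg].
  move=> e e0; have e20 : 0 < e / 2 by rewrite divr_gt0.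
  have [A cA fA] := vf _ e20; have [B cB gB] := vg _ e20.
  exists (A `|` B); first exact: compactU.
  move=> x /not_orP[/fA fx /gB gx].
  by rewrite (le_lt_trans (ler_normD _ _))// [ltRHS]splitr ltrD.
- move=> a f /C0_predP[cf vf]; apply/C0_predP; split.
    by move=> x; apply: cvgZr; exact: cf.
  move=> e e0; have a0 : 0 < `|a| + 1 by rewrite ltr_wpDl.
  have [A cA fA] := vf _ (divr_gt0 e0 a0); exists A => // x /fA fx.
  rewrite /= normrM (@le_lt_trans _ _ ((`|a| + 1) * `|f x|))//.
    by rewrite ler_wpM2r// lerDl.
  by rewrite mulrC -ltr_pdivlMr.
Qed.

HB.instance Definition _ :=
  GRing.isSubmodClosed.Build K (L -> K^o) (C0_pred K L) C0_submod_closed.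
HB.instance Definition _ := [isSub for @C0_fun K L].
HB.instance Definition _ := [Choice of C0 K L by <:].
HB.instance Definition _ := [SubChoice_isSubLmodule of C0 K L by <:].

Lemma C0_continuous (f : C0 K L) : continuous f.
Proof. by case: f => f /= /C0_predP[]. Qed.

Lemma C0_vanish (f : C0 K L) : vanishes_at_infinity f.
Proof. by case: f => f /= /C0_predP[]. Qed.

Lemma C0D (f g : C0 K L) x : (f + g) x = f x + g x.
Proof. by []. Qed.

Lemma C0Z (a : K) (f : C0 K L) x : (a *: f) x = a * f x.
Proof. by []. Qed.

(* The least upper bound exists in [K], even when [K] is a field of complex
   numbers, because it is attained. *)
Definition sup_norm (f : C0 K L) : K :=
  supremum 0 (range (fun x => `|f x|)).

Lemma C0_max (f : C0 K L) (x1 : L) :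
  exists x0, forall x, `|f x| <= `|f x0|.
Proof.
have [[y fy0]|f0] := pselect (exists y, f y != 0); last first.
  exists x1 => x; suff -> : f x = 0 by rewrite normr0.
  by apply/eqP/negPn/negP => fx; apply: f0; exists x.
have fyp : 0 < `|f y| by rewrite normr_gt0.
have [A cA fA] := C0_vanish f fyp.
have total x z : (`|f x| <= `|f z|) || (`|f z| <= `|f x|).
  by apply: real_leVge; exact: normr_real.
have Ay : A y by apply: contrapT => /fA; rewrite ltxx.
pose F := filter_from A (fun z => A `&` [set x | `|f z| <= `|f x|]).
have PF : ProperFilter F.
  apply: filter_from_proper; last by move=> z Az; exists z; split => /=.
  apply: filter_from_filter; first by exists y.
  move=> z w Az Aw; case/orP: (total z w) => zw.
    by exists w => // x [Ax] /= wx; do !split => //=; exact: le_trans wx.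
  by exists z => // x [Ax] /= zx; do !split => //=; exact: le_trans zx.
have FA : F A by exists y => // x [].
have [p [Ap clp]] := cA F PF FA.
have pA z : A z -> `|f z| <= `|f p|.
  move=> Az; case/orP: (total z p) => //.
  rewrite le_eqVlt => /predU1P[->//|pz].
  have Fz : F (A `&` [set x | `|f z| <= `|f x|]) by exists z.
  have Np : nbhs p [set x | `|f x| < `|f z|].
    have d0 : 0 < `|f z| - `|f p| by rewrite subr_gt0.
    have /cvgrPdist_lt/(_ _ d0) := @C0_continuous f p.
    apply: filterS => x /=; rewrite ltrBrDl => /(le_lt_trans _); apply.
    by rewrite -lerBlDl distrC lerB_dist.
  have [x [[_ /= zx] /= xz]] := clp _ _ Fz Np.
  by move: (lt_le_trans xz zx); rewrite ltxx.
exists p => x; have [/pA//|/fA fx] := pselect (A x).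
exact: (le_trans (ltW fx)) (pA _ Ay).
Qed.

Lemma sup_normP (f : C0 K L) (x1 : L) :
  exists2 x0, sup_norm f = `|f x0| & forall x, `|f x| <= `|f x0|.
Proof.
have [x0 mx0] := C0_max f x1; exists x0 => //; rewrite /sup_norm /supremum.
case: ifPn => [/eqP r0|_].
  have : range (fun x => `|f x|) `|f x0| by exists x0.
  by rewrite r0.
have ub0 : ubound (range (fun x => `|f x|)) `|f x0| by move=> _ [x _ <-].
case: xgetP => [r _ [ubr lbr]|/(_ `|f x0|)]; last first.
  by case; split => // r; apply; exists x0.
by apply/le_anti; rewrite lbr//= ubr//; exists x0.
Qed.

Lemma le_sup_norm (f : C0 K L) (x : L) : `|f x| <= sup_norm f.
Proof. by have [x0 ->] := sup_normP f x. Qed.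

Lemma sup_norm_empty (f : C0 K L) : (L -> False) -> sup_norm f = 0.
Proof.
move=> L0; rewrite /sup_norm /supremum; case: ifPn => // /eqP; case.
by rewrite -subset0 => r [x]; case: (L0 x).
Qed.

Lemma sup_normD (f g : C0 K L) : sup_norm (f + g) <= sup_norm f + sup_norm g.
Proof.
have [x1|L0] := pselect (exists _ : L, True); last first.
  by rewrite !sup_norm_empty ?addr0// => x; apply: L0; exists x.
have [x0 -> _] := sup_normP (f + g) (sval (cid x1)).
by rewrite (le_trans (ler_normD _ _))// lerD// le_sup_norm.
Qed.

Lemma sup_normZ (a : K) (f : C0 K L) : sup_norm (a *: f) = `|a| * sup_norm f.
Proof.
have [x1|L0] := pselect (exists _ : L, True); last first.
  by rewrite !sup_norm_empty ?mulr0// => x; apply: L0; exists x.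
have [x0 -> ax0] := sup_normP (a *: f) (sval (cid x1)).
have [y0 -> fy0] := sup_normP f (sval (cid x1)).
apply/le_anti; rewrite C0Z normrM ler_wpM2l//=.
by have := ax0 y0; rewrite !C0Z !normrM.
Qed.

Lemma sup_norm0 (f : C0 K L) : sup_norm f = 0 -> f = 0.
Proof.
move=> f0; apply/val_inj/funext => x; apply/eqP.
by rewrite -normr_le0 -f0 le_sup_norm.
Qed.

HB.instance Definition _ := Lmodule_isNormed.Build K (C0 K L)
  sup_normD sup_normZ sup_norm0.

End C0_normed.

(* An uncountable well-order all of whose proper initial segments are countable:
   [W] is the interval [0, omega_1), up to a unique order isomorphism. *)
Definition order_type_omega1 (d : Order.disp_t) (W : orderType d) : Prop :=
  [/\ well_order (<=%O : rel W),
      ~ countable [set: W] &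
      forall a : W, countable [set b | (b < a)%O]].

(* If [W] is the interval [0, alpha), then [with_top W], with its order topology,
   is [0, alpha], and [top_point] is alpha itself. *)
Definition with_top (T : Type) : Type := option T.

Definition top_point {T : Type} : with_top T := None.

Section with_top_order.
Context {d : Order.disp_t} {W : orderType d}.

Definition with_top_le (x y : with_top W) : bool :=
  match x, y with
  | _, None => true
  | None, Some _ => false
  | Some a, Some b => (a <= b)%O
  end.

Lemma with_top_le_refl : reflexive with_top_le.
Proof. by case=> /=. Qed.

Lemma with_top_le_anti : antisymmetric with_top_le.
Proof. by case=> [a|] [b|]//= /le_anti ->. Qed.

Lemma with_top_le_trans : transitive with_top_le.
Proof. by case=> [a|] [b|] [c|]//=; exact: le_trans. Qed.

Lemma with_top_le_total : total with_top_le.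
Proof. by case=> [a|] [b|]//=; exact: le_total. Qed.

HB.instance Definition _ := Choice.copy (with_top W) (option W).
HB.instance Definition _ := Order.Le_isPOrder.Build d (with_top W)
  with_top_le_refl with_top_le_anti with_top_le_trans.
HB.instance Definition _ :=
  Order.POrder_isTotal.Build d (with_top W) with_top_le_total.
HB.instance Definition _ :=
  OrderTopological.copy (with_top W) (order_topology (with_top W)).

End with_top_order.

Definition club (d : Order.disp_t) (W : orderTopologicalType d)
    (D : set W) : Prop :=
  closed D /\ forall a, exists2 b, D b & (a < b)%O.

Definition is_succ (d : Order.disp_t) (W : orderType d) (a c : W) : Prop :=
  (a < c)%O /\ forall x, (a < x)%O -> (c <= x)%O.

Definition L0_set (d : Order.disp_t) (W : orderType d) : set (W * W) :=
  \bigcup_(a in [set: W]) ([set b | (b <= a)%O] `*` [set c | is_succ a c]).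
Arguments L0_set {d} W.

Definition L0 (d : Order.disp_t) (W : orderTopologicalType d) :
    topologicalType := set_type (L0_set W).
Arguments L0 {d} W.

Section matrix.
Variables (K : numFieldType) (L : topologicalType).

Definition absolutely_summable (g : L -> K^o) : Prop :=
  exists M : K, forall A : {fset L}, partial_sum (fun b => `|g b|) A <= M.

Definition represents (phi : C0 K L -> K^o) (g : L -> K^o) : Prop :=
  absolutely_summable g /\
  forall f : C0 K L, partial_sum (fun b => g b * f b) @ totally --> phi f.

(* The unique representing function, when [L] is a non-zero ordinal and [phi]
   is a bounded functional; [cst 0] is only the dummy default of [xget]. *)
Definition coefficients (phi : C0 K L -> K^o) : L -> K^o :=
  xget (cst 0) (represents phi).

Definition point_evaluation (b : L) : C0 K L -> K^o := fun f => f b.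

Definition matrix_entry (T : bounded_op (C0 K L) (C0 K L)) (b c : L) : K :=
  coefficients (point_evaluation b \o T) c.

End matrix.

Section character.
Variables (K : numFieldType) (d : Order.disp_t) (W : orderTopologicalType d).

Definition original_loy_willis :
    set (bounded_op (C0 K (with_top W)) (C0 K (with_top W))) :=
  [set S | {for (top_point : with_top W),
     continuous (fun b : with_top W => matrix_entry S b top_point : K^o)}].

(* The condition does not depend on the isomorphism [U]. *)
Definition loy_willis : set (bounded_op (C0 K W) (C0 K W)) :=
  [set T | exists (U : bounded_op (C0 K (with_top W)) (C0 K W))
                  (V : bounded_op (C0 K W) (C0 K (with_top W))),
     isomorphism U V /\ original_loy_willis (comp_op V (comp_op T U))].

(* Such a scalar exists and is unique when [W] has order type omega_1; [0] is only
   the dummy default of [xget]. *)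
Definition alspach_benyamini (T : bounded_op (C0 K W) (C0 K W)) : K :=
  xget 0 [set c : K | exists2 D : set W, club D &
    forall (f : C0 K W) (a : W), D a -> T f a = c * f a].

End character.

(* Main.v *)
(* For an operator [T] on [C_0[0,omega_1)], let [s(a)] be the eventual value of
   [T 1_[0,b](a)] as [b] grows. The function [s] is continuous on [[0,omega_1)],
   hence eventually equal to a constant [c]. A closing-off argument on the supports
   of the rows of the matrix gives a club set [D] with [(T f)(a) = c f(a)] for [a]
   in [D], so [c] is the value of the character and the diagonal entry on [D], and
   every condition is compared with [c = 0].

   If [c] is nonzero, composition with the increasing enumeration of [D] and with
   its left inverse shows that the identity factors through [T].  If [c = 0], every
   [T f] vanishes on [D], whose complement splits into blocks ending at successive
   points of [D]; spreading [T f] over the corresponding pieces of [L_0]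
   factors [T] through [C_0(L_0)].  In [C_0(L_0)] suitably weighted indicator
   functions, with dense linear span, form a weakly null family and define an
   operator from [ell_2(L_0)].

   Conversely, if the range of [T] lies in a generated subspace, the functions
   [T 1_[0,b]], equal to [c] on long intervals, are approximated by combinations
   of the generators. For a weakly compact set, countably many evaluations far out
   already see each finite family of generators as small, which forces [c = 0];
   for a Hilbert space, nearly shortest vectors approximating [c] on ever longer
   intervals are nearly equal by the parallelogram law, yet each image vanishes
   eventually.  Finally, if [c = 0] and [T] were bounded below on a copy of
   [C_0[0,omega_1)], a combination with coefficients [1,...,1,-1,...,-1] of
   indicator functions [1_[0,b_j]] of large norm would have image of
   bounded norm. *)

Require Import Defs.
From HB Require Import structures.
From mathcomp Require Import all_boot all_order all_algebra finmap.
From mathcomp Require Import sesquilinear complex.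
From mathcomp Require Import all_classical all_reals topology normedtype.
From mathcomp Require Import wochoice summability.
From mathcomp Require Import ring lra.

Set Implicit Arguments.
Unset Strict Implicit.
Unset Printing Implicit Defensive.

Import Order.TTheory GRing.Theory Num.Theory.
Import numFieldNormedType.Exports.

Local Open Scope classical_set_scope.
Local Open Scope ring_scope.

(* The matrix is defined through unique representing functions, so it carries information only once
   every bounded functional is shown to be an unordered sum of point masses. This is proved by
   transfinite induction, for [W] and [with_top W] alike. The other main resource is that countable
   sets in omega_1 are bounded: absolutely summable rows then have bounded support, limits become
   eventual equalities, and a real quantity that increases along omega_1 must nearly stabilise. The
   Loy-Willis ideal lives on C[0,omega_1]. There the last column of the identity is 1 at omega_1 and
   0 before it, while an operator of character zero has a last column that takes its final value on
   a club set. Subtracting [c] times the identity therefore shows that continuity of the column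
   forces [c = 0]. *)
#[local] Existing Instance totally_filter.

(** * Real and complex scalars *)

Section scalar_facts.
Variables (R : realType) (k : scalar_kind).
Local Notation K := (scalars R k).

Definition scalar_of : {rmorphism R -> K} :=
  match k return {rmorphism R -> scalars R k} with
  | RealScalars => idfun
  | ComplexScalars => real_complex R
  end.

(** Norms take values in [K], whose order is only partial for complex scalars. This map moves them
    to [R], where suprema and infima exist. *)
Definition scalar_abs : K -> R :=
  match k return scalars R k -> R with
  | RealScalars => fun z => `|z|
  | ComplexScalars => @Normc.normc R
  end.

Lemma normE (z : K) : `|z| = scalar_of (scalar_abs z).
Proof. by rewrite /scalar_of /scalar_abs; case: k z => // -[]. Qed.

Lemma ler_scalar_of (x y : R) : (scalar_of x <= scalar_of y) = (x <= y).
Proof. by rewrite /scalar_of; case: k => //=; rewrite lecR. Qed.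

Lemma ltr_scalar_of (x y : R) : (scalar_of x < scalar_of y) = (x < y).
Proof. by rewrite /scalar_of; case: k => //=; rewrite ltcR. Qed.

Lemma scalar_abs_ge0 (z : K) : 0 <= scalar_abs z.
Proof. by rewrite -ler_scalar_of rmorph0 -normE. Qed.

Lemma scalar_natr_gt (z : K) : exists n : nat, `|z| < n%:R.
Proof.
exists (Num.truncn (scalar_abs z)).+1; rewrite normE -(rmorph_nat scalar_of) ltr_scalar_of.
exact: truncnS_gt.
Qed.

Lemma scalar_inv_natr_lt (e : K) : 0 < e -> exists n : nat, n.+1%:R^-1 < e.
Proof.
move=> e0; have [[|n] en] := scalar_natr_gt e^-1.
  by move: en; rewrite normr_lt0.
exists n; rewrite -[ltRHS]invrK ltf_pV2 ?posrE ?ltr0n ?invr_gt0//.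
by rewrite -[ltLHS]gtr0_norm// invr_gt0.
Qed.

(** Stated for filters, since it is applied to filters of cuts and of finite index sets. In the
    complex case the real and imaginary parts, being 1-Lipschitz, reduce it to [R]. *)
Lemma scalar_complete (F : set_system K^o) :
  ProperFilter F -> cauchy F -> cvg F.
Proof.
rewrite /scalars; case: k F => F FF; first exact: R_complete.
move=> /cauchyP Fc; apply/cvg_ex.
have lipc (h : R[i] -> R) :
    (forall x y, `|h x - h y| <= Normc.normc (x - y)) -> cvg (h @ F).
  move=> hl; apply: R_complete; apply: cauchy_exP => e e0.
  have [|x Fx] := Fc (e%:C)%C; first by rewrite ltcR.
  exists (h x); change (F [set y | `|h x - h y| < e]).
  apply: filterS Fx => y /= xy; apply: (le_lt_trans (hl _ _)).
  by rewrite -ltcR; exact: xy.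
have hRe (z : R[i]) : `|complex.Re z| <= Normc.normc z.
  by case: z => a b /=; rewrite -sqrtr_sqr ler_sqrt ?addr_ge0 ?sqr_ge0// lerDl sqr_ge0.
have hIm (z : R[i]) : `|complex.Im z| <= Normc.normc z.
  by case: z => a b /=; rewrite -sqrtr_sqr ler_sqrt ?addr_ge0 ?sqr_ge0// lerDr sqr_ge0.
have /cvg_ex[/= a Fa] : cvg (@complex.Re R @ F).
  by apply: lipc => -[a b] [a' b']; exact: (hRe ((a +i* b) - (a' +i* b'))%C).
have /cvg_ex[/= b Fb] : cvg (@complex.Im R @ F).
  by apply: lipc => -[c b] [a' b']; exact: (hIm ((c +i* b) - (a' +i* b'))%C).
exists (a +i* b)%C; apply/cvgrPdist_lt => e.
move: e => [e e'] /=; rewrite ltcE /= => /andP[/eqP -> e0].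
have e20 : 0 < e / 2 by rewrite divr_gt0.
move/cvgrPdist_lt : Fa => /(_ _ e20); move/cvgrPdist_lt : Fb => /(_ _ e20).
rewrite !near_simpl => Fb; apply: filterS2 (Fb) => -[c d] /= bd ac.
have sqrt_le (x y : R) : Num.sqrt (x ^+ 2 + y ^+ 2) <= `|x| + `|y|.
  rewrite -[leRHS]ger0_norm ?addr_ge0// -sqrtr_sqr ler_sqrt ?sqr_ge0//.
  rewrite [leRHS]sqrrD !real_normK ?num_real//.
  by rewrite addrAC lerDl mulrn_wge0// mulr_ge0.
change ((Normc.normc ((a +i* b) - (c +i* d)))%:C%C < e%:C%C).
rewrite ltcR /= (le_lt_trans (sqrt_le _ _))//.
by rewrite [ltRHS]splitr ltrD.
Qed.

End scalar_facts.

(** * Well-ordered spaces and the first uncountable ordinal *)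

(* [above a x] says that [x] lies to the right of the cut [a], where [None] is
   the cut at minus infinity; in a well-order the sets [(a, b]] so obtained are
   a neighbourhood basis of [b]. *)
Definition above (d : Order.disp_t) (L : orderType d) (a : option L) (x : L) : bool :=
  if a is Some a' then (a' < x)%O else true.

Section well_ordered_space.
Variables (d : Order.disp_t) (L : orderTopologicalType d).
Hypothesis wo : well_order (<=%O : rel L).

Lemma wo_min (P : set L) : P !=set0 -> exists2 m, P m & forall x, P x -> (m <= x)%O.
Proof.
move=> [x Px]; have Pne : nonempty [pred x | `[< P x >]] by exists x; apply/asboolP.
have [m [[mP mle] _]] := wo Pne.
exists m; first exact/asboolP.
by move=> y Py; apply: mle; apply/asboolP.
Qed.

Lemma wo_ind (P : L -> Prop) :
  (forall b, (forall a, (a < b)%O -> P a) -> P b) -> forall b, P b.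
Proof.
move=> indP b; apply: contrapT => nPb.
have [|m nPm mle] := @wo_min [set x | ~ P x]; first by exists b.
apply: nPm; apply: indP => a am; apply: contrapT => /mle.
by rewrite leNgt am.
Qed.

Lemma above_le (a : option L) x y : above a x -> (x <= y)%O -> above a y.
Proof. by case: a => //= a ax xy; exact: lt_le_trans xy. Qed.

Lemma aboveI (a b : option L) x : above a x -> above b x ->
  exists2 c, above c x & forall y, above c y -> above a y /\ above b y.
Proof.
case: a => [a|] ax; last by move=> bx; exists b.
case: b => [b|] bx; last by exists (Some a).
exists (Some (Order.max a b)); first by rewrite /= gt_max; apply/andP.
by move=> y /=; rewrite gt_max => /andP[].
Qed.

Lemma open_above (a : option L) : open [set x | above a x].
Proof.
case: a => [a|]; last first.
  by have -> : [set x : L | above None x] = setT; [exact/seteqP|exact: openT].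
have -> : [set x | above (Some a) x] = `]a, +oo[%classic.
  by apply/seteqP; split => x /=; rewrite in_itv /= andbT.
exact: rray_open.
Qed.

(** Unless [P] is everything, it is the open ray below the least point that it misses. *)
Lemma open_initial (P : set L) :
  (forall x y, P y -> (x <= y)%O -> P x) -> open P.
Proof.
move=> dP; have [[y nPy]|allP] := pselect (exists y, ~ P y); last first.
  have -> : P = setT.
    by apply/seteqP; split => // x _; apply: contrapT => nPx; apply: allP; exists x.
  exact: openT.
have [|m nPm mle] := @wo_min (~` P); first by exists y.
have -> : P = `]-oo, m[%classic.
  apply/seteqP; split => x /=; rewrite in_itv /=.
    by move=> Px; rewrite ltNge; apply/negP => /(dP _ _ Px).
  by move=> xm; apply: contrapT => /mle; rewrite leNgt xm.
exact: lray_open.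
Qed.

Lemma open_le (b : L) : open [set x | (x <= b)%O].
Proof. by apply: open_initial => x y /= yb /le_trans; apply. Qed.

(** Closed initial segments are open in a well-order, so only the left end of a neighbourhood
    matters. *)
Lemma nbhs_woP (b : L) (P : set L) :
  nbhs b P <-> exists2 a, above a b & forall x, above a x -> (x <= b)%O -> P x.
Proof.
split=> [|[a ab abP]].
  rewrite itv_nbhsE => -[[l r] [/= iends ib] iP].
  case: l iends ib iP => [[] l|[]] //= iends ib iP.
  - exists (Some l) => /=; first by move: ib; rewrite in_itv /= => /andP[].
    move=> x lx xb; apply: iP => /=; move: ib; rewrite !in_itv /= lx /= => /andP[_].
    by case: r {iends} => [[] r|[]] //= br; [exact: le_lt_trans br|exact: le_trans br].
  - exists None => // x _ xb; apply: iP => /=; move: ib; rewrite !in_itv /=.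
    by case: r {iends} => [[] r|[]] //= br; [exact: le_lt_trans br|exact: le_trans br].
rewrite nbhsE; exists ([set x | above a x] `&` [set x | (x <= b)%O]).
  by split; [apply: openI; [exact: open_above|exact: open_le]|split => /=].
by move=> x [ax xb]; exact: abP.
Qed.

Lemma closed_woP (D : set L) : closed D <->
  forall m, (forall a, above a m -> exists x, [/\ D x, above a x & (x <= m)%O]) -> D m.
Proof.
split=> [cD m mD|mD m clm].
  apply: cD => B /nbhs_woP[a am aB]; have [x [Dx ax xm]] := mD a am.
  by exists x; split => //; exact: aB.
apply: mD => a am.
have [|x [Dx [ax xm]]] := clm [set x | above a x /\ (x <= m)%O]; last by exists x.
by apply/nbhs_woP; exists a.
Qed.

(** The map [j] is there so that the levels of [L0 W] are covered too. If a filter had no cluster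
    point, induction on [x] would give a member missing the image of [[0, x]]: a neighbourhood of
    [j x] treats [(a, x]], the induction hypothesis [[0, a]]. *)
Lemma compact_image_wo (X : topologicalType) (j : L -> X) (b : L) :
  (forall x (N : set X), (x <= b)%O -> nbhs (j x) N ->
     exists2 a, above a x & forall y, above a y -> (y <= x)%O -> N (j y)) ->
  compact (j @` [set x | (x <= b)%O]).
Proof.
move=> jc F PF Fb; apply: contrapT => noclus.
suff H x : (x <= b)%O -> exists2 B, F B & forall y, (y <= x)%O -> ~ B (j y).
  have [B FB BN] := H b (lexx b).
  have /filter_ex[z [Bz [y /= yb jy]]] : F (B `&` (j @` [set x | (x <= b)%O])).
    exact: filterI.
  by apply: (BN y yb); rewrite jy.
elim/wo_ind : x => x IH xb.
have : ~ cluster F (j x).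
  by move=> clx; apply: noclus; exists (j x); split => //; exists x.
move=> /existsNP[B] /existsNP[N] /not_implyP[FB] /not_implyP[Nx BN].
have [[a|] ax aN] := jc x N xb Nx.
  have [B' FB' B'N] := IH a ax (ltW (lt_le_trans ax xb)).
  exists (B `&` B'); first exact: filterI.
  move=> y yx [By B'y]; have [ya|ay] := leP y a; first exact: (B'N y ya).
  by apply: BN; exists (j y); split => //; exact: aN.
exists B => // y yx By; apply: BN; exists (j y); split => //; exact: aN.
Qed.

Lemma compact_le (b : L) : compact [set x | (x <= b)%O].
Proof.
rewrite -[X in compact X]image_id; apply: compact_image_wo => x N xb /nbhs_woP[a ax aN].
by exists a.
Qed.

(** The final parts of [A] generate a filter, and any cluster point of it is an upper bound. *)
Lemma compact_bounded_wo (A : set L) : compact A -> A !=set0 ->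
  exists b, forall x, A x -> (x <= b)%O.
Proof.
move=> cA [y0 Ay0]; apply: contrapT => /forallNP unb.
pose F := filter_from A (fun z => A `&` [set x | (z <= x)%O]).
have PF : ProperFilter F.
  apply: filter_from_proper; last by move=> z Az; exists z; split => /=.
  apply: filter_from_filter; first by exists y0.
  move=> z w Az Aw; case/orP: (le_total z w) => zw.
    by exists w => // x [Ax] /= wx; do !split => //=; exact: le_trans wx.
  by exists z => // x [Ax] /= zx; do !split => //=; exact: le_trans zx.
have FA : F A by exists y0 => // x [].
have [p [Ap clp]] := cA F PF FA.
have /existsNP[z /not_implyP[Az /negP]] := unb p; rewrite -ltNge => pz.
have [||x [[_ /= zx] xp]] := clp (A `&` [set x | (z <= x)%O]) [set x | (x <= p)%O].
- by exists z.
- by apply/nbhs_woP; exists None.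
- by move: (le_lt_trans (le_trans zx xp) pz); rewrite ltxx.
Qed.

Lemma compact_closed_wo (A : set L) : compact A -> closed A.
Proof.
move=> cA m clA; apply: contrapT => nAm.
pose F := filter_from [set a | above a m] (fun a => [set x | [/\ A x, above a x & (x <= m)%O]]).
have ex a : above a m -> exists x, [/\ A x, above a x & (x <= m)%O].
  move=> am; have [|x [Ax [ax xm]]] := clA [set x | above a x /\ (x <= m)%O].
    by apply/nbhs_woP; exists a.
  by exists x.
have PF : ProperFilter F.
  apply: filter_from_proper; last by move=> a /ex.
  apply: filter_from_filter; first by exists None.
  move=> a b am bm; have [c cm cab] := aboveI am bm.
  by exists c => // x [Ax /cab[ax bx] xm].
have FA : F A by exists None => // x [].
have [p [Ap clp]] := cA F PF FA.
have [pm|mp] := ltP p m.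
  have [||x [[_ px _] /= xp]] := clp [set x | [/\ A x, (p < x)%O & (x <= m)%O]] [set x | (x <= p)%O].
  - by exists (Some p).
  - by apply/nbhs_woP; exists None.
  - by move: px; rewrite /= ltNge xp.
have {}mp : (m < p)%O by rewrite lt_neqAle mp andbT; apply: contra_notN nAm => /eqP ->.
have [||x [[_ _ xm] /= mx]] := clp [set x | [/\ A x, true & (x <= m)%O]] [set x | (m < x)%O].
- by exists None.
- by apply/nbhs_woP; exists (Some m).
- by move: mx; rewrite ltNge xm.
Qed.

Lemma continuous_at_woP (K : numFieldType) (f : L -> K^o) (b : L) :
  {for b, continuous f} <-> forall e, 0 < e ->
  exists2 a, above a b & forall x, above a x -> (x <= b)%O -> `|f b - f x| < e.
Proof.
split=> [cf e e0|cf].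
  by have /cvgrPdist_lt/(_ _ e0) := cf; rewrite near_simpl => /nbhs_woP.
by apply/cvgrPdist_lt => e e0; rewrite near_simpl; apply/nbhs_woP; exact: cf.
Qed.

Lemma continuous_woP (K : numFieldType) (f : L -> K^o) : continuous f <->
  forall b e, 0 < e ->
  exists2 a, above a b & forall x, above a x -> (x <= b)%O -> `|f b - f x| < e.
Proof. by split=> cf b; apply/continuous_at_woP; exact: cf. Qed.

Lemma continuous_wo_locally (K : numFieldType) (f : L -> K^o) :
  (forall b, exists2 g : L -> K^o, continuous g & forall x, (x <= b)%O -> f x = g x) ->
  continuous f.
Proof.
move=> fg; apply/continuous_woP => b e e0; have [g /continuous_woP cg fgb] := fg b.
have [a ab ag] := cg b e e0; exists a => // x ax xb.
by rewrite !fgb// ag.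
Qed.

End well_ordered_space.

Section omega1.
Variables (d : Order.disp_t) (W : orderTopologicalType d).
Hypothesis W_omega1 : order_type_omega1 W.

Lemma omega1_wo : well_order (<=%O : rel W). Proof. by case: W_omega1. Qed.
Let wo := omega1_wo.

Lemma countable_below (a : W) : countable [set b | (b <= a)%O].
Proof.
have [_ _ /(_ a) ca] := W_omega1.
have -> : [set b | (b <= a)%O] =
    \bigcup_(i in [set: bool]) (if i then [set b | (b < a)%O] else [set a]).
  apply/seteqP; split => b /=.
    by rewrite le_eqVlt => /predU1P[->|ba]; [exists false|exists true].
  by case=> -[] _ /=; [exact: ltW|move=> ->].
by apply: bigcup_countable => // -[].
Qed.

(** Otherwise [W] would be a countable union of countable initial segments. *)
Lemma countable_bounded (S : set W) : countable S -> exists b, forall x, S x -> (x < b)%O.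
Proof.
move=> cS; apply: contrapT => /forallNP unb; have [_ + _] := W_omega1; apply.
apply: (@sub_countable _ _ _ (\bigcup_(a in S) [set b | (b <= a)%O])).
  apply: subset_card_le => b _; have /existsNP[x /not_implyP[Sx /negP]] := unb b.
  by rewrite -leNgt => bx; exists x.
by apply: bigcup_countable => // a _; exact: countable_below.
Qed.

Lemma seq_bounded (u : nat -> W) : exists b, forall n, (u n < b)%O.
Proof.
have [|b bP] := @countable_bounded (range u); last by exists b => n; apply: bP; exists n.
exact: sub_countable (card_image_le _ _) (countableP _).
Qed.

Lemma fun_bounded (h : W -> W) (a : W) :
  exists b, forall x, (x <= a)%O -> (h x < b)%O.
Proof.
have [|b bP] := @countable_bounded (h @` [set x | (x <= a)%O]).
  exact: sub_countable (card_image_le _ _) (countable_below a).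
by exists b => x xa; apply: bP; exists x.
Qed.

Lemma gt_exists (a : W) : exists b, (a < b)%O.
Proof. by have [b bP] := fun_bounded id a; exists b; exact: bP. Qed.

Lemma omega1_inhabited : exists _ : W, True.
Proof.
apply: contrapT => W0; have [_ + _] := W_omega1; apply.
by apply: (@sub_countable _ _ _ (@set0 W)) => //; apply: subset_card_le => x; case: W0; exists x.
Qed.

Lemma seq_sup (u : nat -> W) : {homo u : m n / (m < n)%N >-> (m < n)%O} ->
  exists2 m, (forall n, (u n < m)%O) &
    forall a, above a m -> exists n, above a (u n).
Proof.
move=> uincr; have [b bP] := seq_bounded u.
have [|m mP mle] := @wo_min _ _ wo [set m | forall n, (u n < m)%O]; first by exists b.
exists m => // -[a|] //= am; last by exists 0%N.
apply: contrapT => /forallNP ua; move: am; rewrite ltNge => /negP; apply.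
apply: mle => n; apply: (lt_le_trans (uincr n n.+1 _)) => //.
by rewrite leNgt; apply/negP.
Qed.

(** Closing off: iterate a function [g] that dominates [h] on initial segments; the supremum of the
    iterates is closed under [h]. *)
Lemma club_closed_under (h : W -> W) :
  club [set m | forall x, (x < m)%O -> (h x < m)%O].
Proof.
split.
  apply/(closed_woP wo) => m mP x xm; have [y [/= yP xy ym]] := mP (Some x) xm.
  exact: lt_le_trans (yP x xy) ym.
have /choice[g gP] (a : W) : exists b, (a < b)%O /\ forall x, (x <= a)%O -> (h x < b)%O.
  have [b bP] := fun_bounded h a; exists (Order.max b (sval (cid (gt_exists a)))).
  by split=> [|x xa]; rewrite lt_max ?(svalP (cid (gt_exists a))) ?orbT// bP.
move=> a; pose u n := iter n g (g a).
have uincr : {homo u : m n / (m < n)%N >-> (m < n)%O}.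
  by apply: homo_ltn => [x y z|n]; [exact: lt_trans|exact: (gP _).1].
have [m um mu] := seq_sup uincr; exists m; last exact: lt_trans (gP a).1 (um 0%N).
move=> x xm; have [n xn] := mu (Some x) xm.
exact: lt_trans ((gP (u n)).2 _ (ltW xn)) (um n.+1).
Qed.

(** Points of [D] and [E] are chosen alternately; their common supremum lies in both closed sets. *)
Lemma clubI (D E : set W) : club D -> club E -> club (D `&` E).
Proof.
move=> [cD uD] [cE uE]; split; first exact: closedI.
have /choice[g gP] (a : W) : exists b, D b /\ (a < b)%O by have [b] := uD a; exists b.
have /choice[h hP] (a : W) : exists b, E b /\ (a < b)%O by have [b] := uE a; exists b.
move=> a; pose u n := iter n (h \o g) a.
have uincr : {homo u : m n / (m < n)%N >-> (m < n)%O}.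
  apply: homo_ltn => [x y z|n]; first exact: lt_trans.
  exact: lt_trans (gP _).2 (hP _).2.
have [m um mu] := seq_sup uincr; exists m; last exact: um 0%N.
split.
  apply: (closed_woP wo D).1 => // c cm; have [n cn] := mu c cm.
  exists (g (u n)); split; first exact: (gP _).1.
    exact: above_le cn (ltW (gP _).2).
  exact: ltW (lt_trans (hP _).2 (um n.+1)).
apply: (closed_woP wo E).1 => // c cm; have [n cn] := mu c cm.
exists (u n.+1); split; [exact: (hP _).1| |exact: ltW].
exact: above_le cn (ltW (uincr n n.+1 _)).
Qed.

Lemma club_gt (t : W) : club [set x | (t < x)%O].
Proof.
split; last first.
  by move=> a; have [b] := gt_exists (Order.max a t); rewrite gt_max => /andP[]; exists b.
by apply/(closed_woP wo) => m /(_ None isT)[x [/= tx _ xm]]; exact: lt_le_trans xm.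
Qed.

Lemma clubW (D : set W) : club D -> exists x, D x.
Proof. by move=> [_ uD]; have [a _] := omega1_inhabited; have [b] := uD a; exists b. Qed.

End omega1.

(** * Functionals on spaces of continuous functions and their matrices *)

Section C0_basics.
Variables (K : numFieldType) (L : topologicalType).

Lemma C0_ext (f g : C0 K L) : f =1 g -> f = g.
Proof. by move=> fg; apply/val_inj/funext. Qed.

Definition C0_of (f : L -> K^o) (cf : continuous f)
    (vf : vanishes_at_infinity f) : C0 K L :=
  MkC0 (introT (C0_predP f) (conj cf vf)).

Lemma C0_norm_ge (f : C0 K L) (x : L) : `|f x| <= `|f|.
Proof. exact: le_sup_norm. Qed.

Lemma C0_norm_le (f : C0 K L) (M : K) :
  0 <= M -> (forall x, `|f x| <= M) -> `|f| <= M.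
Proof.
move=> M0 fM; have [[x _]|L0] := pselect (exists _ : L, True).
  by have [y fy _] := sup_normP f x; rewrite /Num.norm /= fy.
by rewrite /Num.norm /= sup_norm_empty// => x; apply: L0; exists x.
Qed.

Lemma C0E (f g : C0 K L) (a : K) (x : L) :
  [/\ (f + g) x = f x + g x, (a *: f) x = a * f x, (- f) x = - f x,
      (f - g) x = f x - g x & (0 : C0 K L) x = 0].
Proof. by []. Qed.

Lemma C0_sum (I : Type) (r : seq I) (P : pred I) (F : I -> C0 K L) (x : L) :
  (\sum_(i <- r | P i) F i) x = \sum_(i <- r | P i) F i x.
Proof. by elim/big_rec2 : _ => // i y z _ <-. Qed.

Lemma continuous_nbhsP (f : L -> K^o) : continuous f <->
  forall x e, 0 < e -> nbhs x [set y | `|f x - f y| < e].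
Proof.
split=> [cf x e e0|cf x]; first by have /cvgrPdist_lt/(_ _ e0) := cf x.
by apply/cvgrPdist_lt => e e0; exact: cf.
Qed.

End C0_basics.

Section operators_basics.
Variables (K : numFieldType).

Lemma op_bound (X Y : normedModType K) (T : bounded_op X Y) :
  exists2 M : K, 0 < M & forall x, `|T x| <= M * `|x|.
Proof.
have /linear_boundedP/pinfty_ex_gt0[M M0 TM] := op_bounded T.
by exists M.
Qed.

Lemma bounded_op_ex (X Y : normedModType K) (F : X -> Y) (M : K) :
  linear F -> (forall x, `|F x| <= M * `|x|) ->
  exists T : bounded_op X Y, forall x, T x = F x.
Proof.
move=> lF FM.
pose F' : {linear X -> Y} := HB.pack F (GRing.isLinear.Build K X Y *:%R F lF).
have bF : bounded_near F' (nbhs (0 : X)).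
  apply/bounded_funP => r; exists (`|M| * `|r|) => x xr.
  rewrite (le_trans (FM x))// (le_trans (real_ler_norm _))//.
    by rewrite ger0_real// (le_trans _ (FM x)).
  rewrite normrM normr_id ler_wpM2l// (le_trans xr)// real_ler_norm//.
  by rewrite ger0_real// (le_trans _ xr).
by exists (BoundedOp bF).
Qed.

Lemma dense_normP (X : normedModType K) (A : set X) :
  (forall x (e : K), 0 < e -> exists2 y, A y & `|x - y| < e) <-> dense A.
Proof.
split=> [Ad O [x Ox] oO|Ad x e e0].
  have /nbhs_ballP[e /= e0 eO] : nbhs x O by apply: open_nbhs_nbhs.
  have [y Ay xy] := Ad x e e0; exists y; split => //; apply: eO.
  by rewrite -ball_normE.
have [||y [xy Ay]] := Ad (ball x e).
- by exists x; exact: ballxx.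
- exact: ball_open.
- by exists y => //; move: xy; rewrite -ball_normE.
Qed.

End operators_basics.

(** * Restriction to the clopen intervals [(a, b]] *)

Section clip.
Variables (K : numFieldType) (d : Order.disp_t) (L : orderTopologicalType d).
Hypothesis wo : well_order (<=%O : rel L).

Definition clip_fun (a : option L) (b : L) (f : L -> K^o) (x : L) : K^o :=
  if above a x && (x <= b)%O then f x else 0.

Lemma clip_continuous a b (f : L -> K^o) : continuous f -> continuous (clip_fun a b f).
Proof.
move=> /(continuous_woP wo) cf; apply/(continuous_woP wo) => x e e0.
have [xb|bx] := leP x b; last first.
  exists (Some b) => // y /= by_ yx.
  by rewrite /clip_fun !leNgt bx by_ !andbF subrr normr0.
have [ax|nax] := boolP (above a x).
  have [c cx cfx] := cf x e e0; have [c' c'x c'P] := aboveI ax cx.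
  exists c' => // y /c'P[ay cy] yx.
  by rewrite /clip_fun ax xb ay (le_trans yx xb) /= cfx.
exists None => // y _ yx; rewrite /clip_fun (negbTE nax).
case: ifPn => [/andP[ay _]|]; last by rewrite subrr normr0.
by rewrite (above_le ay yx) in nax.
Qed.

Lemma vanishes_eventually (f : L -> K^o) (b : L) :
  (forall x, (b < x)%O -> f x = 0) -> vanishes_at_infinity f.
Proof.
move=> fb e e0; exists [set x | (x <= b)%O]; first exact: compact_le.
by move=> x /= /negP; rewrite -ltNge => /fb ->; rewrite normr0.
Qed.

Lemma clip_vanishes a b (f : L -> K^o) : vanishes_at_infinity (clip_fun a b f).
Proof.
by apply: (@vanishes_eventually _ b) => x bx; rewrite /clip_fun leNgt bx andbF.
Qed.

Lemma cst1_continuous : continuous (fun _ : L => 1 : K^o).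
Proof. by move=> x; exact: cvg_cst. Qed.

Fact clip_subproof a b (f : C0 K L) :
  {g : C0 K L | forall x, g x = if above a x && (x <= b)%O then f x else 0}.
Proof.
by exists (C0_of (@clip_continuous a b f (@C0_continuous _ _ f)) (@clip_vanishes a b f)).
Qed.

Fact box_subproof a b : {g : C0 K L | forall x, g x = (above a x && (x <= b)%O)%:R}.
Proof.
exists (C0_of (@clip_continuous a b _ cst1_continuous) (@clip_vanishes a b _)) => x.
by rewrite /= /clip_fun; case: ifP.
Qed.

Definition clip a b f : C0 K L := sval (clip_subproof a b f).

Definition box a b : C0 K L := sval (box_subproof a b).

Lemma clipE a b f x : clip a b f x = if above a x && (x <= b)%O then f x else 0.
Proof. exact: (svalP (clip_subproof a b f)). Qed.

Lemma boxE a b x : box a b x = (above a x && (x <= b)%O)%:R.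
Proof. exact: (svalP (box_subproof a b)). Qed.

End clip.

Lemma partial_sumE (I : choiceType) (V : zmodType) (g : I -> V) (A : {fset I}) :
  partial_sum g A = \sum_(x <- A) g x.
Proof. by rewrite /partial_sum (big_seq_fsetE _ _ xpredT). Qed.

Section absolutely_summable.
Variables (R : realType) (k : scalar_kind).
Local Notation K := (scalars R k).

(** [A0] comes within [e] of the supremum of all finite sums, so a disjoint [A] cannot add as much
    as [e]. *)
Lemma absolutely_summable_tail (L : topologicalType) (g : L -> K^o) (e : K) :
  absolutely_summable g -> 0 < e ->
  exists A0 : {fset L}, forall A : {fset L}, [disjoint A0 & A]%fset ->
    \sum_(x <- A) `|g x| < e.
Proof.
move=> [M gM] e0; pose s (A : {fset L}) := \sum_(x <- A) scalar_abs (g x).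
have sE (A : {fset L}) : \sum_(x <- A) `|g x| = scalar_of R k (s A).
  by rewrite rmorph_sum; apply: eq_bigr => x _; exact: normE.
have psE A : partial_sum (fun x => `|g x|) A = scalar_of R k (s A).
  by rewrite -sE /partial_sum -(big_seq_fsetE _ _ xpredT (fun x => `|g x|)).
have ubs : has_ubound (range s).
  exists (scalar_abs M) => _ [A _ <-]; rewrite -(ler_scalar_of k) -psE -normE.
  rewrite (le_trans (gM A))// real_ler_norm// ger0_real//.
  by rewrite (le_trans _ (gM fset0))// /partial_sum sumr_ge0.
have e'0 : 0 < scalar_abs e.
  by rewrite -(ltr_scalar_of k) rmorph0 -normE gtr0_norm.
have hs : has_sup (range s) by split => //; exists (s fset0), fset0.
have [_ [A0 _ <-] A0s] := sup_adherent e'0 hs.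
exists A0 => A dA; rewrite sE -(gtr0_norm e0) normE ltr_scalar_of.
have : s (A0 `|` A)%fset <= sup (range s) by apply: ub_le_sup => //; exists (A0 `|` A)%fset.
rewrite {1}/s (big_fsetID _ (mem A0)) /=.
have -> : [fset x in (A0 `|` A)%fset | x \in A0]%fset = A0.
  by apply/fsetP => x; rewrite !inE /=; case: (x \in A0); rewrite ?andbF.
have -> : [fset x in (A0 `|` A)%fset | x \notin A0]%fset = A.
  apply/fsetP => x; rewrite !inE /=; have [xA0|] := boolP (x \in A0); last by rewrite andbT.
  by rewrite andbF; apply/esym/negbTE; move/fdisjointP : dA => /(_ x xA0).
rewrite -/(s A0) -/(s A) -(ltrD2l (s A0)) => /le_lt_trans; apply.
by rewrite -ltrBlDr.
Qed.

End absolutely_summable.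

Section phase.
Variables (K : numFieldType).

Definition phase (z : K) : K := if z == 0 then 1 else `|z| / z.

Lemma phase_mul (z : K) : phase z * z = `|z|.
Proof.
by rewrite /phase; case: eqVneq => [->|z0]; rewrite ?mulr0 ?normr0// divfK.
Qed.

Lemma phase_norm (z : K) : `|phase z| = 1.
Proof.
rewrite /phase; case: eqVneq => [_|z0]; first exact: normr1.
by rewrite normrM normr_id normfV divff// normr_eq0.
Qed.

End phase.

(** * Functionals as absolutely summable families of point masses *)

Section representation.
Variables (R : realType) (k : scalar_kind).
Local Notation K := (scalars R k).
Variables (d : Order.disp_t) (L : orderTopologicalType d).
Hypothesis wo : well_order (<=%O : rel L).
Local Notation X := (C0 K L).
Local Notation box := (@box K d L wo).
Local Notation clip := (clip wo).

Definition refines (a a' : option L) := forall x : L, above a' x -> above a x.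

(** With [phi] regarded as a measure, this is its mass at [b]: the limit of the masses of [(a, b]]
    as the cut moves up to [b]. *)
Definition is_coef (phi : X -> K^o) (b : L) (z : K) :=
  forall e, 0 < e -> exists2 a, above a b &
    forall a', above a' b -> refines a a' -> `|phi (box a' b) - z| < e.

Lemma is_coef_unique phi b z z' : is_coef phi b z -> is_coef phi b z' -> z = z'.
Proof.
move=> hz hz'; apply/eqP; rewrite -subr_eq0 -normr_le0; apply/ler_addgt0Pr => e e0.
have e20 : 0 < e / 2 by rewrite divr_gt0.
have [a ab az] := hz _ e20; have [a' a'b az'] := hz' _ e20.
have [c cb ca] := aboveI ab a'b.
have h := az c cb (fun x cx => (ca x cx).1); have h' := az' c cb (fun x cx => (ca x cx).2).
have -> : z - z' = (phi (box c b) - z') - (phi (box c b) - z) by ring.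
by rewrite add0r [e]splitr (le_trans (ler_normB _ _))// ltW// ltrD.
Qed.

Lemma box_boxB_norm a a' b : refines a a' -> forall x,
  `|(box a b - box a' b) x| = (above a x && ~~ above a' x && (x <= b)%O)%:R.
Proof.
move=> aa' x; have [_ _ _ -> _] := C0E (box a b) (box a' b) 0 x; rewrite !boxE.
have [a'x|na'x] := boolP (above a' x).
  by rewrite (aa' _ a'x) /= subrr normr0.
by rewrite /= subr0 andbT normr_nat.
Qed.

(** A gliding hump. Without a limit there are disjoint intervals below [b] on whose indicators [phi]
    has modulus at least [e]; a unimodular combination of [n] of them has norm at most 1 and value
    at least [e *+ n]. *)
Lemma coef_exists (phi : functional X) b : exists z, is_coef phi b z.
Proof.
have [M M0 phiM] := op_bound phi.
pose F := filter_from [set a : option L | above a b]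
  (fun a => [set z : K^o | exists a', [/\ above a' b, refines a a' & z = phi (box a' b)]]).
have PF : ProperFilter F.
  apply: filter_from_proper; last by move=> a ab; exists (phi (box a b)), a; split.
  apply: filter_from_filter; first by exists None.
  move=> a a' ab a'b; have [c cb cP] := aboveI ab a'b.
  exists c => // z [e [eb ce ->]]; split; exists e; split => //.
    by move=> x /ce/cP[].
  by move=> x /ce/cP[].
suff Fc : cauchy F.
  have /cvg_ex[/= z /fcvgrPdist_lt Fz] := scalar_complete PF Fc.
  exists z => e /Fz [a /= ab aP]; exists a => // a' a'b aa'.
  by rewrite distrC; apply: aP; exists a'.
apply: cauchy_exP => e e0; apply: contrapT => /forallNP nc.
have step a : above a b -> exists2 a', above a' b &
    refines a a' /\ e <= `|phi (box a b - box a' b)|.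
  move=> ab; apply: contrapT => /forall2NP h; apply: (nc (phi (box a b) : K^o)).
  exists a => //= _ [a' [a'b aa' ->]]; rewrite -ball_normE /=.
  have [//|/not_andP[//|/negP nle]] := h a'.
  by rewrite real_ltNge ?normr_real ?gtr0_real// -linearB.
(* The cut [a] records where [f] has stopped, so the next hump is added without raising the norm. *)
have iter (n : nat) : exists2 a, above a b & exists f : X,
    [/\ forall x, `|f x| <= 1, forall x, above a x -> f x = 0 & e *+ n <= phi f].
  elim: n => [|n [a ab [f [f1 fa phif]]]].
    exists None => //; exists 0; split => //; last by rewrite linear0 mulr0n.
    by move=> x; rewrite normr0.
  have [a' a'b [aa' ephi]] := step a ab; exists a' => //.
  set h := box a b - box a' b in ephi.
  have hE x := @box_boxB_norm a a' b aa' x; rewrite -/h in hE.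
  exists (f + phase (phi h) *: h); split.
  - move=> x; have [-> _ _ _ _] := C0E f (phase (phi h) *: h) 0 x.
    have [_ -> _ _ _] := C0E h 0 (phase (phi h)) x.
    have [ax|nax] := boolP (above a x).
      by rewrite fa// add0r normrM phase_norm mul1r hE lern1 leq_b1.
    have -> : h x = 0 by apply/normr0_eq0; rewrite hE (negbTE nax).
    by rewrite mulr0 addr0.
  - move=> x a'x; have [-> _ _ _ _] := C0E f (phase (phi h) *: h) 0 x.
    have [_ -> _ _ _] := C0E h 0 (phase (phi h)) x.
    have -> : h x = 0 by apply/normr0_eq0; rewrite hE a'x andbF.
    by rewrite fa ?mulr0 ?addr0//; exact: aa'.
  - by rewrite linearD linearZ /= [_ *: _]phase_mul mulrSr lerD.
have [n nM] := scalar_natr_gt (M / e).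
have [a ab [f [f1 _ phif]]] := iter n.
have en : e *+ n <= M.
  rewrite (le_trans phif)// -[leLHS]ger0_norm.
    by rewrite (le_trans (phiM f))// ler_piMr ?(ltW M0)// C0_norm_le.
  by rewrite (le_trans _ phif)// mulrn_wge0// ltW.
move: nM; rewrite gtr0_norm ?divr_gt0// ltr_pdivrMr// mulr_natl => /(le_lt_trans en).
by rewrite ltxx.
Qed.

Lemma cut_below_finite (A : seq L) (x : L) :
  exists2 a, above a x & forall y, y \in A -> above a y -> (x <= y)%O.
Proof.
elim: A => [|z A [a ax aA]]; first by exists None.
have [xz|zx] := leP x z.
  by exists a => // y; rewrite inE => /predU1P[->|/aA].
have [c cx cP] := aboveI ax (zx : above (Some z) x).
exists c => // y; rewrite inE => /predU1P[->|yA] cy; last exact: aA (cP _ cy).1.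
by have := (cP _ cy).2; rewrite /= ltxx.
Qed.

(** The norm bound [M] of [phi] bounds all finite sums: test [phi] on a unimodular combination of
    indicators of disjoint intervals ending at the points of [A]. *)
Lemma coef_summable (phi : functional X) (g : L -> K^o) :
  (forall b, is_coef phi b (g b)) -> absolutely_summable g.
Proof.
move=> gP; have [M M0 phiM] := op_bound phi; exists M => A.
rewrite (partial_sumE (fun x => `|g x|)); apply/ler_addgt0Pr => e e0.
pose e1 := e / (size A).+1%:R; have e10 : 0 < e1 by rewrite divr_gt0.
(* The cut [a x] leaves the points of [A] before [x] to its left, which makes the intervals of
   distinct points of [A] disjoint. *)
have /choice[a aP] x : exists a, [/\ above a x,
    forall y, y \in (A : seq L) -> above a y -> (x <= y)%O & `|phi (box a x) - g x| < e1].
  have [a ax aA] := cut_below_finite A x; have [a' a'x a'P] := gP x _ e10.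
  have [c cx cP] := aboveI ax a'x; exists c; split => //.
    by move=> y yA /cP[ay _]; exact: aA.
  by apply: a'P => // y /cP[].
pose f := \sum_(x <- A) phase (g x) *: box (a x) x.
have f1 : `|f| <= 1.
  apply: C0_norm_le => // p; rewrite /f C0_sum.
  under eq_bigr do rewrite C0Z.
  have [/hasP[x xA xp]|/hasPn nA] := boolP (has (fun x => above (a x) p && (p <= x)%O) A).
    rewrite (big_fsetD1 x xA) big1_seq /=.
      by rewrite addr0 normrM phase_norm mul1r boxE xp normr1.
    move=> y /=; rewrite !inE => /andP[yx yA].
    rewrite boxE; have [/andP[ayp py]|_] := boolP (above (a y) p && (p <= y)%O);
      last by rewrite mulr0.
    have /andP[axp px] := xp; have [_ axA _] := aP x; have [_ ayA _] := aP y.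
    have xy : x = y.
      apply/le_anti/andP; split.
        by apply: axA yA _; exact: above_le axp py.
      by apply: ayA xA _; exact: above_le ayp px.
    by rewrite xy eqxx in yx.
  rewrite big1_seq ?normr0// => y /andP[_ yA].
  by rewrite boxE (negbTE (nA y yA)) mulr0.
have -> : \sum_(x <- A) `|g x| = `|phi f -
    \sum_(x <- A) phase (g x) * (phi (box (a x) x) - g x)|.
  rewrite -[LHS]ger0_norm ?sumr_ge0//; congr (`|_|).
  rewrite /f linear_sum -sumrB; apply: eq_bigr => x _.
  by rewrite linearZ /= mulrBr opprB addrC subrK phase_mul.
rewrite (le_trans (ler_normB _ _))// lerD//.
  by rewrite (le_trans (phiM f))// ler_piMr// ltW.
rewrite (le_trans (ler_norm_sum _ _ _))//.
rewrite (@le_trans _ _ (\sum_(x <- A) e1))//.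
  apply: ler_sum => x _; have [_ _ xe1] := aP x.
  by rewrite normrM phase_norm mul1r ltW.
rewrite big_const_seq iter_addr_0 count_predT -mulr_natr.
by rewrite mulrAC ler_pdivrMr// ler_wpM2l ?(ltW e0)// ler_nat.
Qed.

Lemma cut_continuous (f : X) b (e : K) : 0 < e -> exists2 a, above a b &
  forall x, above a x -> (x <= b)%O -> `|f b - f x| < e.
Proof. by have /(continuous_woP wo) := @C0_continuous _ _ f; exact. Qed.

Lemma summable_left_tail (g : L -> K^o) b (e : K) : absolutely_summable g -> 0 < e ->
  exists2 a, above a b & forall A : {fset L},
    \sum_(x <- A | above a x && (x < b)%O) `|g x| < e.
Proof.
move=> gs e0; have [A0 A0P] := absolutely_summable_tail gs e0.
have [a ab aA0] := cut_below_finite A0 b; exists a => // A.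
rewrite big_fset_condE; apply: A0P; apply/fdisjointP => x xA0.
rewrite !inE /= negb_and; apply/orP; right; apply/negP => /andP[ax].
by rewrite ltNge aA0.
Qed.

(** Transfinite induction on [b]. On a short interval [(a, b]] the function is nearly [f b] and the
    masses strictly inside are small, so the contribution is nearly [g b * f b]; the part up to [a]
    is the induction hypothesis. *)
Lemma coef_sum_clip (phi : functional X) (g : L -> K^o) (f : X) b :
  (forall b, is_coef phi b (g b)) -> forall e, 0 < e ->
  exists A0 : {fset L}, forall A : {fset L}, (A0 `<=` A)%fset ->
    `|\sum_(x <- A | (x <= b)%O) g x * f x - phi (clip None b f)| < e.
Proof.
move=> gP; have [M M0 phiM] := op_bound phi.
have gs := coef_summable gP.
elim/(wo_ind wo) : b => b IH e e0.
(* Three errors, each scaled by [e1]: the oscillation of [f] costs [M], the error in the mass at [b]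
   and the masses strictly inside cost the norm of [f] each. The 1 makes the total strict. *)
pose N := M + (`|f| + `|f|) + 1.
have N0 : 0 < N by rewrite ltr_wpDl// !addr_ge0// ltW.
pose e1 := e / 2 / N; have e10 : 0 < e1 by rewrite !divr_gt0.
have e1N : e1 * M + e1 * `|f| + e1 * `|f| < e / 2.
  rewrite -!mulrDr -addrA [ltRHS](_ : _ = e1 * N); last by rewrite /e1 divfK// gt_eqF.
  by rewrite ltr_pM2l// ltrDl.
have [a1 a1b a1P] := gP b _ e10; have [a2 a2b a2P] := cut_continuous f b e10.
have [a3 a3b a3P] := summable_left_tail b gs e10.
have [a12 a12b a12P] := aboveI a1b a2b; have [a ab aP] := aboveI a12b a3b.
have [A1 A1P] : exists A1 : {fset L}, forall A : {fset L}, (A1 `<=` A)%fset ->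
    `|\sum_(x <- A | ~~ above a x && (x <= b)%O) g x * f x -
      (phi (clip None b f) - phi (clip a b f))| < e / 2.
  case: a {aP} ab => [a|] /= ab; last first.
    by exists fset0 => A _; rewrite big_pred0// !subrr normr0 divr_gt0.
  have [|A1 A1P] := IH a ab (e / 2); first by rewrite divr_gt0.
  exists A1 => A /A1P.
  have -> : clip None a f = clip None b f - clip (Some a) b f.
    apply: C0_ext => x; have [_ _ _ -> _] := C0E (clip None b f) (clip (Some a) b f) 0 x.
    rewrite !clipE /=; have [xa|ax] := leP x a; last by case: leP => _; rewrite subrr.
    by rewrite (le_trans xa (ltW ab)) subr0.
  rewrite linearB; congr (`|_ - _| < _); apply: eq_bigl => x /=.
  by case: leP => // xa; rewrite (le_trans xa (ltW ab)).
exists (b |` A1)%fset => A; rewrite fsubUset fsub1set => /andP[bA /A1P A1A].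
pose S1 := \sum_(x <- A | ~~ above a x && (x <= b)%O) g x * f x.
pose S2 := \sum_(x <- A | above a x && (x < b)%O) g x * f x.
have -> : \sum_(x <- A | (x <= b)%O) g x * f x = S1 + S2 + g b * f b.
  rewrite (bigID (above a)) /= addrC /S1 -addrA; congr (_ + _).
    by apply: eq_bigl => x; rewrite andbC.
  rewrite big_mkcond (bigD1_seq b bA (fset_uniq A)) /= lexx ab addrC; congr (_ + _).
  rewrite -big_mkcondr; apply: eq_bigl => x /=.
  by rewrite lt_neqAle; case: (above a x); case: (x != b); case: (x <= b)%O.
have S2e : `|S2| <= e1 * `|f|.
  rewrite (le_trans (ler_norm_sum _ _ _))//.
  rewrite (@le_trans _ _ (\sum_(x <- A | above a x && (x < b)%O) `|g x| * `|f|))//.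
    by apply: ler_sum => x _; rewrite normrM ler_wpM2l// C0_norm_ge.
  rewrite -mulr_suml ler_wpM2r// (le_trans _ (ltW (a3P A)))//.
  rewrite big_mkcond [leRHS]big_mkcond; apply: ler_sum => x _.
  case: ifPn => [/andP[ax xb]|_]; last by case: ifP.
  by have [_ ->] := aP x ax; rewrite xb.
have S3e : `|g b * f b - phi (clip a b f)| <= e1 * M + e1 * `|f|.
  have -> : g b * f b - phi (clip a b f) =
      phi (f b *: box a b - clip a b f) - f b * (phi (box a b) - g b).
    by rewrite linearB linearZ /= /GRing.scale /=; ring.
  rewrite (le_trans (ler_normB _ _))// lerD//.
    rewrite (le_trans (phiM _))// mulrC ler_wpM2r ?(ltW M0)//.
    apply: C0_norm_le => [|x]; first exact: ltW.
    have [_ _ _ -> _] := C0E (f b *: box a b) (clip a b f) 0 x.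
    rewrite C0Z boxE clipE; have [/andP[ax xb]|_] := boolP (above a x && (x <= b)%O).
      by rewrite mulr1 ltW// a2P//; have [/a12P[]] := aP x ax.
    by rewrite mulr0 subrr normr0 ltW.
  rewrite normrM mulrC ler_pM// ?C0_norm_ge// ltW// a1P//.
  by move=> x ax; have [/a12P[]] := aP x ax.
have -> : S1 + S2 + g b * f b - phi (clip None b f) =
  (S1 - (phi (clip None b f) - phi (clip a b f))) + S2 +
  (g b * f b - phi (clip a b f)) by ring.
rewrite (le_lt_trans (ler_normD _ _))//.
rewrite (le_lt_trans (lerD (ler_normD _ _) (lexx _)))//.
rewrite -addrA [e]splitr ltr_leD//.
rewrite (le_trans (lerD S2e S3e))//.
by rewrite addrCA addrA ltW.
Qed.

Lemma represents_coef (phi : functional X) (g : L -> K^o) :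
  (forall f : X, exists b, forall x, (b < x)%O -> f x = 0) ->
  (forall b, is_coef phi b (g b)) -> represents phi g.
Proof.
move=> ez gP; split; first exact: coef_summable gP.
move=> f; have [b fb] := ez f; apply/cvgrPdist_lt => e e0.
have [A0 A0P] := coef_sum_clip f b gP e0; exists A0 => // A /A0P.
rewrite distrC.
have -> : clip None b f = f.
  by apply: C0_ext => x; rewrite clipE /=; case: leP => // /fb ->.
rewrite partial_sumE big_mkcond /=; congr (`|_ - _| < _); apply: eq_bigr => x _.
by case: leP => // /fb ->; rewrite mulr0.
Qed.

(** Besides [g b], the indicator of a short [(a', b]] sees only a small tail of [g]. Hence
    representations are unique and [coefficients] can be computed from any of them. *)
Lemma represents_is_coef (phi : X -> K^o) (g : L -> K^o) b :
  represents phi g -> is_coef phi b (g b).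
Proof.
move=> [gs gphi] e e0; have e20 : 0 < e / 2 by rewrite divr_gt0.
have [a ab aP] := summable_left_tail b gs e20; exists a => // a' a'b aa'.
have /cvgrPdist_lt/(_ _ e20) := gphi (box a' b).
move=> [A0 _ A0P]; have := A0P (b |` A0)%fset (fsubsetU1 _ _).
set s := partial_sum _ _ => phis.
have sgb : `|s - g b| <= e / 2.
  rewrite /s partial_sumE; under eq_bigr do rewrite boxE.
  rewrite (bigD1_seq b (fset1U1 _ _) (fset_uniq _)) /= a'b lexx mulr1 addrAC subrr add0r.
  rewrite (le_trans (ler_norm_sum _ _ _))// (le_trans _ (ltW (aP (b |` A0)%fset)))//.
  rewrite big_mkcond [leRHS]big_mkcond; apply: ler_sum => x _.
  have [->|xb] := eqVneq x b; first by rewrite ltxx andbF.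
  rewrite lt_neqAle xb /=; case: (boolP (above a' x)) => [/aa' ->|_] /=.
    by case: leP; rewrite ?mulr1 ?mulr0 ?normr0.
  by rewrite mulr0 normr0; case: ifP.
have -> : phi (box a' b) - g b = (phi (box a' b) - s) + (s - g b) by ring.
by rewrite (le_lt_trans (ler_normD _ _))// [e]splitr ltr_leD.
Qed.

Lemma coefficientsE (phi : X -> K^o) (g : L -> K^o) :
  represents phi g -> coefficients phi = g.
Proof.
move=> rg; apply/funext => b; apply: (@is_coef_unique phi b).
  exact: represents_is_coef (xgetPex _ (ex_intro _ g rg)).
exact: represents_is_coef.
Qed.

End representation.

Section matrix_rows.
Variables (R : realType) (k : scalar_kind).
Local Notation K := (scalars R k).
Variables (d : Order.disp_t) (L : orderTopologicalType d).
Hypothesis wo : well_order (<=%O : rel L).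
Hypothesis C0_eventually0 : forall f : C0 K L, exists b, forall x, (b < x)%O -> f x = 0.

Lemma op_eval_ex (X : normedModType K) (T : bounded_op X (C0 K L)) (b : L) :
  exists phi : functional X, forall f, phi f = T f b.
Proof.
have [M M0 TM] := op_bound T.
apply: (@bounded_op_ex _ X (K^o) (fun f => T f b) M) => [a f g|f].
  by rewrite linearD linearZ.
exact: le_trans (C0_norm_ge _ _) (TM f).
Qed.

(** Eventual vanishing holds on [W] by uncountable cofinality and on [with_top W] trivially, so both
    spaces are covered. *)
Lemma matrix_row (T : bounded_op (C0 K L) (C0 K L)) (b : L) :
  represents (point_evaluation b \o T) (matrix_entry T b).
Proof.
have [phi phiE] := op_eval_ex T b.
have phiT : (phi : _ -> _) = point_evaluation b \o T by exact/funext.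
rewrite -phiT.
have /choice[g gP] b' := coef_exists wo phi b'.
have rg : represents phi g by exact: represents_coef.
rewrite (_ : matrix_entry T b = coefficients phi).
  exact: xgetPex _ (ex_intro _ g rg).
by apply/funext => c; rewrite /matrix_entry -phiT.
Qed.

End matrix_rows.

(** * The Alspach--Benyamini character *)

Section omega1_operators.
Variables (R : realType) (k : scalar_kind).
Local Notation K := (scalars R k).
Variables (d : Order.disp_t) (W : orderTopologicalType d).
Hypothesis W_omega1 : order_type_omega1 W.
Let wo := omega1_wo W_omega1.
Local Notation X := (C0 K W).

Lemma scalar_eq0 (z : K) : (forall n : nat, `|z| < n.+1%:R^-1) -> z = 0.
Proof.
move=> zn; apply: contrapT => /eqP; rewrite -normr_gt0 => z0.
have [n zn'] := scalar_inv_natr_lt z0; have := lt_trans zn' (zn n); by rewrite ltxx.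
Qed.

Lemma C0_omega1_eventually0 (f : X) : exists b, forall x, (b < x)%O -> f x = 0.
Proof.
have /choice[u uP] (n : nat) : exists b, forall x, (b < x)%O -> `|f x| < n.+1%:R^-1.
  have [|A cA fA] := @C0_vanish _ _ f (n.+1%:R^-1); first by rewrite invr_gt0.
  have [A0|A0] := pselect (A !=set0).
    have [b bA] := compact_bounded_wo wo cA A0; exists b => x bx; apply: fA => /bA.
    by rewrite leNgt bx.
  have [b _] := omega1_inhabited W_omega1; exists b => x bx; apply: fA => Ax.
  by apply: A0; exists x.
have [b ub] := seq_bounded W_omega1 u; exists b => x bx; apply: scalar_eq0 => n.
by apply: uP; exact: lt_trans bx.
Qed.

Lemma summable_support (g : W -> K^o) : absolutely_summable g ->
  exists h, forall x, (h < x)%O -> g x = 0.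
Proof.
move=> gs; have /choice[A AP] (n : nat) : exists A0 : {fset W}, forall A : {fset W},
    [disjoint A0 & A]%fset -> \sum_(x <- A) `|g x| < n.+1%:R^-1.
  by apply: absolutely_summable_tail; rewrite // invr_gt0.
have [|h hP] := @countable_bounded _ _ W_omega1 (\bigcup_n [set` A n]).
  by apply: bigcup_countable => // n _; exact: countable_fset.
exists h => x hx; apply: scalar_eq0 => n.
have := AP n [fset x]%fset; rewrite big_seq_fset1; apply.
rewrite fdisjointX1; apply/negP => xA.
by have /hP : (\bigcup_n [set` A n]) x; [exists n|rewrite ltNge (ltW hx)].
Qed.

(** A row is absolutely summable, so its support is countable and lies below some [h]. *)
Lemma op_row_support (T : bounded_op X X) (b : W) :
  exists h, forall f : X, (forall x, (x <= h)%O -> f x = 0) -> T f b = 0.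
Proof.
have [gs gT] := matrix_row wo C0_omega1_eventually0 T b.
have [h hP] := summable_support gs; exists h => f f0.
apply/eqP; rewrite -normr_le0; apply/ler_addgt0Pr => e e0; rewrite add0r.
have /cvgrPdist_lt/(_ _ e0)[A0 _ A0P] := gT f.
have := A0P A0 (fsubset_refl _); rewrite /= partial_sumE big1 ?subr0 => [/ltW//|x _].
by have [xh|hx] := leP x h; [rewrite f0// mulr0|rewrite hP// mul0r].
Qed.

Lemma op_rows_support (T : bounded_op X X) (a : W) :
  exists h, forall f : X, (forall x, (x <= h)%O -> f x = 0) ->
    forall b, (b <= a)%O -> T f b = 0.
Proof.
have /choice[h hP] b := op_row_support T b.
have [H HP] := fun_bounded W_omega1 h a; exists H => f f0 b ba.
by apply: hP => x xh; apply: f0; rewrite (le_trans xh)// ltW// HP.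
Qed.

(** If oscillations of a fixed size occurred beyond every point, closing off would produce a point
    [m] with such oscillations arbitrarily close below it, against continuity at [m]. *)
Lemma continuous_eventually_cst (s : W -> K^o) : continuous s ->
  exists t, exists c, forall x, (t < x)%O -> s x = c.
Proof.
move=> cs; have /choice[u uP] (n : nat) : exists t, forall x y, (t < x)%O -> (t < y)%O ->
    `|s x - s y| < n.+1%:R^-1.
  apply: contrapT => /forallNP nt.
  have /choice[h hP] t : exists z, [/\ (t < z)%O & exists x y,
      [/\ (t < x)%O, (t < y)%O, (x < z)%O, (y < z)%O & ~ `|s x - s y| < n.+1%:R^-1]].
    have /existsNP[x /existsNP[y /not_implyP[tx /not_implyP[ty sxy]]]] := nt t.
    have [z] := gt_exists W_omega1 (Order.max x y); rewrite gt_max => /andP[xz yz].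
    by exists z; split; [exact: lt_trans xz|exists x, y].
  have [w _] := omega1_inhabited W_omega1.
  (* Below [m] there is a bad pair beyond any [a']. Also [m] exceeds [w], which serves as [a'] when
     the neighbourhood has no left end. *)
  have [m [mh wm]] := clubW W_omega1 (clubI W_omega1 (club_closed_under W_omega1 h)
    (club_gt W_omega1 w)).
  have e0 : (0 : K) < n.+1%:R^-1 / 2 by rewrite divr_gt0// invr_gt0.
  have /(continuous_woP wo)/(_ m _ e0)[a am aP] := cs.
  have [a' [aa' a'm]] : exists a', (forall x, (a' < x)%O -> above a x) /\ (a' < m)%O.
    case: a am aP => [a|] /= am aP; first by exists a.
    by exists w.
  have [_ [x [y [ax ay xh yh]]]] := hP a'; apply.
  have hm := mh a' a'm.
  have -> : s x - s y = (s m - s y) - (s m - s x) by ring.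
  rewrite (le_lt_trans (ler_normB _ _))// [ltRHS]splitr ltrD//.
    by apply: aP; [exact: aa'|exact: ltW (lt_trans yh hm)].
  by apply: aP; [exact: aa'|exact: ltW (lt_trans xh hm)].
have [t tP] := seq_bounded W_omega1 u; have [x0 tx0] := gt_exists W_omega1 t.
exists t, (s x0) => x tx; apply/eqP; rewrite -subr_eq0; apply/eqP.
by apply: scalar_eq0 => n; apply: uP; exact: lt_trans (tP n) _.
Qed.

Local Notation box := (@box K d W wo).
Local Notation ibox b := (box None b).

(** Since [h x] bounds the supports of the rows up to [x], the witness is a full row sum. On an
    initial segment one late indicator gives all these sums at once, whence continuity. *)
Lemma op_row_sums (T : bounded_op X X) : exists2 s : W -> K^o, continuous s &
  forall a, exists h, forall b x, (h <= b)%O -> (x <= a)%O -> T (ibox b) x = s x.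
Proof.
have /choice[h hP] b := op_rows_support T b.
have sP a b x : (h a <= b)%O -> (x <= a)%O -> T (ibox b) x = T (ibox (h x)) x.
  move=> hab xa.
  have agree c c' y : (h y <= c)%O -> (h y <= c')%O -> T (ibox c) y = T (ibox c') y.
    move=> hc hc'; apply/eqP; rewrite -subr_eq0; apply/eqP.
    have [_ _ _ <- _] := C0E (T (ibox c)) (T (ibox c')) 0 y; rewrite -linearB.
    apply: (hP y) => // z zh; have [_ _ _ -> _] := C0E (ibox c) (ibox c') 0 z.
    by rewrite !boxE /= (le_trans zh hc) (le_trans zh hc') subrr.
  pose c := Order.max b (h x).
  transitivity (T (ibox c) x); last by apply: agree; rewrite ?le_max ?lexx ?orbT.
  apply/eqP; rewrite -subr_eq0; apply/eqP.
  have [_ _ _ <- _] := C0E (T (ibox b)) (T (ibox c)) 0 x; rewrite -linearB.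
  apply: (hP a) => // z zh; have [_ _ _ -> _] := C0E (ibox b) (ibox c) 0 z.
  by rewrite !boxE /= le_max (le_trans zh hab) subrr.
exists (fun x => T (ibox (h x)) x); last by move=> a; exists (h a) => b x; exact: sP.
apply: (continuous_wo_locally wo) => b; exists (T (ibox (h b))); first exact: C0_continuous.
by move=> x xb; rewrite -(sP b (h b)).
Qed.

Definition op_character (T : bounded_op X X) (c : K) :=
  exists2 D : set W, club D & forall (f : X) (a : W), D a -> T f a = c * f a.

Lemma op_character_unique T c c' : op_character T c -> op_character T c' -> c = c'.
Proof.
move=> [D cD DP] [D' cD' D'P].
have [a [Da D'a]] := clubW W_omega1 (clubI W_omega1 cD cD').
by have := DP (ibox a) a Da; rewrite (D'P _ _ D'a) boxE /= lexx !mulr1.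
Qed.

(** At [a] closed under [h] and [h'], columns beyond [a] vanish because earlier rows do not reach
    them and [T f] is continuous at [a]; columns before [a] vanish because [T (ibox b)] has died
    out. Row [a] is thus diagonal, and its entry is the row sum [c]. *)
Lemma op_character_ex (T : bounded_op X X) : exists s : W -> K^o, exists c t,
  [/\ op_character T c, forall x, (t < x)%O -> s x = c &
      forall a, exists h, forall b x, (h <= b)%O -> (x <= a)%O -> T (ibox b) x = s x].
Proof.
have [s cs sP] := op_row_sums T; have [t [c tc]] := continuous_eventually_cst cs.
exists s, c, t; split => //.
have /choice[h hP] b := op_rows_support T b.
have /choice[h' h'P] b := C0_omega1_eventually0 (T (ibox b)).
have /choice[g gP] b : exists z, [/\ (b < z)%O, (h b < z)%O & (h' b < z)%O].
  have [z] := gt_exists W_omega1 (Order.max b (Order.max (h b) (h' b))).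
  by rewrite !gt_max => /andP[bz /andP[hz h'z]]; exists z.
exists ([set x | forall y, (y < x)%O -> (g y < x)%O] `&` [set x | (t < x)%O]).
  exact: clubI (club_closed_under _ _) (club_gt _ _).
move=> f a [/= ag ta].
(* Being closed under [g] and above [t], the point [a] is a limit of smaller points, so continuity
   carries zeros up to it. *)
have lim0 (f' : X) : (forall x, (x < a)%O -> T f' x = 0) -> T f' a = 0.
  move=> f'0; apply/eqP; rewrite -normr_le0; apply/ler_addgt0Pr => e e0.
  have [u ua uP] := cut_continuous wo (T f') a e0.
  have [v [uv va]] : exists v, above u v /\ (v < a)%O.
    case: u ua uP => [u|] /= ua _; last by exists t.
    by exists (g u); split; [have [] := gP u|exact: ag].
  by have := uP v uv (ltW va); rewrite (f'0 v va) subr0 add0r => /ltW.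
have T_far (f' : X) : (forall x, (x <= a)%O -> f' x = 0) -> T f' a = 0.
  move=> f'0; apply: lim0 => x xa; apply: (hP x) => // y yh; apply: f'0.
  have [_ hg _] := gP x; exact: ltW (le_lt_trans yh (lt_trans hg (ag x xa))).
have T_near b : (b < a)%O -> T (ibox b) a = 0.
  by move=> ba; apply: h'P; have [_ _ h'g] := gP b; exact: lt_trans (ag b ba).
have [phi phiE] := op_eval_ex T a.
have rT := matrix_row wo C0_omega1_eventually0 T a.
have coef0 b : b != a -> matrix_entry T a b = 0.
  move=> ba; apply: (@is_coef_unique _ _ _ _ wo (point_evaluation a \o T) b).
    exact: represents_is_coef.
  move=> e e0.
  have [ba'|ab] := ltP b a.
    exists None => // u ub _.
    suff -> : box u b = ibox b - (if u is Some u' then ibox u' else 0).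
      rewrite /point_evaluation /= linearB.
      have [_ _ _ -> _] := C0E (T (ibox b)) (T (if u is Some u' then ibox u' else 0)) 0 a.
      rewrite T_near// sub0r; case: u ub => [u|] /= ub; last first.
        by rewrite linear0 subr0 oppr0 normr0.
      by rewrite T_near ?(lt_trans ub)// oppr0 addr0 normr0.
    apply: C0_ext => x.
    have [_ _ _ -> _] := C0E (ibox b) (if u is Some u' then ibox u' else 0) 0 x.
    case: u ub => [u|] /= ub; last by rewrite boxE subr0.
    rewrite !boxE /=; have [xu|ux] := leP x u; last by rewrite subr0.
    by rewrite (le_trans xu (ltW ub)) subrr.
  have {ba}ab : (a < b)%O by rewrite lt_neqAle eq_sym ba.
  exists (Some a) => // u ub au; rewrite /point_evaluation /= T_far ?subrr ?normr0//.
  move=> x xa; rewrite boxE; case: (boolP (above u x)) => // /au /=.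
  by rewrite ltNge xa.
have TfE (f' : X) : T f' a = matrix_entry T a a * f' a.
  have [_ gT] := rT; apply/eqP; rewrite -subr_eq0 -normr_le0.
  apply/ler_addgt0Pr => e e0; rewrite add0r.
  have /cvgrPdist_lt/(_ _ e0)[A0 _ A0P] := gT f'.
  have := A0P (a |` A0)%fset (fsubsetU1 _ _); rewrite /= partial_sumE.
  rewrite (bigD1_seq a (fset1U1 _ _) (fset_uniq _)) /= big1 ?addr0 => [/ltW//|x xa].
  by rewrite coef0// mul0r.
(* An indicator containing [a] and long enough to realise the row sum identifies the diagonal
   entry. *)
have [H HP] := sP a; pose b := Order.max H a.
have := TfE (ibox b); rewrite HP ?le_max ?lexx// tc// boxE /= le_max lexx orbT mulr1 => ->.
exact: TfE.
Qed.

Lemma alspach_benyaminiP T : op_character T (alspach_benyamini T).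
Proof.
have [s [c [t [cT _ _]]]] := op_character_ex T.
exact: (xgetPex 0 (ex_intro _ c cT : [set c | op_character T c] !=set0)).
Qed.

Lemma alspach_benyamini0P T : alspach_benyamini T = 0 <-> op_character T 0.
Proof.
split=> [<-|T0]; first exact: alspach_benyaminiP.
exact: op_character_unique (alspach_benyaminiP T) T0.
Qed.

Lemma matrix_entry_diag (T : bounded_op X X) (c : K) (a : W) :
  (forall f : X, T f a = c * f a) -> matrix_entry T a a = c.
Proof.
move=> Tc; pose g (x : W) : K^o := if x == a then c else 0.
have gE (A : {fset W}) (F : W -> K) : a \in A -> \sum_(x <- A) g x * F x = c * F a.
  move=> aA; rewrite (big_fsetD1 a aA) /= {1}/g eqxx big1_seq ?addr0// => x /=.
  by rewrite !inE => /andP[xa _]; rewrite /g (negbTE xa) mul0r.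
rewrite /matrix_entry (@coefficientsE _ _ _ _ wo _ g) ?/g ?eqxx//; split.
  exists `|c| => A; rewrite (partial_sumE (fun x => `|g x|)).
  have [aA|aA] := boolP (a \in A).
    rewrite (big_fsetD1 a aA) /= {1}/g eqxx big1_seq ?addr0// => x /=.
    by rewrite !inE => /andP[xa _]; rewrite /g (negbTE xa) normr0.
  rewrite big1_seq// => x /= xA; rewrite /g ifN ?normr0//.
  by apply: contraNneq aA => <-.
move=> f; apply/cvgrPdist_lt => e e0; exists [fset a]%fset => // A /=; rewrite fsub1set => aA.
by rewrite partial_sumE gE//= /point_evaluation Tc subrr normr0.
Qed.

End omega1_operators.

(** * The increasing enumeration of a club set and its left inverse *)

Section club_enumeration.
Variables (d : Order.disp_t) (W : orderTopologicalType d).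
Hypothesis W_omega1 : order_type_omega1 W.
Let wo := omega1_wo W_omega1.
Variable D : set W.
Hypothesis clubD : club D.

Lemma lt_wf : well_founded (fun a b : W => (a < b)%O).
Proof. by apply: (wo_ind wo) => b IH; constructor. Qed.

Definition least_above (b : W) (f : forall a, (a < b)%O -> W) : set W :=
  [set x | [/\ D x, forall a (ab : (a < b)%O), (f a ab < x)%O &
    forall y, D y -> (forall a (ab : (a < b)%O), (f a ab < y)%O) -> (x <= y)%O]].

(** The default [b] of [xget] never occurs, because a least admissible point of [D] always
    exists. *)
Definition enum_club : W -> W :=
  Fix lt_wf (fun=> W) (fun b f => xget b (least_above f)).

Lemma enum_clubE b : enum_club b = xget b (least_above (fun a (_ : (a < b)%O) => enum_club a)).
Proof.
rewrite /enum_club Fix_eq// => x f g fg; congr (xget _ _).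
have -> // : f = g by apply: functional_extensionality_dep => a; exact: functional_extensionality_dep.
Qed.

Lemma enum_clubP b : [/\ D (enum_club b), forall a, (a < b)%O -> (enum_club a < enum_club b)%O &
  forall y, D y -> (forall a, (a < b)%O -> (enum_club a < y)%O) -> (enum_club b <= y)%O].
Proof.
suff [x xP] : least_above (fun a (_ : (a < b)%O) => enum_club a) !=set0.
  by rewrite enum_clubE; case: (xgetPex b (ex_intro _ x xP)).
have [u uP] := fun_bounded W_omega1 enum_club b.
have [z Dz uz] := clubD.2 u.
have [|m [Dm mP] mle] := @wo_min _ _ wo [set x | D x /\ forall a, (a < b)%O -> (enum_club a < x)%O].
  by exists z; split => // a /ltW/uP/lt_trans; exact.
by exists m; split => // y Dy yP; exact: mle.
Qed.

Lemma enum_club_lt : {mono enum_club : a b / (a <= b)%O}.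
Proof. by apply: le_mono => a b; have [_ + _] := enum_clubP b; exact. Qed.

Lemma enum_club_ge b : (b <= enum_club b)%O.
Proof.
elim/(wo_ind wo) : b => b IH; rewrite leNgt; apply/negP => lt_b.
by have := IH _ lt_b; rewrite enum_club_lt leNgt lt_b.
Qed.

Lemma club_rank_ex x : exists2 b, (x <= enum_club b)%O &
  forall b', (x <= enum_club b')%O -> (b <= b')%O.
Proof. by apply: (wo_min wo); exists x; exact: enum_club_ge. Qed.

Definition club_rank x := sval (cid2 (club_rank_ex x)).

(** An adjunction: it turns cuts for the rank into cuts for the enumeration, which is what makes the
    rank continuous. *)
Lemma club_rank_le x b : (club_rank x <= b)%O = (x <= enum_club b)%O.
Proof.
rewrite /club_rank; case: cid2 => c /= xc cle; apply/idP/idP; last exact: cle.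
by rewrite -enum_club_lt; exact: le_trans.
Qed.

Lemma enum_clubK : cancel enum_club club_rank.
Proof.
move=> b; apply/le_anti; rewrite club_rank_le lexx /=.
by rewrite -enum_club_lt -club_rank_le.
Qed.

Lemma club_rankK x : D x -> enum_club (club_rank x) = x.
Proof.
move=> Dx; apply/le_anti; rewrite -club_rank_le lexx andbT.
have [_ _] := enum_clubP (club_rank x); apply => // a.
by rewrite !ltNge club_rank_le.
Qed.

Lemma club_rank_continuous (K : numFieldType) (f : W -> K^o) :
  continuous f -> continuous (f \o club_rank).
Proof.
move=> /(continuous_woP wo) cf; apply/(continuous_woP wo) => x e e0.
have [u ux uP] := cf (club_rank x) e e0; exists (omap enum_club u).
  by case: u ux {uP} => //= u; rewrite !ltNge club_rank_le.
move=> y uy yx; apply: uP; last by rewrite club_rank_le (le_trans yx)// -club_rank_le.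
by case: u ux uy => //= u _; rewrite !ltNge club_rank_le.
Qed.

(** Closedness of [D] matters here. If the values before [b] stayed at most some [u] below
    [enum_club b], their supremum [m] would be a point of [D], against the minimality of
    [enum_club b]. *)
Lemma enum_club_continuous (K : numFieldType) (f : W -> K^o) :
  continuous f -> continuous (f \o enum_club).
Proof.
move=> /(continuous_woP wo) cf; apply/(continuous_woP wo) => b e e0.
have [u ub uP] := cf (enum_club b) e e0.
suff [v vb vP] : exists2 v, above v b & forall y, above v y -> (y <= b)%O -> above u (enum_club y).
  by exists v => // y vy yb; apply: uP; [exact: vP|rewrite enum_club_lt].
case: u ub {uP} => [u|] /= ub; last by exists None.
apply: contrapT => /forall2NP nv.
have {}nv v : above v b -> exists y, [/\ above v y, (y < b)%O & (enum_club y <= u)%O].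
  move=> vb; have [//|/existsNP[y /not_implyP[vy /not_implyP[yb /negP]]]] := nv v.
  rewrite -leNgt => yu; exists y; split => //; rewrite lt_neqAle yb andbT.
  by apply: contraTneq ub => <-; rewrite -leNgt.
have [|m mP mle] := @wo_min _ _ wo [set z | forall a, (a < b)%O -> (enum_club a < z)%O].
  by exists (enum_club b) => a ab; rewrite (leW_mono enum_club_lt).
have Dm : D m.
  apply: (closed_woP wo D).1; first by case: clubD.
  move=> [w|] /= wm; last first.
    have [y [_ yb _]] := nv None isT; exists (enum_club y).
    split => //; last exact: ltW (mP y yb).
    by case: (enum_clubP y).
  have /existsNP[a /not_implyP[ab /negP]] : ~ forall a, (a < b)%O -> (enum_club a < w)%O.
    by move=> /mle; rewrite leNgt wm.
  rewrite -leNgt => wa; have [y [ay yb _]] := nv (Some a) ab.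
  exists (enum_club y); split; [by case: (enum_clubP y)| |exact: ltW (mP y yb)].
  by rewrite (le_lt_trans wa)// (leW_mono enum_club_lt).
have mu : (m <= u)%O.
  apply: mle => a ab; have [y [ay yb yu]] := nv (Some a) ab.
  by rewrite (lt_le_trans _ yu)// (leW_mono enum_club_lt).
have [_ _ /(_ m Dm mP)] := enum_clubP b.
by rewrite leNgt (le_lt_trans mu ub).
Qed.

End club_enumeration.

Section factorization_of_identity.
Variables (R : realType) (k : scalar_kind).
Local Notation K := (scalars R k).
Variables (d : Order.disp_t) (W : orderTopologicalType d).
Hypothesis W_omega1 : order_type_omega1 W.
Let wo := omega1_wo W_omega1.
Local Notation X := (C0 K W).

Lemma C0_omega1_ex (f : W -> K^o) : continuous f ->
  (exists b, forall x, (b < x)%O -> f x = 0) -> exists g : X, forall x, g x = f x.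
Proof. by move=> cf [b fb]; exists (C0_of cf (vanishes_eventually wo fb)). Qed.

Lemma composition_op_ex (L1 L2 : topologicalType) (j : L2 -> L1) :
  (forall f : C0 K L1, exists g : C0 K L2, forall x, g x = f (j x)) ->
  exists T : bounded_op (C0 K L1) (C0 K L2), forall f x, T f x = f (j x).
Proof.
move=> /choice[G GP]; have [||T TE] := @bounded_op_ex _ (C0 K L1) (C0 K L2) G 1.
- by move=> a f g; apply: C0_ext => x; rewrite C0D C0Z !GP.
- by move=> f; rewrite mul1r; apply: C0_norm_le => // x; rewrite GP C0_norm_ge.
- by exists T => f x; rewrite TE GP.
Qed.

Lemma character_neq0_factors (T : bounded_op X X) (c : K) :
  op_character T c -> c != 0 -> factors_through_op (@idfun X) T.
Proof.
move=> [D cD TD] c0.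
have [|C1 C1E] := @composition_op_ex W W (club_rank W_omega1 cD).
  move=> f; apply: (@C0_omega1_ex (f \o club_rank W_omega1 cD)).
    by apply: club_rank_continuous; exact: C0_continuous.
  have [b fb] := C0_omega1_eventually0 W_omega1 f; exists (enum_club W_omega1 D b) => x bx.
  by apply: fb; rewrite ltNge club_rank_le -ltNge.
have [|C2 C2E] := @composition_op_ex W W (enum_club W_omega1 D).
  move=> f; apply: (@C0_omega1_ex (f \o enum_club W_omega1 D)).
    by apply: enum_club_continuous => //; exact: C0_continuous.
  have [b fb] := C0_omega1_eventually0 W_omega1 f; exists b => x bx.
  by apply: fb; rewrite (lt_le_trans bx)// enum_club_ge.
have [M M0 C2M] := op_bound C2.
have [||U UE] := @bounded_op_ex _ X X (fun f => c^-1 *: C2 f) (`|c^-1| * M).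
- by move=> a f g /=; rewrite linearP scalerDr !scalerA mulrC.
- by move=> f; rewrite normrZ -mulrA ler_wpM2l.
exists C1, U; apply/funext => f; apply: C0_ext => x /=.
rewrite UE C0Z C2E TD; last by case: (enum_clubP W_omega1 cD x).
by rewrite C1E enum_clubK mulKf.
Qed.

End factorization_of_identity.

(** * The Loy--Willis ideal *)

Section with_top_space.
Variables (R : realType) (k : scalar_kind).
Local Notation K := (scalars R k).
Variables (d : Order.disp_t) (W : orderTopologicalType d).
Hypothesis W_omega1 : order_type_omega1 W.
Let wo := omega1_wo W_omega1.
Local Notation V := (with_top W).
Local Notation top := (top_point : V).

Lemma with_top_ltS (a b : W) : ((Some a : V) < Some b)%O = (a < b)%O.
Proof. by rewrite !ltNge. Qed.

Lemma with_top_leS (a b : W) : ((Some a : V) <= Some b)%O = (a <= b)%O.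
Proof. by []. Qed.

Lemma with_top_lt_top (a : W) : ((Some a : V) < top)%O.
Proof. by rewrite ltNge. Qed.

Lemma with_top_le_top (x : V) : (x <= top)%O.
Proof. by case: x. Qed.

Lemma with_top_wo : well_order (<=%O : rel V).
Proof.
move=> A [x Ax].
suff [m [mA mle]] : exists m, minimum_of (<=%O : rel V) A m.
  exists m; split=> // m' [m'A m'le]; apply/le_anti/andP.
  by split; [exact: mle|exact: m'le].
have [[w Aw]|nA] := pselect (exists w : W, (Some w : V) \in A).
  have [|m mA mle] := @wo_min _ _ wo [set w | (Some w : V) \in A]; first by exists w.
  exists (Some m); split=> // -[y|] yA //; exact: mle.
exists x; split=> // -[y|] yA; first by case: nA; exists y.
by rewrite with_top_le_top.
Qed.
Let wot := with_top_wo.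

Lemma C0_with_top_eventually0 (f : C0 K V) : exists b, forall x, (b < x)%O -> f x = 0.
Proof. by exists top => x; rewrite ltNge with_top_le_top. Qed.

Lemma above_top (u : option V) : above u top ->
  exists w : W, forall a, (w <= a)%O -> refines u (Some (Some a)).
Proof.
case: u => [[w|]|] //= _; last by have [w _] := omega1_inhabited W_omega1; exists w.
by exists w => a wa x /=; apply: le_lt_trans; rewrite with_top_leS.
Qed.

Lemma continuous_SomeP (f : V -> K^o) : continuous (f \o Some : W -> K^o) <->
  forall b : W, {for Some b : V, continuous f}.
Proof.
split=> [/(continuous_woP wo) cf b|cf].
  apply/(continuous_at_woP wot) => e e0.
  have [u ub uP] := cf b e e0; exists (omap Some u).
    by case: u ub {uP} => //= u; rewrite with_top_ltS.
  move=> [x|] ux xb //; apply: uP => //.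
  by case: u ub ux => //= u _; rewrite with_top_ltS.
apply/(continuous_woP wo) => b e e0.
have [u ub uP] := (continuous_at_woP wot _ _).1 (cf b) e e0.
(* A cut of [with_top W] at the top point cannot lie to the left of [Some b], so sending it to
   [None] is harmless. *)
exists (obind id u).
  by case: u ub {uP} => [[u|]|] //=; rewrite with_top_ltS.
move=> x ux xb; apply: uP => //.
by case: u ub ux => [[u|]|] //=; rewrite !with_top_ltS.
Qed.

Lemma continuous_topP (f : V -> K^o) : {for top, continuous f} <->
  forall e, 0 < e -> exists w : W, forall x, (w < x)%O -> `|f top - f (Some x)| < e.
Proof.
split=> [cf e e0|cf].
  have [u ut uP] := (continuous_at_woP wot _ _).1 cf e e0.
  have [w wP] := above_top ut; exists w => x wx; apply: uP; last exact: with_top_le_top.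
  by apply: (wP w (lexx w)); rewrite /= with_top_ltS.
apply/(continuous_at_woP wot) => e e0.
have [w wP] := cf e e0; exists (Some (Some w)); first exact: with_top_lt_top.
move=> [x|] wx _; last by rewrite subrr normr0.
by apply: wP; rewrite -with_top_ltS.
Qed.

Lemma C0_with_top_eventually (f : C0 K V) :
  exists b, forall x, (b < x)%O -> f (Some x) = f top.
Proof.
have ct : {for top, continuous f} by exact: C0_continuous.
have /choice[u uP] (n : nat) : exists w, forall x, (w < x)%O ->
    `|f top - f (Some x)| < n.+1%:R^-1.
  by apply: ((continuous_topP f).1 ct); rewrite invr_gt0.
have [b bP] := seq_bounded W_omega1 u; exists b => x bx.
apply/esym/eqP; rewrite -subr_eq0; apply/eqP/scalar_eq0 => n.
by apply: uP; exact: lt_trans (bP n) bx.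
Qed.

Lemma C0_with_top_ex (f : V -> K^o) : continuous (f \o Some : W -> K^o) ->
  (exists b, forall x, (b < x)%O -> f (Some x) = f top) ->
  exists g : C0 K V, forall x, g x = f x.
Proof.
move=> cf [b fb]; have cf' : continuous f.
  case=> [x|]; first by move/continuous_SomeP : cf; exact.
  apply/continuous_topP => e e0; exists b => x /fb ->.
  by rewrite subrr normr0.
have vf : vanishes_at_infinity f.
  by apply: (@vanishes_eventually _ _ _ wot _ top) => x; rewrite ltNge with_top_le_top.
by exists (C0_of cf' vf).
Qed.

(** The value at the top is stored at the least point [w0]; what remains after subtracting it is
    shifted onto the points beyond [w0], which again form a copy of [W]. *)
Lemma with_top_isomorphic : exists (U : bounded_op (C0 K V) (C0 K W))
  (U' : bounded_op (C0 K W) (C0 K V)), isomorphism U U'.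
Proof.
have [w1 _] := omega1_inhabited W_omega1.
have [|w0 _ w0le] := @wo_min _ _ wo [set: W]; first by exists w1.
have cD := club_gt W_omega1 w0; set D := [set x | _] in cD.
pose en := enum_club W_omega1 D; pose rk := club_rank W_omega1 cD.
have en0 b : en b != w0.
  by have [+ _ _] := enum_clubP W_omega1 cD b; rewrite /D /= lt_neqAle eq_sym => /andP[].
have D0 x : x != w0 -> D x by move=> x0; rewrite /D /= lt_neqAle eq_sym x0 w0le.
have rkK x : rk (en x) = x by exact: enum_clubK.
have enK x : D x -> en (rk x) = x by exact: club_rankK.
have /choice[F FP] (f : C0 K V) : exists g : C0 K W,
    forall x, g x = if x == w0 then f top else f (Some (rk x)) - f top.
  apply: (C0_omega1_ex W_omega1).
    have cf : continuous ((fun y => f (Some y) - f top) \o rk : W -> K^o).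
      apply: club_rank_continuous => y; apply: cvgB; last exact: cvg_cst.
      have /(continuous_SomeP f) : forall b : W, {for Some b : V, continuous f}.
        by move=> b; exact: C0_continuous.
      exact.
    apply/(continuous_woP wo) => b e e0; have [->|b0] := eqVneq b w0.
      exists None => // x _ xw0; have -> : x = w0 by apply/le_anti; rewrite xw0 w0le.
      by rewrite eqxx subrr normr0.
    have [u ub uP] := (continuous_woP wo _).1 cf b e e0.
    have [u' u'b u'P] := aboveI ub (D0 b b0 : above (Some w0) b).
    exists u' => // x /u'P[ux w0x] xb; rewrite ifN ?uP//.
    by apply: contraTneq w0x => ->; rewrite /= ltxx.
  have [b fb] := C0_with_top_eventually f; exists (en b) => x bx.
  rewrite ifN; last by apply: contraTneq bx => ->; rewrite -leNgt w0le.
  by rewrite fb ?subrr// ltNge club_rank_le -ltNge.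
have /choice[G GP] (g : C0 K W) : exists f : C0 K V,
    forall x, f x = (if x is Some y then g (en y) else 0) + g w0.
  apply: C0_with_top_ex.
    move=> y; apply: cvgD; last exact: cvg_cst.
    by apply: (enum_club_continuous cD); exact: C0_continuous.
  have [b gb] := C0_omega1_eventually0 W_omega1 g; exists b => x bx /=.
  by rewrite gb// (lt_le_trans bx)// enum_club_ge.
have [||U UE] := @bounded_op_ex _ _ _ F 2.
- move=> a f g; apply: C0_ext => x; rewrite C0D C0Z !FP !C0D !C0Z.
  by case: ifP => _; rewrite ?C0D ?C0Z; ring.
- move=> f; apply: C0_norm_le => [|x]; first by rewrite mulr_ge0.
  rewrite FP mulr_natl mulr2n; case: ifP => _.
    by rewrite (le_trans (C0_norm_ge _ _))// lerDl.
  by rewrite (le_trans (ler_normB _ _))// lerD// C0_norm_ge.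
have [||U' U'E] := @bounded_op_ex _ _ _ G 2.
- move=> a f g; apply: C0_ext => x; rewrite C0D C0Z !GP.
  by case: x => [x|]; rewrite ?C0D ?C0Z; ring.
- move=> f; apply: C0_norm_le => [|x]; first by rewrite mulr_ge0.
  rewrite GP mulr_natl mulr2n (le_trans (ler_normD _ _))// lerD//.
    by case: x => [x|]; rewrite ?normr0// C0_norm_ge.
  exact: C0_norm_ge.
exists U, U'; split => [f|g]; apply: C0_ext => x.
  rewrite U'E GP !UE !FP eqxx; case: x => [x|]; last by rewrite add0r.
  by rewrite FP (negbTE (en0 x)) subrK rkK.
rewrite UE FP !U'E !GP add0r; case: eqVneq => [->//|x0].
by rewrite addrK enK//; exact: D0.
Qed.

Local Notation tbox a := (@box K d V wot (Some (Some a)) top).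

(** The limit is attained: countably many thresholds have a common bound. *)
Lemma top_coef_eventually (phi : C0 K V -> K^o) z : is_coef wot phi top z ->
  exists h : W, forall a, (h <= a)%O -> phi (tbox a) = z.
Proof.
move=> phiz; have /choice[u uP] (n : nat) : exists w : W, forall a, (w <= a)%O ->
    `|phi (tbox a) - z| < n.+1%:R^-1.
  have [|c ct cP] := phiz n.+1%:R^-1; first by rewrite invr_gt0.
  have [w wP] := above_top ct; exists w => a wa.
  by apply: cP; [exact: with_top_lt_top|exact: wP].
have [h hP] := seq_bounded W_omega1 u; exists h => a ha.
apply/eqP; rewrite -subr_eq0; apply/eqP/scalar_eq0 => n; apply: uP.
exact: le_trans (ltW (hP n)) ha.
Qed.

Lemma matrix_entry_top (S : bounded_op (C0 K V) (C0 K V)) (b : V) :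
  is_coef wot (point_evaluation b \o S) top (matrix_entry S b top).
Proof. exact: represents_is_coef (matrix_row wot C0_with_top_eventually0 S b). Qed.

(** The last column is continuous on [W], since on initial segments it agrees with one image
    function, and it has its top value on [D]. If it did not converge, the points of large deviation
    would form a club set, which meets [D]. *)
Lemma original_loy_willis_club (S : bounded_op (C0 K V) (C0 K V)) (D : set W) :
  club D -> (forall f a, D a -> S f (Some a) = S f top) -> original_loy_willis S.
Proof.
move=> cD SD; rewrite /original_loy_willis /=.
set s : V -> K^o := fun b => _.
have /choice[h hP] b := top_coef_eventually (matrix_entry_top S b).
have cs : continuous (s \o Some : W -> K^o).
  apply: (continuous_wo_locally wo) => b.
  have [H HP] := fun_bounded W_omega1 (h \o Some) b.
  exists (S (tbox H) \o Some).
    by apply/continuous_SomeP => x; exact: C0_continuous.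
  by move=> x xb; rewrite /s /= -(hP (Some x) H)//; exact: ltW (HP x xb).
apply/continuous_topP => e e0; apply: contrapT => /forallNP nE.
pose E := [set b : W | ~ `|s top - s (Some b)| < e].
have cE : club E.
  split; last by move=> a; have /existsNP[b /not_implyP[ab sb]] := nE a; exists b.
  apply/(closed_woP wo) => m mE smt.
  have e10 : 0 < e - `|s top - s (Some m)| by rewrite subr_gt0.
  have [u um uP] := (continuous_woP wo _).1 cs m _ e10.
  have [x [Ex ux xm]] := mE u um; apply: Ex.
  have -> : s top - s (Some x) = (s top - s (Some m)) + (s (Some m) - s (Some x)) by ring.
  rewrite (le_lt_trans (ler_normD _ _))// -ltrBrDl; exact: uP.
have [a [Da]] := clubW W_omega1 (clubI W_omega1 cD cE); apply.
suff -> : s (Some a) = s top by rewrite subrr normr0.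
rewrite /s /matrix_entry; congr (coefficients _ _).
by apply/funext => f; exact: SD.
Qed.

(** [Q'] sends [g] to [U' g] minus its value at the top, restricted to [W]. As an operator on
    [C0 K W] it has a character itself, so on a club set it only rescales values of [T (U f)], and
    these vanish on [DT]. *)
Lemma character0_original_loy_willis (T : bounded_op (C0 K W) (C0 K W))
    (U : bounded_op (C0 K V) (C0 K W)) (U' : bounded_op (C0 K W) (C0 K V)) :
  op_character T 0 -> original_loy_willis (comp_op U' (comp_op T U)).
Proof.
move=> [DT cDT TD].
have /choice[Q QP] (g : C0 K W) : exists g' : C0 K W,
    forall x, g' x = U' g (Some x) - U' g top.
  apply: (C0_omega1_ex W_omega1).
    move=> x; apply: cvgB; last exact: cvg_cst.
    have /(continuous_SomeP (U' g)) : forall b : W, {for Some b : V, continuous (U' g)}.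
      by move=> b; exact: C0_continuous.
    exact.
  have [b gb] := C0_with_top_eventually (U' g); exists b => x /gb ->.
  by rewrite subrr.
have [M M0 U'M] := op_bound U'.
have [||Q' Q'E] := @bounded_op_ex _ _ _ Q (2 * M).
- move=> a f g; apply: C0_ext => x; rewrite C0D C0Z !QP linearP !C0D !C0Z.
  by ring.
- move=> f; apply: C0_norm_le => [|x].
    by rewrite !mulr_ge0// ltW.
  rewrite QP -mulrA mulr_natl mulr2n (le_trans (ler_normB _ _))//.
  by rewrite lerD// (le_trans (C0_norm_ge _ _))// U'M.
have [_ [c [_ [[DQ cDQ QD] _ _]]]] := op_character_ex W_omega1 Q'.
apply: (original_loy_willis_club (clubI W_omega1 cDT cDQ)) => f a [Ta Qa] /=.
apply/eqP; rewrite -subr_eq0 -QP -Q'E QD//.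
by rewrite TD// mul0r mulr0.
Qed.

Lemma character0_loy_willis (T : bounded_op (C0 K W) (C0 K W)) :
  op_character T 0 -> loy_willis T.
Proof.
move=> T0; have [U [U' UU']] := with_top_isomorphic; exists U, U'; split => //.
exact: character0_original_loy_willis.
Qed.

(** [T] minus [c] times the identity satisfies the condition by the converse. The identity
    contributes [c] to the last column at the top and nothing before it, so both columns are
    continuous there only if [c] is 0. *)
Lemma loy_willis_character0 (T : bounded_op (C0 K W) (C0 K W)) :
  loy_willis T -> op_character T 0.
Proof.
move=> [U [U' [[UK U'K] LW]]].
have [_ [c [_ [[D cD TD] _ _]]]] := op_character_ex W_omega1 T.
suff <- : c = 0 by exists D.
have [M M0 TM] := op_bound T.
have [||T' T'E] := @bounded_op_ex _ _ _ (fun f => T f - c *: f) (M + `|c|).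
- move=> a f g; apply: C0_ext => x; rewrite linearP scalerDr.
  change (a * T f x + T g x - (c * (a * f x) + c * g x) =
    a * (T f x - c * f x) + (T g x - c * g x)).
  by ring.
- by move=> f; rewrite (le_trans (ler_normB _ _))// mulrDl lerD// normrZ.
have T'0 : op_character T' 0.
  exists D => // f a Da; rewrite T'E; have [_ _ _ -> _] := C0E (T f) (c *: f) 0 a.
  by rewrite C0Z TD// mul0r subrr.
have := @character0_original_loy_willis T' U U' T'0; set S' := comp_op _ _ => LW'.
set S := comp_op _ _ in LW.
have S'E f x : S' f x = S f x - c * f x.
  by rewrite /S' /S /= T'E linearB linearZ /= UK.
have eS b : matrix_entry S (Some b) top = matrix_entry S' (Some b) top.
  apply: is_coef_unique (matrix_entry_top S _) _ => e e0.
  have [u ut uP] := matrix_entry_top S' (Some b) e0.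
  (* Once the cut has passed [b], the indicator vanishes at [b] and the multiple of the identity
     drops out. *)
  have [u' u't u'P] := aboveI ut (with_top_lt_top b : @above d V (Some (Some b)) top).
  exists u' => // v vt u'v; have := uP v vt (fun x vx => (u'P x (u'v x vx)).1).
  rewrite /= /point_evaluation S'E boxE.
  case: (boolP (above v (Some b))) => [/u'v/u'P[_ /=]|_]; first by rewrite ltxx.
  by rewrite mulr0 subr0.
have eSt : matrix_entry S top top = matrix_entry S' top top + c.
  apply: is_coef_unique (matrix_entry_top S _) _ => e e0.
  have [u ut uP] := matrix_entry_top S' top e0; exists u => // v vt uv.
  have := uP v vt uv; rewrite /= /point_evaluation S'E boxE vt lexx mulr1.
  by rewrite opprD addrA addrAC.
apply/eqP; rewrite -normr_le0; apply/ler_addgt0Pr => e e0; rewrite add0r.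
have e20 : 0 < e / 2 by rewrite divr_gt0.
have [w wP] := (continuous_topP _).1 LW _ e20.
have [w' w'P] := (continuous_topP _).1 LW' _ e20.
have [z] := gt_exists W_omega1 (Order.max w w'); rewrite gt_max => /andP[wz w'z].
have := wP z wz; have := w'P z w'z; rewrite eS eSt => h1 h2.
set p := matrix_entry S' top top in h1 h2; set q := matrix_entry S' (Some z) top in h1 h2.
have -> : c = (p + c - q) - (p - q) by ring.
by rewrite (le_trans (ler_normB _ _))// [leRHS]splitr lerD// ltW.
Qed.

End with_top_space.

(** * The space L_0 and factorization through C_0(L_0) *)

Section L0_space.
Variables (d : Order.disp_t) (W : orderTopologicalType d).
Hypothesis W_omega1 : order_type_omega1 W.
Let wo := omega1_wo W_omega1.

Lemma succ_ex (a : W) : exists c, is_succ a c.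
Proof. by have [c ac cle] := wo_min wo (gt_exists W_omega1 a); exists c. Qed.

Definition succ_pt (a : W) : W := sval (cid (succ_ex a)).

Lemma succ_ptP a : is_succ a (succ_pt a).
Proof. by rewrite /succ_pt; case: cid. Qed.

Lemma is_succ_unique (a c c' : W) : is_succ a c -> is_succ a c' -> c = c'.
Proof. by move=> [ac cle] [ac' c'le]; apply/le_anti; rewrite cle// c'le. Qed.

Lemma is_succ_inj (a a' c : W) : is_succ a c -> is_succ a' c -> a = a'.
Proof.
move=> [ac cle] [a'c c'le]; apply/le_anti; rewrite !leNgt.
by apply/andP; split; apply/negP; [move=> /c'le|move=> /cle]; rewrite leNgt ?ac ?a'c.
Qed.

Fact L0_pt_subproof (a b : W) : (Order.min b a, succ_pt a) \in L0_set W.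
Proof.
apply/mem_set; exists a => //; split => /=; last exact: succ_ptP.
by rewrite ge_min lexx orbT.
Qed.

(* The point [(min b a, a + 1)] of [L0]; the minimum makes the map total. *)
Definition L0_pt (a b : W) : L0 W :=
  exist (fun p => p \in L0_set W) _ (L0_pt_subproof a b).

Definition L0_fst (q : L0 W) : W := (\val q).1.

Lemma L0_level_ex (q : L0 W) : exists a, q = L0_pt a (L0_fst q) /\ (L0_fst q <= a)%O.
Proof.
have /set_mem[a _ [/= ba ac]] := valP q; exists a; split => //.
apply/val_inj => /=; rewrite min_l// -(is_succ_unique ac (succ_ptP a)).
exact: surjective_pairing.
Qed.

Definition L0_level (q : L0 W) : W := sval (cid (L0_level_ex q)).

Lemma L0_levelP q : q = L0_pt (L0_level q) (L0_fst q) /\ (L0_fst q <= L0_level q)%O.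
Proof. by rewrite /L0_level; case: cid. Qed.

Lemma L0_ptP (q : L0 W) : exists a b, (b <= a)%O /\ q = L0_pt a b.
Proof. by have [qE qle] := L0_levelP q; exists (L0_level q), (L0_fst q). Qed.

Lemma L0_fst_pt a b : (b <= a)%O -> L0_fst (L0_pt a b) = b.
Proof. by move=> ba; rewrite /L0_fst /= min_l. Qed.

Lemma L0_level_pt a b : L0_level (L0_pt a b) = a.
Proof.
have [/(congr1 (fun q => (\val q).2)) /= e _] := L0_levelP (L0_pt a b).
apply: is_succ_inj (succ_ptP _) _; rewrite -e; exact: succ_ptP.
Qed.

Lemma L0_val_pt a b : (b <= a)%O -> set_val (L0_pt a b) = (b, succ_pt a).
Proof. by move=> ba; rewrite -[LHS]/(Order.min b a, succ_pt a) min_l. Qed.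

Lemma L0_snd (q : L0 W) : (sval q).2 = succ_pt (L0_level q).
Proof. by have [/(congr1 (fun q : L0 W => (sval q).2)) /= -> _] := L0_levelP q. Qed.

(** Second coordinates are successors, hence isolated in [W]; so levels are open and only the first
    coordinate varies locally. *)
Lemma nbhs_L0P a b (P : set (L0 W)) : (b <= a)%O -> nbhs (L0_pt a b) P <->
  exists2 u, above u b & forall y, above u y -> (y <= b)%O -> P (L0_pt a y).
Proof.
move=> ba; split=> [|[u ub uP]].
  rewrite nbhsE => -[U [[O oO OU] Ub] UP].
  have Ob : O (b, succ_pt a).
    by move: Ub; rewrite -OU -(L0_val_pt ba).
  have [[A B] /= [nA nB] AB] : nbhs (b, succ_pt a) O by apply: open_nbhs_nbhs.
  have [u ub uA] := (nbhs_woP wo _ _).1 nA; exists u => // y uy yb.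
  apply: UP; rewrite -OU; change (O (set_val (L0_pt a y))).
  rewrite L0_val_pt ?(le_trans yb)//.
  by apply: AB; split; [exact: uA|exact: nbhs_singleton].
pose N : set (W * W) := [set p |
    (above u p.1 /\ (p.1 <= b)%O) /\ ((a < p.2)%O /\ (p.2 <= succ_pt a)%O)].
have nN : nbhs (set_val (L0_pt a b)) N.
  rewrite L0_val_pt//.
  exists ([set x | above u x /\ (x <= b)%O], [set x | (a < x)%O /\ (x <= succ_pt a)%O]) => //=.
  split; apply/(nbhs_woP wo); first by exists u.
  by exists (Some a) => //=; have [] := succ_ptP a.
have nN' : nbhs (L0_pt a b) (set_val @^-1` N).
  exact: (@initial_continuous _ _ (set_val : L0_set W -> _) (L0_pt a b) _ nN).
apply: filterS nN' => q [[uq qb] [aq qa]].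
have -> : q = L0_pt a (L0_fst q).
  have [qE qle] := L0_levelP q; rewrite {1}qE; congr (L0_pt _ _).
  have sq : (\val q).2 = succ_pt a.
    by apply/le_anti; rewrite qa /=; have [_] := succ_ptP a; exact.
  apply: is_succ_inj (succ_ptP _) _; move: (congr1 (fun q => (\val q).2) qE) => /= <-.
  by rewrite sq; exact: succ_ptP.
by apply: uP.
Qed.

Lemma continuous_L0P (K : numFieldType) (g : L0 W -> K^o) : continuous g <->
  forall a b e, (b <= a)%O -> 0 < e -> exists2 u, above u b &
    forall y, above u y -> (y <= b)%O -> `|g (L0_pt a b) - g (L0_pt a y)| < e.
Proof.
split=> [/continuous_nbhsP cg a b e ba e0|cg].
  exact: (nbhs_L0P _ ba).1 (cg (L0_pt a b) e e0).
apply/continuous_nbhsP => q e e0.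
have [qE qa] := L0_levelP q; have := cg _ _ e qa e0; rewrite -qE => cgq.
suff : nbhs (L0_pt (L0_level q) (L0_fst q)) [set t | `|g q - g t| < e] by rewrite -qE.
exact/nbhs_L0P.
Qed.

Lemma compact_L0_level a : compact [set q | L0_level q = a].
Proof.
have -> : [set q | L0_level q = a] = L0_pt a @` [set x | (x <= a)%O].
  apply/seteqP; split => [q /= <-|_ [x _ <-]]; last exact: L0_level_pt.
  by have [qE qle] := L0_levelP q; exists (L0_fst q).
by apply: (compact_image_wo wo) => x N xa; move/(nbhs_L0P _ xa).
Qed.

Lemma compact_L0_levels (s : seq W) : compact [set q | L0_level q \in s].
Proof.
elim: s => [|a s IH].
  have -> : [set q | L0_level q \in [::]] = set0 by apply/seteqP; split.
  exact: compact0.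
have -> : [set q | L0_level q \in a :: s] =
    [set q | L0_level q = a] `|` [set q | L0_level q \in s].
  apply/seteqP; split => q /=; rewrite inE.
    by case/predU1P; [left|right].
  by case=> ->; rewrite ?eqxx ?orbT.
by apply: compactU => //; exact: compact_L0_level.
Qed.

Lemma compact_L0_proj (A : set (L0 W)) : compact A ->
  compact [set c | exists2 q, A q & succ_pt (L0_level q) = c].
Proof.
move=> cA; have -> : [set c | exists2 q, A q & succ_pt (L0_level q) = c] =
    (fun q : L0 W => (sval q).2) @` A.
  by apply/seteqP; split => c [q Aq <-]; exists q; rewrite ?L0_snd.
apply: continuous_compact => //; apply: continuous_subspaceT => q.
have [qE qa] := L0_levelP q => B nB.
suff : nbhs (L0_pt (L0_level q) (L0_fst q)) ((fun q : L0 W => (sval q).2) @^-1` B) by rewrite -qE.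
apply/nbhs_L0P => //; exists None => // y _ yq /=.
by have := nbhs_singleton nB; rewrite L0_snd.
Qed.

End L0_space.

Section factorization_through_L0.
Variables (R : realType) (k : scalar_kind).
Local Notation K := (scalars R k).
Variables (d : Order.disp_t) (W : orderTopologicalType d).
Hypothesis W_omega1 : order_type_omega1 W.
Let wo := omega1_wo W_omega1.
Local Notation X := (C0 K W).
Local Notation pt := (L0_pt W_omega1).
Local Notation level := (L0_level W_omega1).

Section block_end.
Variable D : set W.
Hypothesis clubD : club D.

(** The least point of [D] at or after [b]; the fibres are the blocks. *)
Definition block_end (b : W) : W := enum_club W_omega1 D (club_rank W_omega1 clubD b).
Local Notation g := block_end.

Lemma block_end_in b : D (g b).
Proof. by case: (enum_clubP W_omega1 clubD (club_rank W_omega1 clubD b)). Qed.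

Lemma block_end_ge b : (b <= g b)%O.
Proof. by rewrite -(club_rank_le W_omega1 clubD). Qed.

Lemma block_end_le b x : D x -> (b <= x)%O -> (g b <= x)%O.
Proof.
move=> Dx bx; rewrite /block_end -(club_rankK W_omega1 clubD Dx).
by rewrite enum_club_lt// club_rank_le club_rankK.
Qed.

Lemma block_end_id b : D b -> g b = b.
Proof. by move=> Db; apply/le_anti; rewrite block_end_le ?block_end_ge. Qed.

Lemma block_end_locally_cst b : ~ D b ->
  exists2 u, above u b & forall y, above u y -> (y <= b)%O -> g y = g b.
Proof.
move=> nDb; have [u ub uD] : exists2 u, above u b & forall x, above u x -> (x <= b)%O -> ~ D x.
  apply: contrapT => /forall2NP h; apply: nDb; apply: (closed_woP wo D).1; first by case: clubD.
  move=> u ub; have [//|/existsNP[x /not_implyP[ux /not_implyP[xb /contrapT Dx]]]] := h u.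
  by exists x.
exists u => // y uy yb; apply/le_anti/andP; split.
  by apply: block_end_le (le_trans yb (block_end_ge b)); exact: block_end_in.
apply: block_end_le; first exact: block_end_in.
rewrite leNgt; apply/negP => /ltW gb; apply: (uD (g y)) (block_end_in y) => //.
exact: above_le uy (block_end_ge y).
Qed.

End block_end.

(** Transfinite induction on a bound for the support: near a point of [D] the function is small, and
    near any other point only one block occurs. *)
Lemma finitely_many_block_ends (D : set W) (clubD : club D) (f : X) (e : K) :
  0 < e -> (forall x, D x -> f x = 0) ->
  exists s : seq W, forall y, ~ `|f y| < e -> block_end clubD y \in s.
Proof.
move=> e0 fD; have [b fb] := C0_omega1_eventually0 W_omega1 f.
suff [s sP] : exists s : seq W, forall y, (y <= b)%O -> ~ `|f y| < e -> block_end clubD y \in s.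
  exists s => y fy; apply: sP => //; rewrite leNgt; apply/negP => /fb fy0.
  by apply: fy; rewrite fy0 normr0.
elim/(wo_ind wo) : b {fb} => b IH.
have [u [ub [s1 s1P]]] : exists u, above u b /\ exists s1 : seq W, forall y, above u y ->
    (y <= b)%O -> ~ `|f y| < e -> block_end clubD y \in s1.
  have [Db|nDb] := pselect (D b).
    have [u ub uP] := cut_continuous wo f b e0; exists u; split => //; exists [::] => y uy yb.
    by have := uP y uy yb; rewrite fD// sub0r normrN.
  have [u ub uP] := block_end_locally_cst clubD nDb; exists u; split => //.
  by exists [:: block_end clubD b] => y uy yb _; rewrite inE uP.
case: u ub s1P => [u|] /= ub s1P; last by exists s1 => y; exact: s1P.
have [s2 s2P] := IH u ub; exists (s1 ++ s2) => y yb fy; rewrite mem_cat.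
by have [yu|uy] := leP y u; [rewrite s2P ?orbT|rewrite s1P].
Qed.

(** Level [a] carries [f] on the block ending at [a]. The zeros on [D] give continuity where blocks
    begin and end, and smallness off finitely many levels. *)
Lemma L0_spread_ex (D : set W) (clubD : club D) (f : X) : (forall x, D x -> f x = 0) ->
  exists h : C0 K (L0 W), forall a b, (b <= a)%O ->
    h (pt a b) = if block_end clubD b == a then f b else 0.
Proof.
move=> fD; pose h (q : L0 W) : K^o :=
  if block_end clubD (L0_fst q) == level q then f (L0_fst q) else 0.
have hE a b : (b <= a)%O -> h (pt a b) = if block_end clubD b == a then f b else 0.
  by move=> ba; rewrite /h L0_fst_pt// L0_level_pt.
suff [ch vh] : continuous h /\ vanishes_at_infinity h by exists (C0_of ch vh).
split.
  apply/(continuous_L0P W_omega1) => a b e ba e0.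
  have [u ub uP] := cut_continuous wo f b e0.
  have [Db|nDb] := pselect (D b).
    exists u => // y uy yb; rewrite !hE ?(le_trans yb)// fD// if_same.
    by case: ifP => _; [have := uP y uy yb; rewrite fD|rewrite subrr normr0].
  have [v vb vP] := block_end_locally_cst clubD nDb.
  have [w wb wP] := aboveI ub vb; exists w => // y /wP[uy vy] yb.
  rewrite !hE ?(le_trans yb)// vP//; case: ifP => _; last by rewrite subrr normr0.
  exact: uP.
move=> e e0; have [s sP] := finitely_many_block_ends clubD e0 fD.
exists [set q | level q \in s]; first exact: compact_L0_levels.
move=> q /= qs; rewrite /h; case: eqP => [eq|_]; last by rewrite normr0.
by apply: contrapT => /sP; rewrite eq => /qs.
Qed.

(** Subtracting the value at the end of the block forces zeros on [D], so that pieces from unrelated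
    levels fit together continuously. *)
Lemma L0_gather_ex (D : set W) (clubD : club D) (h : C0 K (L0 W)) :
  exists f : X, forall b, f b = h (pt (block_end clubD b) b) -
    h (pt (block_end clubD b) (block_end clubD b)).
Proof.
set g := block_end clubD.
pose f b : K^o := h (pt (g b) b) - h (pt (g b) (g b)).
have ch := (continuous_L0P W_omega1 h).1 (@C0_continuous _ _ h).
have small e : 0 < e -> exists2 P : set W, compact P &
    [/\ forall c, P c -> exists a, is_succ a c &
    forall y, ~ P (succ_pt W_omega1 (g y)) -> `|f y| < e].
  move=> e0; have e20 : 0 < e / 2 by rewrite divr_gt0.
  have [A cA hA] := @C0_vanish _ _ h _ e20.
  exists [set c | exists2 q, A q & succ_pt W_omega1 (level q) = c].
    exact: compact_L0_proj.
  split => [c [q _ <-]|y nA]; first by exists (level q); exact: succ_ptP.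
  rewrite /f (le_lt_trans (ler_normB _ _))// [ltRHS]splitr.
  have lA q : level q = g y -> ~ A q by move=> qy Aq; apply: nA; exists q; rewrite ?qy.
  by apply: ltrD; apply: hA; apply: lA; rewrite L0_level_pt.
suff [cf vf] : continuous f /\ vanishes_at_infinity f by exists (C0_of cf vf).
split; last first.
  move=> e e0; have [P cP [_ PP]] := small e e0.
  have [b bP] : exists b, forall x, P x -> (x <= b)%O.
    have [P0|P0] := pselect (P !=set0); first exact: compact_bounded_wo cP P0.
    have [b _] := omega1_inhabited W_omega1; exists b => x Px; case: P0; by exists x.
  exists [set x | (x <= b)%O]; first exact: compact_le.
  move=> y /negP; rewrite -ltNge => yb; apply: PP => /bP.
  have [gs _] := succ_ptP W_omega1 (g y).
  by rewrite leNgt (lt_trans (lt_le_trans yb (block_end_ge clubD y))).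
apply/(continuous_woP wo) => b e e0.
have [Db|nDb] := pselect (D b); last first.
  have [u ub uP] := block_end_locally_cst clubD nDb.
  have [v vb vP] := ch (g b) b e (block_end_ge _ _) e0.
  have [w wb wP] := aboveI ub vb; exists w => // y /wP[uy vy] yb.
  have -> : f b - f y = h (pt (g b) b) - h (pt (g b) y) by rewrite /f [g y]uP//; ring.
  exact: vP.
have gb : g b = b by exact: block_end_id.
have fb : f b = 0 by rewrite /f gb subrr.
have [[u ub uP]|niso] := pselect (exists2 u, above u b & forall y, above u y -> (y <= b)%O -> y = b).
  by exists u => // y uy yb; rewrite (uP y uy yb) subrr normr0.
have [P cP [Psucc PP]] := small e e0.
(* [b] is a limit of smaller points, whereas [P] consists of successors. As [P] is closed, it misses
   a left neighbourhood of [b]. *)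
have nPb : ~ P b.
  move=> /Psucc[a [ab ba]]; apply: niso; exists (Some a) => // y ay yb.
  by apply/le_anti; rewrite yb ba.
have [u ub uP] : exists2 u, above u b & forall x, above u x -> (x <= b)%O -> ~ P x.
  apply: contrapT => /forall2NP hP; apply: nPb; apply: (closed_woP wo P).1.
    exact: compact_closed_wo.
  move=> u ub; have [//|/existsNP[x /not_implyP[ux /not_implyP[xb /contrapT Px]]]] := hP u.
  by exists x.
have [v vb vP] := ch b b e (lexx b) e0.
have [w wb wP] := aboveI ub vb; exists w => // y /wP[uy vy] yb.
rewrite fb sub0r normrN; have gyb : (g y <= b)%O by exact: block_end_le.
(* If [y] lies in the block ending at [b], continuity along level [b] suffices. Otherwise the
   successor of [g y] still lies in the neighbourhood that [P] misses. *)
have [gyE|ngy] := eqVneq (g y) b.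
  by rewrite /f gyE distrC; exact: vP.
have {}gyb : (g y < b)%O by rewrite lt_neqAle ngy.
have [gs sle] := succ_ptP W_omega1 (g y).
apply: PP; apply: uP; last exact: sle.
exact: above_le (above_le uy (block_end_ge clubD y)) (ltW gs).
Qed.

Lemma character0_factors_L0 (T : bounded_op X X) :
  op_character T 0 -> factors_through T (C0 K (L0 W)).
Proof.
move=> [D cD TD]; have T0 f x : D x -> T f x = 0 by move=> /TD ->; rewrite mul0r.
have [M M0 TM] := op_bound T.
have /choice[F FP] f := L0_spread_ex cD (T0 f).
have /choice[G GP] h := L0_gather_ex cD h.
have [||R1 R1E] := @bounded_op_ex _ _ _ F M.
- move=> a f f'; apply: C0_ext => q; have [a' [b [ba ->]]] := L0_ptP W_omega1 q.
  rewrite C0D C0Z !(FP _ _ _ ba); case: ifP => _; last by rewrite mulr0 addr0.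
  by rewrite linearP C0D C0Z.
- move=> f; apply: C0_norm_le => [|q]; first by rewrite mulr_ge0// ltW.
  have [a [b [ba ->]]] := L0_ptP W_omega1 q; rewrite (FP _ _ _ ba).
  case: ifP => _; last by rewrite normr0 mulr_ge0// ltW.
  exact: le_trans (C0_norm_ge _ _) (TM f).
have [||U UE] := @bounded_op_ex _ _ _ G 2.
- move=> a f f'; apply: C0_ext => b; rewrite C0D C0Z !GP !C0D !C0Z.
  by ring.
- move=> f; apply: C0_norm_le => [|b]; first by rewrite mulr_ge0.
  by rewrite GP mulr_natl mulr2n (le_trans (ler_normB _ _))// lerD// C0_norm_ge.
exists R1, U; apply/funext => f; apply: C0_ext => b /=.
rewrite UE GP R1E !FP//; last exact: block_end_ge.
have Dg := block_end_in cD b.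
by rewrite eqxx (block_end_id cD Dg) eqxx (T0 f _ Dg) subr0.
Qed.

End factorization_through_L0.

(** * Weakly compact generation *)

Section weak_topology.
Variable K : numFieldType.

Lemma cvg_initial (S : choiceType) (T : topologicalType) (f : S -> T)
    (F : set_system S) (s : S) : Filter F ->
  f x @[x --> F] --> f s -> F --> (s : initial_topology f).
Proof.
move=> FF Ff A [/= _ [[B oB <-] Bs BA]].
by apply: filterS BA _; apply: (Ff B); exact: open_nbhs_nbhs.
Qed.

Lemma weak_cvg (X : normedModType K) (F : set_system X) (x : X) : Filter F ->
  (forall phi : functional X, (phi : X -> K^o) y @[y --> F] --> (phi x : K^o)) ->
  F --> (x : weak X).
Proof.
move=> FF Fphi; apply: cvg_initial; apply/cvg_sup => phi.
by apply: cvg_initial; exact: Fphi.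
Qed.

Lemma weak_continuous (X : normedModType K) (phi : functional X) :
  continuous (phi : weak X -> K^o).
Proof.
move=> x; apply: (@cvg_comp (weak X) {ptws functional X -> K^o} K^o
  (fun x (phi : functional X) => phi x) (@^~ phi) (nbhs x)
  (nbhs ((fun phi : functional X => phi x) : {ptws functional X -> K^o}))).
  exact: initial_continuous.
exact: (@proj_continuous (bounded_op X K^o) (fun=> K^o) phi).
Qed.

(** A filter that does not cluster at 0 is carried by finitely many of the vectors, and a finite set
    is compact. *)
Lemma weakly_compact_null_family (X : normedModType K) (I : choiceType) (v : I -> X) :
  (forall (phi : functional X) (e : K), 0 < e ->
     exists A0 : {fset I}, forall i, i \notin A0 -> `|phi (v i)| < e) ->
  weakly_compact (range v `|` [set 0]).
Proof.
move=> vphi F PF FA; apply: contrapT => noclus.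
have : ~ @cluster (weak X) F 0 by move=> cl0; apply: noclus; exists 0; split => //; right.
move=> /existsNP[B] /existsNP[N] /not_implyP[FB] /not_implyP[N0 BN].
pose G : set_system I := filter_from [set: {fset I}] (fun A => [set i | i \notin A]).
have FG : Filter G.
  apply: filter_from_filter; first by exists fset0.
  move=> A C _ _; exists (A `|` C)%fset => // i /=.
  by rewrite inE negb_or => /andP[].
have vG : v i @[i --> G] --> (0 : weak X).
  apply: weak_cvg => phi; apply/cvgrPdist_lt => e e0.
  have [A0 A0P] := vphi phi e e0; exists A0 => // i /A0P /=.
  by rewrite linear0 sub0r normrN.
have [A0 _ A0N] := vG _ N0.
have finA : finite_set (v @` [set` A0]) by exact: finite_image.
have FA0 : F (v @` [set` A0]).
  have : F (B `&` (range v `|` [set 0])) by exact: filterI.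
  apply: filterS => x [Bx [[i _ vx]|x0]].
    have [iA|niA] := boolP (i \in A0); first by exists i.
    by case: BN; exists x; split => //; rewrite -vx; exact: A0N.
  by case: BN; exists x; split => //; rewrite x0; exact: nbhs_singleton N0.
have [x [[i _ <-] cl]] := @finite_compact (weak X) _ finA F PF FA0.
by apply: noclus; exists (v i); split => //; left; exists i.
Qed.

Lemma linear_span_closed (X : normedModType K) (A : set X) :
  [/\ linear_span A 0, forall v, A v -> linear_span A v &
    forall a u v, linear_span A u -> linear_span A v -> linear_span A (a *: u + v)].
Proof.
split.
- by exists 0%N, (fun=> 0), (fun=> 0); split; [case|rewrite big_ord0].
- move=> v Av; exists 1%N, (fun=> 1), (fun=> v); split => //.
  by rewrite big_ord1 scale1r.
- move=> a u v [m [b [x [xA ->]]]] [n [c [y [yA ->]]]].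
  exists (m + n)%N, (fun i => match fintype.split i with inl j => a * b j | inr j => c j end),
    (fun i => match fintype.split i with inl j => x j | inr j => y j end).
  split => [i|]; first by case: (fintype.split i).
  rewrite big_split_ord /= scaler_sumr; congr (_ + _); apply: eq_bigr => i _.
    by rewrite (unsplitK (inl i)) /= scalerA.
  by rewrite (unsplitK (inr i)).
Qed.

End weak_topology.

(** * Closed subspaces and closures of ranges *)

Section closed_subspaces.
Variable K : numFieldType.

Lemma closed_subspace_ex (X : normedModType K) (P : set X) :
  P 0 -> (forall a u v, P u -> P v -> P (a *: u + v)) -> closed P ->
  exists Y : closed_subspace X, forall x, (x \in Y) <-> P x.
Proof.
move=> P0 PL cP; pose p : {pred X} := fun x => `[< P x >].
have pP x : (x \in p) <-> P x by split => [/asboolP|/asboolP].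
have pC : subsemimod_closed p.
  split; first split.
  - exact/pP.
  - by move=> u v /pP Pu /pP Pv; apply/pP; rewrite -[u]scale1r; exact: PL.
  - by move=> a u /pP Pu; apply/pP; rewrite -[_ *: _]addr0; exact: PL.
pose S : submodClosed X := HB.pack p (GRing.isSubmodClosed.Build K X p pC).
have cS : closed [set x | x \in (S : {pred X})].
  by rewrite (_ : [set x | _] = P)//; apply/seteqP; split => x /pP.
by exists (ClosedSubspace cS).
Qed.

Lemma corestriction_ex (X Z : normedModType K) (U : bounded_op Z X) (Y : closed_subspace X) :
  (forall z, U z \in Y) -> exists U' : bounded_op Z (subspace_elt Y), forall z, \val (U' z) = U z.
Proof.
move=> UY; have [M M0 UM] := op_bound U.
have [||U' U'E] := @bounded_op_ex _ _ _ (fun z => SubspaceElt (UY z)) M.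
- by move=> a f g; apply/val_inj; rewrite /= linearP.
- by move=> z; exact: UM.
- by exists U' => z; rewrite U'E.
Qed.

Lemma inclusion_ex (X : normedModType K) (Y : closed_subspace X) :
  exists J : bounded_op (subspace_elt Y) X, forall y, J y = \val y.
Proof.
have [||J JE] := @bounded_op_ex _ _ _ (fun y : subspace_elt Y => (\val y : X)) 1.
- by move=> a f g.
- by move=> y; rewrite mul1r.
- by exists J.
Qed.

(** [Y] is the closure of the range of [U]. The corestriction has dense range, so generators of [Z]
    are transported to [Y]. *)
Lemma closure_range_ex (X Z : normedModType K) (U : bounded_op Z X) :
  exists (Y : closed_subspace X) (U' : bounded_op Z (subspace_elt Y)),
    (forall z, \val (U' z) = U z) /\
    forall y (e : K), 0 < e -> exists z, `|y - U' z| < e.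
Proof.
pose P := [set x | forall e : K, 0 < e -> exists z, `|x - U z| < e].
have [||| Y YP] := @closed_subspace_ex X P.
- by move=> e e0; exists 0; rewrite linear0 subr0 normr0.
- move=> a u v Pu Pv e e0; have a0 : 0 < `|a| + 1 by rewrite ltr_wpDl.
  have [|zu zuP] := Pu (e / 2 / (`|a| + 1)); first by rewrite !divr_gt0.
  have [|zv zvP] := Pv (e / 2); first by rewrite divr_gt0.
  exists (a *: zu + zv); rewrite linearP opprD addrACA -scalerBr.
  rewrite (le_lt_trans (ler_normD _ _))// [ltRHS]splitr ltr_leD//; last exact: ltW.
  rewrite normrZ (@le_lt_trans _ _ ((`|a| + 1) * `|u - U zu|))//.
    by rewrite ler_wpM2r// lerDl.
  by rewrite mulrC -ltr_pdivlMr.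
- move=> x clx e e0; have e20 : 0 < e / 2 by rewrite divr_gt0.
  have [y [Py xy]] := clx _ (nbhsx_ballx x _ e20).
  have [z zP] := Py _ e20; exists z.
  rewrite -ball_normE /= in xy.
  have -> : x - U z = (x - y) + (y - U z) by rewrite addrA subrK.
  by rewrite (le_lt_trans (ler_normD _ _))// [ltRHS]splitr ltrD.
have UY z : U z \in Y by apply/YP => e e0; exists z; rewrite subrr normr0.
have [U' U'E] := corestriction_ex UY; exists Y, U'; split => // y e e0.
have [z zP] := (YP (\val y)).1 (valP y) e e0; exists z.
change (`|\val (y - U' z)| < e); by rewrite raddfB /= U'E.
Qed.

End closed_subspaces.

Section C0_L0.
Variables (R : realType) (k : scalar_kind).
Local Notation K := (scalars R k).
Variables (d : Order.disp_t) (W : orderTopologicalType d).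
Hypothesis W_omega1 : order_type_omega1 W.
Let wo := omega1_wo W_omega1.
Local Notation X0 := (C0 K (L0 W)).
Local Notation pt := (L0_pt W_omega1).
Local Notation level := (L0_level W_omega1).

Fact L0_box_subproof (p : L0 W) :
  {f : X0 | forall q, f q = ((level q == level p) && (L0_fst q <= L0_fst p)%O)%:R}.
Proof.
pose f (q : L0 W) : K^o := ((level q == level p) && (L0_fst q <= L0_fst p)%O)%:R.
have cf : continuous f.
  apply/(continuous_L0P W_omega1) => a b e ba e0.
  have [bp|pb] := leP b (L0_fst p).
    exists None => // y _ yb; rewrite /f !L0_level_pt (L0_fst_pt _ ba).
    by rewrite (L0_fst_pt _ (le_trans yb ba)) bp (le_trans yb bp) subrr normr0.
  exists (Some (L0_fst p)) => // y /= py yb.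
  rewrite /f (L0_fst_pt _ ba) (L0_fst_pt _ (le_trans yb ba)).
  by rewrite !leNgt pb py !andbF subrr normr0.
have vf : vanishes_at_infinity f.
  move=> e e0; exists [set q | level q = level p]; first exact: compact_L0_level.
  by move=> q /= /eqP/negbTE qp; rewrite /f qp normr0.
by exists (C0_of cf vf).
Qed.

(* The indicator function of [[0, b] x {a + 1}], where [p = (b, a + 1)]. *)
Definition L0_box (p : L0 W) : X0 := sval (L0_box_subproof p).

Lemma L0_boxE p q : L0_box p q = ((level q == level p) && (L0_fst q <= L0_fst p)%O)%:R.
Proof. exact: svalP (L0_box_subproof p) q. Qed.

Lemma compact_finitely_many_levels (A : set (L0 W)) : compact A ->
  exists s : {fset W}, forall q, A q -> level q \in s.
Proof.
move=> /compact_near_coveringP/(_ {fset W} totally (fun s q => level q \in s) _)[].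
  move=> q _; exists ([set q1 | level q1 = level q], [set s : {fset W} | level q \in s]) => /=.
    split; last by exists [fset level q]%fset => // s /=; rewrite fsub1set.
    have [qE qle] := L0_levelP W_omega1 q.
    suff : nbhs (pt (level q) (L0_fst q)) [set q' | level q' = level q] by rewrite -qE.
    by apply/(nbhs_L0P W_omega1 _ qle); exists None => // y _ _ /=; rewrite L0_level_pt.
  by move=> [q' s] [/= -> ].
by move=> s _ /(_ s (fsubset_refl _)) sP; exists s.
Qed.

(** On one level, transfinite induction on the first coordinate: a multiple of a difference of boxes
    treats [(u, b]], the induction hypothesis the rest. Vanishing at infinity leaves finitely many
    levels. *)
Lemma L0_boxes_dense (P : set X0) :
  P 0 -> (forall a f g, P f -> P g -> P (a *: f + g)) -> (forall p, P (L0_box p)) ->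
  forall (f : X0) (e : K), 0 < e -> exists2 g, P g & `|f - g| <= e.
Proof.
move=> P0 PL Pbox f e e0.
have PD f' g' : P f' -> P g' -> P (f' + g') by move=> ? ?; rewrite -[f']scale1r; exact: PL.
have PZ a f' : P f' -> P (a *: f') by move=> ?; rewrite -[_ *: _]addr0; exact: PL.
have PB f' g' : P f' -> P g' -> P (f' - g').
  by move=> ? ?; apply: (PD) => //; rewrite -scaleN1r; exact: PZ.
(* Exact vanishing off the segment is part of the claim, so that approximants for different
   intervals and levels can be added. *)
have approx a b : (b <= a)%O -> exists2 g, P g & forall q,
    if (level q == a) && (L0_fst q <= b)%O then is_true (`|f q - g q| < e) else g q = 0.
  elim/(wo_ind wo) : b => b IH ba.
  have [u ub uP] := (continuous_L0P W_omega1 f).1 (@C0_continuous _ _ f) a b e ba e0.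
  have {}uP q : level q = a -> above u (L0_fst q) -> (L0_fst q <= b)%O ->
      `|f q - f (pt a b)| < e.
    move=> qa uq qb; rewrite distrC; have [qE _] := L0_levelP W_omega1 q.
    by rewrite qE qa; exact: uP.
  case: u ub uP => [u|] /= ub uP; last first.
    exists (f (pt a b) *: L0_box (pt a b)); first exact: PZ.
    move=> q; rewrite C0Z L0_boxE L0_level_pt L0_fst_pt//.
    have [/andP[/eqP qa qb]|_] := boolP ((level q == a) && (L0_fst q <= b)%O).
      by rewrite mulr1 uP.
    by rewrite mulr0.
  have [g Pg gP] := IH u ub (ltW (lt_le_trans ub ba)).
  exists (g + f (pt a b) *: (L0_box (pt a b) - L0_box (pt a u))).
    by apply: (PD) => //; apply: (PZ); exact: PB.
  move=> q; rewrite C0D C0Z; have [_ _ _ -> _] := C0E (L0_box (pt a b)) (L0_box (pt a u)) 0 q.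
  rewrite !L0_boxE !L0_level_pt !L0_fst_pt ?(ltW (lt_le_trans ub ba))//.
  have := gP q; have [qa|_] /= := eqVneq (level q) a; last first.
    by move=> ->; rewrite subrr mulr0 addr0.
  have [qu|uq] := leP (L0_fst q) u.
    by rewrite (le_trans qu (ltW ub)) subrr mulr0 addr0.
  move=> ->; rewrite add0r subr0.
  have [qb|_] := boolP (L0_fst q <= b)%O; last by rewrite mulr0.
  by rewrite mulr1; exact: uP.
have [A cA fA] := @C0_vanish _ _ f _ e0.
have [s sP] := compact_finitely_many_levels cA.
have /choice[g gP] a : exists g, P g /\ forall q,
    if level q == a then is_true (`|f q - g q| < e) else g q = 0.
  have [g Pg gq] := approx a a (lexx a); exists g; split => // q.
  have := gq q; have [qa|//] := eqVneq (level q) a.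
  by have [_] := L0_levelP W_omega1 q; rewrite qa => ->.
exists (\sum_(a <- s) g a).
  by elim/big_rec : _ => // a h _ Ph; apply: (PD) => //; have [] := gP a.
apply: C0_norm_le => [|q]; first exact: ltW.
have [_ _ _ -> _] := C0E f (\sum_(a <- s) g a) 0 q; rewrite C0_sum.
have [qs|nqs] := boolP (level q \in s).
  rewrite (big_fsetD1 _ qs) /= big1_seq => [|a /=].
    by rewrite addr0; have [_ /(_ q)] := gP (level q); rewrite eqxx => /ltW.
  rewrite !inE => /andP[aq _]; have [_ /(_ q)] := gP a.
  by rewrite eq_sym (negbTE aq).
rewrite big1_seq => [|a /= sa].
  by rewrite subr0 ltW// fA// => /sP; rewrite (negbTE nqs).
have [_ /(_ q)] := gP a; case: eqP => // qa; by rewrite qa sa in nqs.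
Qed.

Lemma code_ex (a : W) : exists c : W -> nat, forall x y, (x <= a)%O -> (y <= a)%O ->
  c x = c y -> x = y.
Proof.
have /countable_injP[c cinj] := countable_below W_omega1 a; exists c => x y xa ya.
by apply: cinj; rewrite inE.
Qed.

Definition L0_code (q : L0 W) : nat := sval (cid (code_ex (level q))) (L0_fst q).

Lemma L0_code_inj p q : level p = level q -> L0_code p = L0_code q -> p = q.
Proof.
move=> pq; rewrite /L0_code pq; case: cid => c /= cinj cpq.
have [pE ple] := L0_levelP W_omega1 p; have [qE qle] := L0_levelP W_omega1 q.
by rewrite pE qE pq (cinj _ _ _ _ cpq)// -pq.
Qed.

(** Each level is countable and coded injectively, so its weights sum to at most 2. This controls
    both the weak nullity and the operator from the square-summable families. *)
Definition L0_weight (q : L0 W) : K := 2 ^- L0_code q.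

Lemma L0_weight_gt0 q : 0 < L0_weight q.
Proof. by rewrite invr_gt0 exprn_gt0. Qed.

Lemma sum_geometric_le (s : seq nat) : uniq s -> \sum_(n <- s) (2 ^- n : K) <= 2.
Proof.
move=> us; pose N := (\max_(n <- s) n).+1.
have geo m : \sum_(0 <= n < m) (2 ^- n : K) = 2 - 2 * 2 ^- m.
  elim: m => [|m IH]; first by rewrite big_geq// expr0 invr1 mulr1 subrr.
  by rewrite big_nat_recr //= IH exprS invfM mulrA divff ?pnatr_eq0// mul1r; ring.
apply: (@le_trans _ _ (\sum_(0 <= n < N) (2 ^- n : K))).
  rewrite [leRHS](bigID (mem s)) /= ler_wpDr//.
    by apply: sumr_ge0 => n _; rewrite invr_ge0 exprn_ge0.
  rewrite -[leRHS]big_filter le_eqVlt; apply/orP; left; apply/eqP.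
  apply: perm_big; apply: uniq_perm => //; first by rewrite filter_uniq// iota_uniq.
  move=> n; rewrite mem_filter mem_index_iota leq0n /= ltnS.
  have [ns|//] := boolP (n \in s).
  by apply/esym; apply: (@leq_bigmax_seq _ s xpredT id).
by rewrite geo gerBl mulr_ge0// invr_ge0 exprn_ge0.
Qed.

Lemma L0_weight_sum (s : seq (L0 W)) (a : W) : uniq s ->
  \sum_(q <- s | level q == a) L0_weight q <= 2.
Proof.
move=> us; rewrite -big_filter /L0_weight -(big_map L0_code xpredT (fun n => 2 ^- n)).
apply: sum_geometric_le; rewrite map_inj_in_uniq ?filter_uniq// => p q.
rewrite !mem_filter => /andP[/eqP pa _] /andP[/eqP qa _]; apply: L0_code_inj.
by rewrite pa qa.
Qed.

Definition L0_generator (q : L0 W) : X0 := L0_weight q *: L0_box q.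

(** At any point only generators of one level are nonzero, so unimodular combinations have norm at
    most 2. The values of [phi] on the generators are therefore absolutely summable. *)
Lemma L0_generator_small (phi : functional X0) (e : K) : 0 < e ->
  exists A0 : {fset L0 W}, forall q, q \notin A0 -> `|phi (L0_generator q)| < e.
Proof.
move=> e0; have [M M0 phiM] := op_bound phi.
have gs : absolutely_summable (fun q => phi (L0_generator q)).
  exists (M * 2) => A; rewrite (partial_sumE (fun q => `|phi (L0_generator q)|)).
  pose f := \sum_(q <- A) phase (phi (L0_generator q)) *: L0_generator q.
  have -> : \sum_(q <- A) `|phi (L0_generator q)| = phi f.
    rewrite /f linear_sum; apply: eq_bigr => q _; move: (L0_generator q) => v.
    by rewrite linearZ /= [_ *: _]phase_mul.
  have phif : phi f = `|phi f|.
    rewrite ger0_norm// /f linear_sum sumr_ge0// => q _; move: (L0_generator q) => v.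
    by rewrite linearZ /= [_ *: _]phase_mul.
  rewrite phif (le_trans (phiM f))// ler_wpM2l ?(ltW M0)//.
  apply: C0_norm_le => // p; rewrite /f C0_sum.
  rewrite (le_trans (ler_norm_sum _ _ _))//.
  apply: le_trans (L0_weight_sum (level p) (fset_uniq A)).
  rewrite [leRHS]big_mkcond; apply: ler_sum => q _.
  rewrite C0Z C0Z L0_boxE normrM phase_norm mul1r normrM normr_nat gtr0_norm ?L0_weight_gt0//.
  rewrite [level p == _]eq_sym; case: eqP => _ /=; last by rewrite mulr0.
  by rewrite ler_piMr ?lern1 ?leq_b1// ltW// L0_weight_gt0.
have [A0 A0P] := absolutely_summable_tail gs e0; exists A0 => q qA0.
by have := A0P [fset q]%fset; rewrite big_seq_fset1; apply; rewrite fdisjointX1.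
Qed.

Lemma factors_L0_weakly_compactly_generated (X : normedModType K) (T : bounded_op X X) :
  factors_through T X0 ->
  exists2 Y : closed_subspace X, weakly_compactly_generated (subspace_elt Y) &
    range T `<=` [set f | f \in Y].
Proof.
move=> [S [U TE]]; have [Y [U' [U'E U'd]]] := closure_range_ex U.
exists Y; last by move=> _ [f _ <-]; rewrite TE /= -U'E; exact: valP.
exists (range (U' \o L0_generator) `|` [set 0]).
  apply: weakly_compact_null_family => phi e e0.
  exact: (L0_generator_small (comp_op phi U')).
apply/dense_normP => y e e0.
have e20 : 0 < e / 2 by rewrite divr_gt0.
have [M M0 U'M] := op_bound U'.
have [z zy] := U'd y _ e20.
set A := _ `|` _; have [sp0 spA spL] := linear_span_closed A.
pose P := [set g | linear_span A (U' g)].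
have PL a f g : P f -> P g -> P (a *: f + g).
  by move=> fA gA; rewrite /P /= linearP; exact: spL.
have P0 : P 0 by rewrite /P /= linear0.
have Pbox p : P (L0_box p).
  have -> : L0_box p = (L0_weight p)^-1 *: L0_generator p + 0.
    by rewrite addr0 /L0_generator scalerA mulVf ?scale1r// gt_eqF// L0_weight_gt0.
  by apply: PL => //; apply: spA; left; exists p.
have eM0 : 0 < e / 2 / M by rewrite divr_gt0.
have [g gA gz] := L0_boxes_dense P0 PL Pbox z eM0.
exists (U' g) => //.
have -> : y - U' g = (y - U' z) + U' (z - g) by rewrite linearB addrA subrK.
rewrite (le_lt_trans (ler_normD _ _))// [ltRHS]splitr ltr_leD// (le_trans (U'M _))//.
by rewrite mulrC -ler_pdivlMr.
Qed.

End C0_L0.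

(** * Hilbert generation *)

Section conjugation.
Variables (R : realType) (k : scalar_kind).
Local Notation K := (scalars R k).
Local Notation conj := (@scalar_conj R k).

Lemma scalar_conj_rmorph : exists c : {rmorphism K -> K}, forall z, c z = conj z.
Proof. by rewrite /scalar_conj; case: k; [exists idfun|exists conjc]. Qed.

Lemma scalar_conjD (x y : K) : conj (x + y) = conj x + conj y.
Proof. by have [c cE] := scalar_conj_rmorph; rewrite -!cE rmorphD. Qed.

Lemma scalar_conjM (x y : K) : conj (x * y) = conj x * conj y.
Proof. by have [c cE] := scalar_conj_rmorph; rewrite -!cE rmorphM. Qed.

Lemma scalar_conjB (x y : K) : conj (x - y) = conj x - conj y.
Proof. by have [c cE] := scalar_conj_rmorph; rewrite -!cE rmorphB. Qed.

Lemma scalar_conj0 : conj 0 = 0.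
Proof. by have [c cE] := scalar_conj_rmorph; rewrite -!cE rmorph0. Qed.

Lemma scalar_conjK (x : K) : conj (conj x) = x.
Proof. by rewrite /scalar_conj; case: k x => //=; exact: conjcK. Qed.

Lemma scalar_mul_conj (x : K) : x * conj x = `|x| ^+ 2.
Proof.
rewrite /scalar_conj; case: k x => /= x; first by rewrite real_normK ?num_real.
case: x => a b; rewrite normc_def; simpc => /=.
by rewrite -rmorphXn /= sqr_sqrtr ?addr_ge0 ?sqr_ge0// [b * a]mulrC addNr.
Qed.

Lemma scalar_conj_norm (x : K) : `|conj x| = `|x|.
Proof.
by apply/eqP; rewrite -(@eqrXn2 _ 2)// -!scalar_mul_conj scalar_conjK mulrC.
Qed.

Lemma scalar_conj_ge0 (x : K) : 0 <= x -> conj x = x.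
Proof.
move=> x0; have [->|xn0] := eqVneq x 0; first exact: scalar_conj0.
by apply: (mulfI xn0); rewrite scalar_mul_conj ger0_norm// expr2.
Qed.

End conjugation.

(** * Unordered sums and square-summable families *)

Section unordered_sums.
Variables (R : realType) (k : scalar_kind).
Local Notation K := (scalars R k).
Variable I : topologicalType.

Lemma absolutely_summable_cvg (g : I -> K^o) : absolutely_summable g ->
  cvg (partial_sum g @ totally).
Proof.
move=> gs; apply: scalar_complete; apply: cauchy_exP => e e0.
have [A0 A0P] := absolutely_summable_tail gs e0; exists (partial_sum g A0).
exists A0 => // A /= A0A; rewrite -ball_normE /= !partial_sumE distrC.
rewrite (big_fsetID _ (mem A0) A) /=.
have -> : [fset x in A | x \in A0]%fset = A0.
  by apply/fsetP => x; rewrite !inE /= andbC; case: (boolP (x \in A0)) => //= /(fsubsetP A0A).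
rewrite addrAC subrr add0r (le_lt_trans (ler_norm_sum _ _ _))//; apply: A0P.
by apply/fdisjointP => x xA0; rewrite !inE /= xA0 andbF.
Qed.

Definition unordered_sum (g : I -> K^o) : K^o := lim (partial_sum g @ totally).
Local Notation tsum := unordered_sum.

Lemma tsum_cvg (g : I -> K^o) : absolutely_summable g -> partial_sum g @ totally --> tsum g.
Proof. exact: absolutely_summable_cvg. Qed.

Lemma tsumE (g : I -> K^o) z : partial_sum g @ totally --> z -> tsum g = z.
Proof. by move=> gz; apply: cvg_lim gz; exact: norm_hausdorff. Qed.

Lemma tsum_linear (a : K) (f g : I -> K^o) : absolutely_summable f -> absolutely_summable g ->
  tsum (fun i => a * f i + g i) = a * tsum f + tsum g.
Proof.
move=> fs gs; apply: tsumE.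
have -> : partial_sum (fun i => a * f i + g i) =
    (fun A => a *: (partial_sum f A : K^o) + partial_sum g A).
  apply/funext => A; rewrite !partial_sumE big_split /=; congr (_ + _).
  by rewrite scaler_sumr.
by apply: cvgD; [apply: cvgZr|]; exact: tsum_cvg.
Qed.

Lemma tsum_near (g : I -> K^o) (A : {fset I}) (e : K) : absolutely_summable g ->
  (forall B : {fset I}, (A `<=` B)%fset -> `|\sum_(i <- B) g i - \sum_(i <- A) g i| <= e) ->
  `|tsum g - \sum_(i <- A) g i| <= e.
Proof.
move=> gs gA; apply/ler_addgt0Pr => e' e'0.
have /cvgrPdist_lt/(_ _ e'0)[B0 _ B0P] := tsum_cvg gs.
have := B0P (A `|` B0)%fset (fsubsetUr _ _); rewrite /= partial_sumE => h.
rewrite -(subrK (\sum_(i <- (A `|` B0)%fset) g i) (tsum g)) -addrA addrC.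
rewrite (le_trans (ler_normD _ _))// lerD ?(ltW h)//.
by apply: gA; exact: fsubsetUl.
Qed.

Lemma tsum_le (g : I -> K^o) (M : K) : absolutely_summable g ->
  (forall A : {fset I}, `|\sum_(i <- A) g i| <= M) -> `|tsum g| <= M.
Proof.
move=> gs gM; have := @tsum_near g fset0 M gs; rewrite big_seq_fset0 subr0; apply.
by move=> B _; rewrite subr0.
Qed.

Lemma tsum_ge (g : I -> K^o) (A : {fset I}) : absolutely_summable g ->
  (forall i, 0 <= g i) -> \sum_(i <- A) g i <= `|tsum g|.
Proof.
move=> gs g0; apply/ler_addgt0Pr => e e0.
have /cvgrPdist_lt/(_ _ e0)[B0 _ B0P] := tsum_cvg gs.
have := B0P (A `|` B0)%fset (fsubsetUr _ _); rewrite /= partial_sumE => h.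
apply: (@le_trans _ _ `|\sum_(i <- (A `|` B0)%fset) g i|).
  rewrite ger0_norm ?sumr_ge0// (big_fsetID _ (mem A) (A `|` B0)%fset) /=.
  have -> : [fset x in (A `|` B0)%fset | x \in A]%fset = A.
    by apply/fsetP => x; rewrite !inE /=; case: (x \in A); rewrite ?andbF.
  by rewrite lerDl sumr_ge0.
rewrite -lerBlDl (le_trans (lerB_dist _ _))// distrC ltW//.
Qed.

Lemma tsum_single (g : I -> K^o) (p : I) : (forall i, i != p -> g i = 0) -> tsum g = g p.
Proof.
move=> gp; apply: tsumE; apply/cvgrPdist_lt => e e0; exists [fset p]%fset => // A /=.
rewrite fsub1set => pA; rewrite partial_sumE (big_fsetD1 p pA) /= big1_seq ?addr0 ?subrr ?normr0//.
by move=> i /=; rewrite !inE => /andP[ip _]; rewrite gp.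
Qed.

End unordered_sums.

Definition ell2_pred (R : realType) (k : scalar_kind) (I : topologicalType) :
    {pred (I -> (scalars R k)^o)} :=
  [pred x | `[< absolutely_summable (fun i => `|x i| ^+ 2 : (scalars R k)^o) >]].

Arguments ell2_pred : clear implicits.

Record ell2 (R : realType) (k : scalar_kind) (I : topologicalType) := Ell2 {
  ell2_fun :> I -> (scalars R k)^o;
  ell2_funP : ell2_fun \in ell2_pred R k I
}.

Section ell2_space.
Variables (R : realType) (k : scalar_kind).
Local Notation K := (scalars R k).
Local Notation conj := (@scalar_conj R k).
Variable I : topologicalType.
Local Notation H := (ell2 R k I).
Local Notation tsum := (@unordered_sum R k I).

Lemma ell2_predP (x : I -> K^o) : reflect
  (exists M : K, forall A : {fset I}, \sum_(i <- A) `|x i| ^+ 2 <= M) (x \in ell2_pred R k I).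
Proof.
apply: (iffP (asboolP _)) => -[M xM]; exists M => A; have := xM A; rewrite partial_sumE.
  by under eq_bigr do rewrite normrX normr_id.
by move=> xMA; under eq_bigr do rewrite normrX normr_id.
Qed.

Lemma sqr_normD_le (x y : K) : `|x + y| ^+ 2 <= 2 * `|x| ^+ 2 + 2 * `|y| ^+ 2.
Proof.
rewrite (@le_trans _ _ ((`|x| + `|y|) ^+ 2))//.
  by rewrite lerXn2r ?nnegrE ?addr_ge0 ?ler_normD.
have -> : 2 * `|x| ^+ 2 + 2 * `|y| ^+ 2 = (`|x| + `|y|) ^+ 2 + (`|x| - `|y|) ^+ 2 by ring.
by rewrite lerDl real_exprn_even_ge0// realB// ger0_real.
Qed.

Lemma ell2_submod_closed : subsemimod_closed (ell2_pred R k I).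
Proof.
split; first split.
- by apply/ell2_predP; exists 0 => A; rewrite big1// => i _; rewrite normr0 expr0n.
- move=> x y /ell2_predP[M xM] /ell2_predP[N yN]; apply/ell2_predP.
  exists (2 * M + 2 * N) => A.
  apply: (@le_trans _ _ (\sum_(i <- A) (2 * `|x i| ^+ 2 + 2 * `|y i| ^+ 2))).
    by apply: ler_sum => i _; exact: sqr_normD_le.
  by rewrite big_split /= -!mulr_sumr lerD// ler_wpM2l.
- move=> a x /ell2_predP[M xM]; apply/ell2_predP; exists (`|a| ^+ 2 * M) => A.
  apply: (@le_trans _ _ (\sum_(i <- A) `|a| ^+ 2 * `|x i| ^+ 2)).
    by apply: ler_sum => i _; rewrite -exprMn -normrM.
  by rewrite -mulr_sumr ler_wpM2l ?exprn_ge0.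
Qed.

HB.instance Definition _ :=
  GRing.isSubmodClosed.Build K (I -> K^o) (ell2_pred R k I) ell2_submod_closed.
HB.instance Definition _ := [isSub for @ell2_fun R k I].
HB.instance Definition _ := [Choice of H by <:].
HB.instance Definition _ := [SubChoice_isSubLmodule of H by <:].

Lemma ell2E (x y : H) (a : K) (i : I) :
  [/\ (x + y) i = x i + y i, (a *: x) i = a * x i, (x - y) i = x i - y i & (0 : H) i = 0].
Proof. by []. Qed.

(** The parameter balances the two terms: 1 suffices for summability, a bound on the norm of [x]
    gives the operator bound. *)
Lemma ell2_mul_le (x y : K) (t : K) : 0 < t ->
  `|x * y| <= (t^-1 * `|x| ^+ 2 + t * `|y| ^+ 2) / 2.
Proof.
move=> t0; rewrite ler_pdivlMr// normrM -subr_ge0.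
have -> : t^-1 * `|x| ^+ 2 + t * `|y| ^+ 2 - `|x| * `|y| * 2 =
    t^-1 * (`|x| - t * `|y|) ^+ 2.
  have t1 : t^-1 * t = 1 by rewrite mulVf// gt_eqF.
  rewrite sqrrB [X in _ = X]mulrDr [in RHS]mulrBr.
  have -> : t^-1 * (t * `|y|) ^+ 2 = (t^-1 * t) * (t * `|y| ^+ 2) by ring.
  have -> : t^-1 * (`|x| * (t * `|y|) *+ 2) = (t^-1 * t) * (`|x| * `|y| * 2).
    by rewrite -mulr_natr; ring.
  by rewrite t1 !mul1r addrAC.
rewrite mulr_ge0 ?invr_ge0 ?(ltW t0)// real_exprn_even_ge0// realB// ger0_real//.
by rewrite mulr_ge0// ltW.
Qed.

Lemma ell2_pairing_summable (x y : H) : absolutely_summable (fun i => x i * y i).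
Proof.
have /ell2_predP[M xM] := ell2_funP x; have /ell2_predP[N yN] := ell2_funP y.
exists ((M + N) / 2) => A; rewrite (partial_sumE (fun i => `|x i * y i|)).
apply: (@le_trans _ _ (\sum_(i <- A) (`|x i| ^+ 2 + `|y i| ^+ 2) / 2)).
  by apply: ler_sum => i _; have := @ell2_mul_le (x i) (y i) 1 ltr01; rewrite invr1 !mul1r.
by rewrite -mulr_suml ler_pM2r ?invr_gt0// big_split /= lerD.
Qed.

Lemma ell2_conj_subproof (x : H) : (fun i => conj (x i)) \in ell2_pred R k I.
Proof.
have /ell2_predP[M xM] := ell2_funP x; apply/ell2_predP; exists M => A.
by under eq_bigr do rewrite scalar_conj_norm.
Qed.

Definition ell2_conj (x : H) : H := Ell2 (ell2_conj_subproof x).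

Definition ell2_ip (x y : H) : K := tsum (fun i => x i * conj (y i)).

Lemma ell2_ip_cvg (x y : H) :
  partial_sum (fun i => x i * conj (y i)) @ totally --> (ell2_ip x y : K^o).
Proof. exact: tsum_cvg (ell2_pairing_summable x (ell2_conj y)). Qed.

Lemma ell2_ip_linear (a : K) (x x' y : H) :
  ell2_ip (a *: x + x') y = a * ell2_ip x y + ell2_ip x' y.
Proof.
rewrite /ell2_ip -tsum_linear; [|exact: (ell2_pairing_summable x (ell2_conj y))|
  exact: (ell2_pairing_summable x' (ell2_conj y))].
congr unordered_sum; apply/funext => i.
by have [-> _ _ _] := ell2E (a *: x) x' 0 i; have [_ -> _ _] := ell2E x x' a i; ring.
Qed.

Lemma ell2_ipC (x y : H) : ell2_ip x y = conj (ell2_ip y x).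
Proof.
apply: tsumE; apply/cvgrPdist_lt => e e0.
have /cvgrPdist_lt/(_ _ e0)[A0 _ A0P] := @ell2_ip_cvg y x.
exists A0 => // A /A0P /=; rewrite !partial_sumE -(scalar_conj_norm (_ - _)) scalar_conjB.
congr (`|_ - _| < e); have [c cE] := scalar_conj_rmorph R k.
rewrite -cE rmorph_sum; apply: eq_bigr => i _.
by rewrite cE scalar_conjM scalar_conjK mulrC.
Qed.

Lemma ell2_ip_linearr (a : K) (x y y' : H) :
  ell2_ip x (a *: y + y') = conj a * ell2_ip x y + ell2_ip x y'.
Proof.
by rewrite ell2_ipC ell2_ip_linear scalar_conjD scalar_conjM -!ell2_ipC.
Qed.

Lemma ell2_ip_xx_summable (x : H) : absolutely_summable (fun i => x i * conj (x i)).
Proof. exact: (ell2_pairing_summable x (ell2_conj x)). Qed.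

Lemma ell2_partial_le (x : H) (A : {fset I}) : \sum_(i <- A) `|x i| ^+ 2 <= `|ell2_ip x x|.
Proof.
under eq_bigr do rewrite -scalar_mul_conj.
apply: tsum_ge; first exact: ell2_ip_xx_summable.
by move=> i; rewrite scalar_mul_conj exprn_ge0.
Qed.

(** For complex scalars this includes being real, so the sum is compared with its own modulus
    through nonnegative partial sums. *)
Lemma ell2_ip_ge0 (x : H) : 0 <= ell2_ip x x.
Proof.
suff -> : ell2_ip x x = `|ell2_ip x x| by [].
apply/eqP; rewrite -subr_eq0 -normr_le0; apply/ler_addgt0Pr => e e0; rewrite add0r.
have e20 : 0 < e / 2 by rewrite divr_gt0.
have /cvgrPdist_lt/(_ _ e20)[A0 _ /(_ A0 (fsubset_refl _))] := @ell2_ip_cvg x x.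
rewrite /= partial_sumE; set s := \sum_(i <- A0) _ => h.
have s0 : 0 <= s by apply: sumr_ge0 => i _; rewrite scalar_mul_conj exprn_ge0.
have -> : ell2_ip x x - `|ell2_ip x x| = (ell2_ip x x - s) + (s - `|ell2_ip x x|) by ring.
rewrite (le_trans (ler_normD _ _))// [leRHS]splitr lerD ?(ltW h)//.
by rewrite -[s]ger0_norm// (le_trans (ler_dist_dist _ _))// distrC ltW.
Qed.

Lemma ell2_ip_eq0 (x : H) : ell2_ip x x = 0 -> x = 0.
Proof.
move=> x0; apply/val_inj/funext => i; apply/eqP.
have := ell2_partial_le x [fset i]%fset; rewrite big_seq_fset1 x0 normr0.
by move=> xi; rewrite -normr_eq0 -sqrf_eq0 eq_le xi exprn_ge0.
Qed.

Definition ell2_norm (x : H) : K := scalar_of R k (Num.sqrt (scalar_abs (ell2_ip x x))).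

Lemma ell2_norm_ge0 (x : H) : 0 <= ell2_norm x.
Proof. by rewrite /ell2_norm -(rmorph0 (scalar_of R k)) ler_scalar_of sqrtr_ge0. Qed.

Lemma ell2_norm_sqr (x : H) : ell2_norm x ^+ 2 = ell2_ip x x.
Proof.
by rewrite /ell2_norm -rmorphXn /= sqr_sqrtr ?scalar_abs_ge0// -normE ger0_norm// ell2_ip_ge0.
Qed.

Lemma ell2_cauchy_schwarz (x y : H) : `|ell2_ip x y| <= ell2_norm x * ell2_norm y.
Proof.
have n0 : 0 <= ell2_norm x * ell2_norm y by rewrite mulr_ge0// ell2_norm_ge0.
rewrite -(@ler_pXn2r _ 2)// ?nnegrE// exprMn !ell2_norm_sqr.
have [c cE] := scalar_conj_rmorph R k.
have [yy0|yy0] := eqVneq (ell2_ip y y) 0.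
  have xy0 : ell2_ip x y = 0.
    have := ell2_ip_linearr (-1) x 0 0; rewrite scaler0 addr0 (ell2_ip_eq0 yy0) => ->.
    by rewrite -cE rmorphN rmorph1 mulN1r addNr.
  by rewrite xy0 normr0 expr0n mulr_ge0// ell2_ip_ge0.
have yyp : 0 < ell2_ip y y by rewrite lt_neqAle eq_sym yy0 ell2_ip_ge0.
set z := ell2_ip x y; set N := ell2_ip y y in yy0 yyp *.
(* This [a] makes [w] orthogonal to [y]. *)
pose a := - (z / N); pose w := a *: y + x.
have cN : c N = N by rewrite cE scalar_conj_ge0// ell2_ip_ge0.
have ca : c a = - (c z / N) by rewrite /a rmorphN rmorphM fmorphV cN.
have yx : ell2_ip y x = c z by rewrite ell2_ipC -cE.
have := ell2_ip_ge0 w; rewrite {1}/w ell2_ip_linear !ell2_ip_linearr -/z -/N -!cE yx ca.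
have -> : a * (- (c z / N) * N + c z) + (- (c z / N) * z + ell2_ip x x) =
    ell2_ip x x - (z * c z) / N.
  by rewrite [_ * N]mulNr divfK// addNr mulr0 add0r; ring.
by rewrite cE scalar_mul_conj subr_ge0 ler_pdivrMr.
Qed.

Lemma ell2_normD (x y : H) : ell2_norm (x + y) <= ell2_norm x + ell2_norm y.
Proof.
have n0 := addr_ge0 (ell2_norm_ge0 x) (ell2_norm_ge0 y).
rewrite -(@ler_pXn2r _ 2)// ?nnegrE ?ell2_norm_ge0// sqrrD !ell2_norm_sqr.
have ipD : ell2_ip (x + y) (x + y) =
    ell2_ip x x + ell2_ip x y + (ell2_ip y x + ell2_ip y y).
  have H1 u : ell2_ip (x + y) u = ell2_ip x u + ell2_ip y u.
    by rewrite -[x in LHS]scale1r ell2_ip_linear mul1r.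
  have H2 u : ell2_ip u (x + y) = ell2_ip u x + ell2_ip u y.
    by rewrite -[x in LHS]scale1r ell2_ip_linearr scalar_conj_ge0// mul1r.
  by rewrite H1 !H2.
rewrite ipD; have cs := ell2_cauchy_schwarz x y.
have cs' : `|ell2_ip y x| <= ell2_norm x * ell2_norm y.
  by rewrite ell2_ipC scalar_conj_norm.
set r := ell2_norm x * ell2_norm y in cs cs' *.
rewrite (le_trans (real_ler_norm _))//.
  by rewrite -ipD ger0_real// ell2_ip_ge0.
rewrite (le_trans (ler_normD _ _))//.
rewrite (le_trans (lerD (ler_normD _ _) (ler_normD _ _)))//.
rewrite !(ger0_norm (ell2_ip_ge0 _)) mulr2n !addrA lerD2r -!addrA lerD2l.
by rewrite lerD.
Qed.

Lemma ell2_normZ (a : K) (x : H) : ell2_norm (a *: x) = `|a| * ell2_norm x.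
Proof.
apply/eqP; rewrite -(@eqrXn2 _ 2)// ?mulr_ge0 ?ell2_norm_ge0// exprMn !ell2_norm_sqr.
have ip0 u : ell2_ip 0 u = 0.
  by have := ell2_ip_linear (-1) 0 0 u; rewrite scaler0 addr0 mulN1r addNr.
have ip0' u : ell2_ip u 0 = 0 by rewrite ell2_ipC ip0 scalar_conj0.
rewrite -[a *: x]addr0 ell2_ip_linear ip0 ell2_ip_linearr ip0' !addr0.
by rewrite mulrA scalar_mul_conj.
Qed.

Lemma ell2_norm0 (x : H) : ell2_norm x = 0 -> x = 0.
Proof. by move=> x0; apply: ell2_ip_eq0; rewrite -ell2_norm_sqr x0 expr0n. Qed.

HB.instance Definition _ := Lmodule_isNormed.Build K H ell2_normD ell2_normZ ell2_norm0.

Lemma ell2_normE (x : H) : `|x| = ell2_norm x. Proof. by []. Qed.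

Lemma ell2_coord_le (x : H) (i : I) : `|x i| <= `|x|.
Proof.
rewrite -(@ler_pXn2r _ 2)// ?nnegrE// ell2_normE ell2_norm_sqr.
have := ell2_partial_le x [fset i]%fset; rewrite big_seq_fset1 => /le_trans; apply.
by rewrite ger0_norm// ell2_ip_ge0.
Qed.

Lemma ell2_norm_le (x : H) (M : K) : 0 <= M ->
  (forall A : {fset I}, \sum_(i <- A) `|x i| ^+ 2 <= M ^+ 2) -> `|x| <= M.
Proof.
move=> M0 xM; rewrite -(@ler_pXn2r _ 2)// ?nnegrE// ell2_normE ell2_norm_sqr.
rewrite -[leLHS](ger0_norm (ell2_ip_ge0 _)); apply: tsum_le.
  exact: ell2_ip_xx_summable.
move=> A; rewrite ger0_norm; last by apply: sumr_ge0 => i _; rewrite scalar_mul_conj exprn_ge0.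
by under eq_bigr do rewrite scalar_mul_conj.
Qed.

Lemma ell2_complete (F : set_system H) : ProperFilter F -> cauchy F -> cvg F.
Proof.
move=> PF /cauchyP Fc.
have /choice[x xP] (i : I) : exists z : K^o, (u : H) i @[u --> F] --> z.
  have : cvg ((u : H) i @[u --> F]).
    apply: scalar_complete; apply: cauchy_exP => e e0; have [u Fu] := Fc e e0.
    exists (u i); change (F [set v : H | ball (u i : K^o) e (v i)]).
    apply: filterS Fu => v; rewrite -!ball_normE /= => uv.
    by apply: le_lt_trans uv; exact: (ell2_coord_le (u - v)).
  by move=> /cvg_ex[z]; exists z.
(* Two members of the ball differ by at most [2 * e]; on a finite [A] one of them may be replaced by
   the coordinatewise limit. *)
have near_sum (e : K) : 0 < e -> exists u : H, F (ball u e) /\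
    forall v : H, ball u e v -> forall A : {fset I},
      \sum_(i <- A) `|v i - x i| ^+ 2 <= (2 * e) ^+ 2.
  move=> e0; have [u Fu] := Fc e e0; exists u; split => // v uv A.
  apply/ler_addgt0Pr => t t0.
  have cvs (s : seq I) : \sum_(i <- s) `|v i - (w : H) i| ^+ 2 @[w --> F] -->
      (\sum_(i <- s) `|v i - x i| ^+ 2 : K^o).
    elim: s => [|i s IH].
      by under eq_fun do rewrite big_nil; rewrite big_nil; exact: cvg_cst.
    under eq_fun do rewrite big_cons; rewrite big_cons; apply: cvgD => //.
    under eq_fun do rewrite expr2; rewrite expr2.
    have ci : `|v i - (w : H) i| @[w --> F] --> (`|v i - x i| : K^o).
      by apply: cvg_norm; apply: cvgB; [exact: cvg_cst|exact: xP].
    exact: cvgM.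
  have /cvgrPdist_lt/(_ _ t0) := cvs A; rewrite near_simpl => Fw.
  have [w [uw /ltW wA]] := filter_ex (filterI Fu Fw).
  move: wA; set s2 := \sum_(i <- A) `|v i - x i| ^+ 2; set s1 := \sum_(i <- A) _ => wA.
  have s10 : 0 <= s1 by apply: sumr_ge0 => i _; rewrite exprn_ge0.
  have s20 : 0 <= s2 by apply: sumr_ge0 => i _; rewrite exprn_ge0.
  rewrite -[leLHS]ger0_norm// -[X in `|X|](addrNK s1) addrC.
  rewrite (le_trans (ler_normD _ _))// lerD// ger0_norm// /s1.
  apply: (@le_trans _ _ (`|v - w| ^+ 2)).
    rewrite ell2_normE ell2_norm_sqr -(ger0_norm (ell2_ip_ge0 _)).
    exact: (ell2_partial_le (v - w)).
  rewrite ler_pXn2r ?nnegrE ?mulr_ge0 ?(ltW e0)//.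
  move: uv uw; rewrite -!ball_normE /= => uv uw.
  have -> : v - w = (u - w) - (u - v) by rewrite opprB [RHS]addrC addrA subrK.
  by rewrite (le_trans (ler_normB _ _))// mulr_natl mulr2n lerD// ltW.
have xH : x \in ell2_pred R k I.
  have [u [Fu uP]] := near_sum 1 ltr01; have [M uM] := ell2_predP _ (ell2_funP u).
  apply/ell2_predP; exists (2 * M + 2 * (2 * 1) ^+ 2) => A.
  apply: (@le_trans _ _ (\sum_(i <- A) (2 * `|u i| ^+ 2 + 2 * `|u i - x i| ^+ 2))).
    apply: ler_sum => i _; have := sqr_normD_le (u i) (- (u i - x i)).
    by rewrite normrN (_ : u i - (u i - x i) = x i)//; ring.
  rewrite big_split /= -!mulr_sumr lerD// ler_wpM2l//.
  by apply: uP; exact: ballxx.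
apply/cvg_ex; exists (Ell2 xH); apply/fcvgrPdist_lt => e e0.
have e40 : 0 < e / 4 by rewrite divr_gt0.
have [u [Fu uP]] := near_sum _ e40; apply: filterS Fu => v uv /=.
apply: (@le_lt_trans _ _ (2 * (e / 4))); last first.
  rewrite mulrCA -[ltRHS]mulr1 ltr_pM2l// ltr_pdivrMr// mul1r ltr_nat.
  by [].
rewrite distrC; apply: ell2_norm_le; first by rewrite mulr_ge0// ltW.
exact: uP.
Qed.

HB.instance Definition _ := isPointed.Build H 0.
HB.instance Definition _ := Uniform_isComplete.Build H ell2_complete.

Definition ell2_hilbert : completeNormedModType K := H.

Lemma ell2_is_hilbert : is_hilbert conj ell2_hilbert.
Proof.
have mixB : isBilinear K H H K *%R (conj \; *%R) ell2_ip.
  split.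
  - by move=> y x x'; rewrite -scaleN1r addrC ell2_ip_linear mulN1r addrC.
  - move=> x y y'; rewrite -scaleN1r addrC ell2_ip_linearr.
    have [c cE] := scalar_conj_rmorph R k.
    by rewrite -cE rmorphN rmorph1 mulN1r addrC.
  - move=> y a x; have := ell2_ip_linear a x 0 y; rewrite addr0 => ->.
    by have := ell2_ip_linear (-1) 0 0 y; rewrite scaler0 addr0 mulN1r addNr => ->; rewrite addr0.
  - move=> x a y; have := ell2_ip_linearr a x y 0; rewrite addr0 => ->.
    have := ell2_ip_linear (-1) 0 0 x; rewrite scaler0 addr0 mulN1r addNr => h.
    by rewrite [ell2_ip x 0]ell2_ipC h scalar_conj0 addr0.
have mixH : isHermitianSesquilinear K H false conj ell2_ip.
  by split => x y; rewrite expr0 mul1r ell2_ipC.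
have mixD : isDotProduct K H ell2_ip.
  split => x x0; rewrite lt_neqAle ell2_ip_ge0 andbT eq_sym.
  by apply: contra_neq x0; exact: ell2_ip_eq0.
pose f : {dot H for conj} := HB.pack ell2_ip mixB mixH mixD.
by exists f => x; rewrite ell2_normE ell2_norm_sqr.
Qed.

End ell2_space.

Section hilbert_generation.
Variables (R : realType) (k : scalar_kind).
Local Notation K := (scalars R k).
Variables (d : Order.disp_t) (W : orderTopologicalType d).
Hypothesis W_omega1 : order_type_omega1 W.
Local Notation X0 := (C0 K (L0 W)).
Local Notation H := (ell2_hilbert R k (L0 W)).
Local Notation gen := (@L0_generator R k d W W_omega1).
Local Notation level := (L0_level W_omega1).
Local Notation weight := (@L0_weight R k d W W_omega1).
Local Notation lbox := (@L0_box R k d W W_omega1).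

Lemma C0_uniform_limit (L : topologicalType) (h : L -> K^o) :
  (forall e : K, 0 < e -> exists f : C0 K L, forall x, `|h x - f x| <= e) ->
  exists g : C0 K L, forall x, g x = h x.
Proof.
move=> hf; suff [ch vh] : continuous h /\ vanishes_at_infinity h by exists (C0_of ch vh).
split.
  apply/continuous_nbhsP => x e e0; have e40 : 0 < e / 2 / 2 by rewrite !divr_gt0.
  have [f fP] := hf _ e40.
  have := (continuous_nbhsP f).1 (@C0_continuous _ _ f) x _ e40.
  apply: filterS => y /= fxy.
  have -> : h x - h y = (h x - f x) + (f x - f y) - (h y - f y) by ring.
  rewrite (le_lt_trans (ler_normB _ _))//.
  rewrite (le_lt_trans (lerD (ler_normD _ _) (lexx _)))//.
  have e44 : e / 2 / 2 + e / 2 / 2 + e / 2 / 2 < e.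
    rewrite [ltRHS]splitr -(splitr (e / 2)) ltrD2l.
    by rewrite [ltRHS]splitr ltrDl.
  by rewrite (le_lt_trans _ e44)// lerD// lerD// ltW.
move=> e e0; have e20 : 0 < e / 2 by rewrite divr_gt0.
have [f fP] := hf _ e20; have [A cA fA] := @C0_vanish _ _ f _ e20.
exists A => // x /fA fx; rewrite -(subrK (f x) (h x)).
by rewrite (le_lt_trans (ler_normD _ _))// [ltRHS]splitr ler_ltD.
Qed.

Lemma L0_generatorE p q : gen p q =
  weight p * ((level q == level p) && (L0_fst q <= L0_fst p)%O)%:R.
Proof. by rewrite /L0_generator C0Z L0_boxE. Qed.

(** Weights are at most 1, so their squares are dominated by the weights on the level of [q]. *)
Lemma L0_generator_sqr_sum (q : L0 W) (A : {fset L0 W}) :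
  \sum_(p <- A) `|gen p q| ^+ 2 <= 2.
Proof.
apply: le_trans (@L0_weight_sum R k _ _ W_omega1 A (level q) (fset_uniq A)).
rewrite [leRHS]big_mkcond; apply: ler_sum => p _; rewrite L0_generatorE eq_sym.
have w0 := @L0_weight_gt0 R k _ _ W_omega1 p.
case: eqP => _ /=; last by rewrite mulr0 normr0 expr0n.
rewrite normrM normr_nat gtr0_norm//; case: (L0_fst q <= L0_fst p)%O; last first.
  by rewrite mulr0 expr0n ltW.
rewrite mulr1 expr2 ler_piMr ?(ltW w0)// /L0_weight invf_le1 ?exprn_gt0//.
by rewrite exprn_ege1// ler1n.
Qed.

Lemma L0_generator_ell2 (q : L0 W) : (fun p => gen p q) \in ell2_pred R k (L0 W).
Proof. by apply/ell2_predP; exists 2 => A; exact: L0_generator_sqr_sum. Qed.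

Lemma sum_generator_le (x : L0 W -> K^o) (q : L0 W) (A : {fset L0 W}) (t : K) : 0 < t ->
  \sum_(p <- A) `|x p| ^+ 2 <= t ^+ 2 -> `|\sum_(p <- A) x p * gen p q| <= 2 * t.
Proof.
move=> t0 xA; rewrite (le_trans (ler_norm_sum _ _ _))//.
apply: (@le_trans _ _ (\sum_(p <- A) (t^-1 * `|x p| ^+ 2 + t * `|gen p q| ^+ 2) / 2)).
  by apply: ler_sum => p _; exact: ell2_mul_le.
rewrite -mulr_suml ler_pdivrMr// big_split /= -!mulr_sumr.
(* This is [3 * t]; halved, it stays below the claimed [2 * t]. *)
apply: (@le_trans _ _ (t^-1 * t ^+ 2 + t * 2)).
  by rewrite lerD// ler_wpM2l ?invr_ge0 ?(ltW t0)// L0_generator_sqr_sum.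
rewrite expr2 mulKf ?gt_eqF// mulrC -{1}[t]mul1r -mulrDl [leRHS]mulrAC ler_wpM2r ?(ltW t0)//.
by rewrite -natrM -[X in X + _]/(1%:R) -natrD ler_nat.
Qed.

Lemma generator_series_ex (x : H) : exists f : X0, forall q,
  f q = unordered_sum (fun p => x p * gen p q).
Proof.
have xs q : absolutely_summable (fun p => x p * gen p q).
  exact: (ell2_pairing_summable x (Ell2 (L0_generator_ell2 q))).
apply: C0_uniform_limit => e e0.
have e20 : 0 < e / 2 by rewrite divr_gt0.
have x2s : absolutely_summable (fun p => `|x p| ^+ 2 : K^o) by exact/asboolP/(ell2_funP x).
(* A square tail below [(e / 2) ^+ 2] bounds the remaining series by [2 * (e / 2)] at all points, so
   the finite sums converge uniformly. *)
have [A AP] := absolutely_summable_tail x2s (exprn_gt0 2 e20).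
exists (\sum_(p <- A) x p *: gen p) => q; rewrite C0_sum.
rewrite [X in _ - X](_ : _ = \sum_(p <- A) x p * gen p q); last first.
  by apply: eq_bigr => p _; rewrite C0Z.
apply: tsum_near => // B AB; rewrite (big_fsetID _ (mem A) B) /=.
have -> : [fset p in B | p \in A]%fset = A.
  by apply/fsetP => p; rewrite !inE /= andbC; case: (boolP (p \in A)) => //= /(fsubsetP AB).
set S1 := \sum_(p <- A) x p * _; set S2 := \sum_(i <- [fset _ | _ in _]%fset) _.
rewrite addrAC subrr add0r [e](_ : _ = 2 * (e / 2)); last by rewrite [RHS]mulrC divfK ?pnatr_eq0.
apply: sum_generator_le => //; apply: le_trans (ltW (AP [fset p in B | p \notin A]%fset _)).
  by apply: ler_sum => p _; rewrite normrX normr_id.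
by apply/fdisjointP => p pA; rewrite !inE /= pA andbF.
Qed.

Lemma ell2_to_C0_L0 : exists S : bounded_op H X0, forall (x : H) q,
  S x q = unordered_sum (fun p => x p * gen p q).
Proof.
have /choice[F FP] := generator_series_ex.
have xs (x : H) q : absolutely_summable (fun p => x p * gen p q).
  exact: (ell2_pairing_summable x (Ell2 (L0_generator_ell2 q))).
have [||S SE] := @bounded_op_ex _ _ _ F 2.
- move=> a x y; apply: C0_ext => q; rewrite C0D C0Z !FP -tsum_linear//.
  congr unordered_sum; apply/funext => p.
  by have [-> _ _ _] := ell2E (a *: x) y 0 p; have [_ -> _ _] := ell2E x y a p; ring.
- move=> x; have [->|x0] := eqVneq x 0.
    rewrite normr0 mulr0; apply: C0_norm_le => // q; rewrite FP.
    rewrite (tsumE (z := 0)) ?normr0//.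
    have -> : partial_sum (fun p => (0 : H) p * gen p q) = fun=> 0.
      by apply/funext => A; rewrite partial_sumE big1// => p _; rewrite mul0r.
    exact: cvg_cst.
  have xp : 0 < `|x| by rewrite normr_gt0.
  apply: C0_norm_le => [|q]; first by rewrite mulr_ge0.
  rewrite FP; apply: tsum_le => // A; apply: sum_generator_le => //.
  rewrite ell2_normE ell2_norm_sqr -(ger0_norm (ell2_ip_ge0 _)).
  exact: ell2_partial_le.
by exists S => x q; rewrite SE FP.
Qed.

Lemma ell2_single_subproof (p : L0 W) :
  (fun q => if q == p then 1 else 0 : K^o) \in ell2_pred R k (L0 W).
Proof.
apply/ell2_predP; exists 1 => A; have [pA|npA] := boolP (p \in A).
  rewrite (big_fsetD1 p pA) /= eqxx normr1 expr1n big1_seq ?addr0// => q /=.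
  by rewrite !inE => /andP[/negbTE -> _]; rewrite normr0 expr0n.
rewrite big1_seq// => q /= qA; rewrite ifN ?normr0 ?expr0n//.
by apply: contraNneq npA => <-.
Qed.

Lemma factors_L0_hilbert_generated (X : normedModType K) (T : bounded_op X X) :
  factors_through T X0 ->
  exists2 Y : closed_subspace X, hilbert_generated (@scalar_conj R k) (subspace_elt Y) &
    range T `<=` [set f | f \in Y].
Proof.
move=> [T1 [U TE]]; have [Y [U' [U'E U'd]]] := closure_range_ex U.
exists Y; last by move=> _ [f _ <-]; rewrite TE /= -U'E; exact: valP.
have [S SE] := ell2_to_C0_L0.
exists H, (comp_op U' S); split; first exact: ell2_is_hilbert.
apply/dense_normP => y e e0.
have e20 : 0 < e / 2 by rewrite divr_gt0.
have [M M0 U'M] := op_bound U'.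
have [z zy] := U'd y _ e20.
pose P := [set g | exists x, S x = g].
have PL a f g : P f -> P g -> P (a *: f + g).
  by move=> [x <-] [x' <-]; exists (a *: x + x'); rewrite linearP.
have P0 : P 0 by exists 0; rewrite linear0.
have Pbox p : P (lbox p).
  have -> : lbox p = (weight p)^-1 *: gen p + 0.
    by rewrite addr0 /L0_generator scalerA mulVf ?scale1r// gt_eqF// L0_weight_gt0.
  (* A unit vector is sent to a single generator. *)
  apply: PL => //; exists (Ell2 (ell2_single_subproof p)); apply: C0_ext => q.
  rewrite SE (tsum_single (p := p)) /= ?eqxx ?mul1r// => i ip.
  by rewrite (negbTE ip) mul0r.
have eM0 : 0 < e / 2 / M by rewrite divr_gt0.
have [_ [x <-] gz] := L0_boxes_dense P0 PL Pbox z eM0.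
exists (U' (S x)); first by exists x.
have -> : y - U' (S x) = (y - U' z) + U' (z - S x) by rewrite linearB addrA subrK.
rewrite (le_lt_trans (ler_normD _ _))// [ltRHS]splitr ltr_leD// (le_trans (U'M _))//.
by rewrite mulrC -ler_pdivlMr.
Qed.

End hilbert_generation.

(** * Operators with generated range *)

Section generated_range.
Variables (R : realType) (k : scalar_kind).
Local Notation K := (scalars R k).
Variables (d : Order.disp_t) (W : orderTopologicalType d).
Hypothesis W_omega1 : order_type_omega1 W.
Let wo := omega1_wo W_omega1.
Local Notation X := (C0 K W).
Local Notation ibox b := (@box K d W wo None b).

Lemma finitely_many_vanish (n : nat) (Y : closed_subspace X) (v : 'I_n -> subspace_elt Y) :
  exists b : W, forall i x, (b < x)%O -> (\val (v i) : X) x = 0.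
Proof.
have /choice[u uP] i := C0_omega1_eventually0 W_omega1 (\val (v i)).
have [|b bP] := @countable_bounded _ _ W_omega1 (range u).
  exact: sub_countable (card_image_le _ _) (countableP _).
by exists b => i x bx; apply: uP; apply: lt_trans bx; apply: bP; exists i.
Qed.

(* On [Y], zero is a cluster point of the evaluations at the points beyond [t];
   compactness of the powers of [A] makes finitely many points suffice for each
   [n] and [e], in place of an appeal to countable tightness. *)
Lemma weakly_compact_small_evaluation (Y : closed_subspace X) (A : set (subspace_elt Y))
    (t : W) (n : nat) (e : K) : weakly_compact A -> 0 < e ->
  exists s : {fset W}, forall v : 'I_n -> subspace_elt Y, (forall i, A (v i)) ->
    exists x, [/\ x \in s, (t < x)%O & forall i, `|(\val (v i) : X) x| < e].
Proof.
move=> cA e0; pose wY : topologicalType := weak (subspace_elt Y).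
pose V : topologicalType := prod_topology (fun _ : 'I_n => wY).
have cAn : @compact V [set v | forall i, A ((v : 'I_n -> wY) i)].
  exact: (@tychonoff 'I_n (fun=> wY) (fun=> A)).
have [J JE] := inclusion_ex Y.
move/compact_near_coveringP : cAn => /(_ {fset W} totally (fun s (v : 'I_n -> subspace_elt Y) =>
  exists x, [/\ x \in s, (t < x)%O & forall i, `|(\val (v i) : X) x| < e]) _)[].
  move=> v _; have [b bv] := finitely_many_vanish v.
  (* Every [v i] vanishes at [x], so the one evaluation at [x] serves a whole neighbourhood of the
     tuple. *)
  have [x] := gt_exists W_omega1 (Order.max b t); rewrite gt_max => /andP[bx tx].
  have [phi phiE] := op_eval_ex J x.
  have cl i : nbhs (v : V) [set w : V | `|(\val ((w : 'I_n -> subspace_elt Y) i) : X) x| < e].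
    have cphi : continuous ((phi : wY -> K^o) \o (fun w : V => (w : 'I_n -> wY) i)).
      move=> w; apply: continuous_comp; first exact: (@proj_continuous 'I_n (fun=> wY) i).
      exact: weak_continuous.
    have := (continuous_nbhsP _).1 cphi v _ e0; apply: filterS => w /=.
    by rewrite !phiE !JE bv// sub0r normrN.
  exists ([set w : V | forall i, `|(\val ((w : 'I_n -> subspace_elt Y) i) : X) x| < e],
          [set s : {fset W} | x \in s]) => /=; last first.
    by move=> [w s] [/= wx xs]; exists x.
  split; last by exists [fset x]%fset => // s /=; rewrite fsub1set.
  exact: (@filter_forall V 'I_n
    (fun i => [set w : V | `|(\val ((w : 'I_n -> subspace_elt Y) i) : X) x| < e])
    (nbhs (v : V)) _ cl).
move=> s _ /(_ s (fsubset_refl _)) sP; exists s => v vA.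
exact: (sP v vA).
Qed.

Lemma weakly_compactly_generated_character0 (T : bounded_op X X) (Y : closed_subspace X) :
  weakly_compactly_generated (subspace_elt Y) -> range T `<=` [set f | f \in Y] ->
  op_character T 0.
Proof.
move=> [A cA dA] TY; have [s [c [t [Tc sc sT]]]] := op_character_ex W_omega1 T.
suff <- : c = 0 by [].
apply: contrapT => /eqP c0; have cp : 0 < `|c| / 2 by rewrite divr_gt0// normr_gt0.
(* The test points depend only on the length of a combination and a precision. These are countably
   many choices, so one [b] exceeds all the points before any combination is chosen. *)
have /choice[S SP] (nm : nat * nat) : exists s : {fset W},
    forall v : 'I_nm.1 -> subspace_elt Y, (forall i, A (v i)) ->
    exists x, [/\ x \in s, (t < x)%O & forall i, `|(\val (v i) : X) x| < nm.2.+1%:R^-1].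
  by apply: weakly_compact_small_evaluation; rewrite ?invr_gt0.
have [|b bP] := @countable_bounded _ _ W_omega1 (\bigcup_nm [set` S nm]).
  by apply: bigcup_countable => // nm _; exact: countable_fset.
have [h hP] := sT b.
have Th : T (ibox h) \in Y by apply: TY; exists (ibox h).
have [_ [n [a [v [vA ->]]]] hv] := (dense_normP _).2 dA (SubspaceElt Th) _ cp.
have [J JE] := inclusion_ex Y.
set N := \sum_(i < n) `|a i|.
have N0 : 0 <= N by apply: sumr_ge0.
(* At precision [m] the combination is at most half the modulus of [c] at [x], although it
   approximates [c] there to strictly less than the other half. *)
have [m mP] := scalar_natr_gt (N / (`|c| / 2)).
have [x [xS tx vx]] := SP (n, m) v vA.
have xb : (x < b)%O by apply: bP; exists (n, m).
have hv' : `|T (ibox h) x - (\val (\sum_(i < n) a i *: v i) : X) x| < `|c| / 2.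
  apply: le_lt_trans hv; apply: (@le_trans _ _ `|J (SubspaceElt Th - \sum_(i < n) a i *: v i)|).
    rewrite JE raddfB /=.
    exact: (C0_norm_ge (T (ibox h) - \val (\sum_(i < n) a i *: v i)) x).
  by rewrite JE.
move: hv'; rewrite hP ?lexx ?(ltW xb)// sc// -JE linear_sum C0_sum => hv'.
suff sm : `|\sum_(i < n) (J (a i *: v i)) x| <= `|c| / 2.
  have : `|c| < `|c|.
    rewrite [ltRHS]splitr -{1}(subrK (\sum_(i < n) (J (a i *: v i)) x) c).
    by rewrite (le_lt_trans (ler_normD _ _))// ltr_leD.
  by rewrite ltxx.
rewrite (le_trans (ler_norm_sum _ _ _))//.
apply: (@le_trans _ _ (\sum_(i < n) `|a i| * m.+1%:R^-1)).
  apply: ler_sum => i _; rewrite linearZ C0Z normrM ler_wpM2l// JE.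
  exact: ltW (vx i).
rewrite -mulr_suml -/N ler_pdivrMr// mulrC -ler_pdivrMr//.
rewrite ger0_norm in mP; last by rewrite divr_ge0// ltW.
by rewrite (le_trans (ltW mP))// ler_nat.
Qed.

Lemma parallelogram (H : normedModType K) (ip : {dot H for (@scalar_conj R k)}) :
  (forall x : H, ip x x = `|x| ^+ 2) -> forall x y : H,
  `|x + y| ^+ 2 + `|x - y| ^+ 2 = 2 * `|x| ^+ 2 + 2 * `|y| ^+ 2.
Proof.
move=> ipE x y; rewrite -!ipE.
rewrite !linearDl !linearNl !linearDr !linearNr /=.
by ring.
Qed.

Lemma hilbert_generated_character0 (T : bounded_op X X) (Y : closed_subspace X) :
  hilbert_generated (@scalar_conj R k) (subspace_elt Y) -> range T `<=` [set f | f \in Y] ->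
  op_character T 0.
Proof.
move=> [H [S [[ip ipE] dS]]] TY; have [s [c [t [Tc sc sT]]]] := op_character_ex W_omega1 T.
suff <- : c = 0 by [].
apply: contrapT => /eqP c0; have cp : 0 < `|c| / 2 by rewrite divr_gt0// normr_gt0.
have [J JE] := inclusion_ex Y; pose JS := comp_op J S.
(* These sets are convex and decrease in [b]; [N b] below is the infimum of the squared norms over
   them. *)
pose C (b : W) := [set x : H | forall a, (t < a)%O -> (a <= b)%O -> `|JS x a - c| <= `|c| / 2].
have C0' b : C b !=set0.
  have [h hP] := sT b.
  have Th : T (ibox h) \in Y by apply: TY; exists (ibox h).
  have [_ [x _ <-] hx] := (dense_normP _).2 dS (SubspaceElt Th) _ cp.
  exists x => a ta ab; have : `|T (ibox h) a - JS x a| <= `|c| / 2.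
    apply: le_trans (ltW hx); change (`|T (ibox h) a - JS x a| <= `|\val (SubspaceElt Th - S x)|).
    by rewrite /JS /= JE; exact: (C0_norm_ge (T (ibox h) - \val (S x)) a).
  by rewrite hP// sc// distrC.
have Cle b b' : (b <= b')%O -> C b' `<=` C b.
  by move=> bb' x Cx a ta ab; apply: Cx => //; exact: le_trans bb'.
pose q (x : H) : R := scalar_abs `|x| ^+ 2.
have qE x : `|x| ^+ 2 = scalar_of R k (q x).
  by rewrite /q rmorphXn /= -normE normr_id.
have q0 x : 0 <= q x by rewrite exprn_ge0// scalar_abs_ge0.
pose N b := inf (q @` C b).
have lbq b : has_lbound (q @` C b) by exists 0 => _ [x _ <-].
have hq b : has_inf (q @` C b).
  by split => //; have [x Cx] := C0' b; exists (q x), x.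
have Nle b x : C b x -> N b <= q x by move=> Cx; apply: ge_inf => //; exists x.
have Nmono b b' : (b <= b')%O -> N b <= N b'.
  move=> bb'; apply: lb_le_inf; first by have [] := hq b'.
  by move=> _ [x Cx <-]; apply: Nle; exact: Cle Cx.
have [M M0 JSM] := op_bound JS.
pose eta : R := scalar_abs (`|c| / 2) ^+ 2 / (scalar_abs M ^+ 2 * 7).
have sM0 : 0 < scalar_abs M by rewrite -(ltr_scalar_of k) rmorph0 -normE gtr0_norm.
have sc0 : 0 < scalar_abs (`|c| / 2) by rewrite -(ltr_scalar_of k) rmorph0 -normE gtr0_norm.
have eta0 : 0 < eta by rewrite divr_gt0 ?mulr_gt0 ?exprn_gt0.
(* Otherwise [N] would gain [eta] infinitely often along a sequence, and the sequence is bounded in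
   [W]. *)
have [b0 b0P] : exists b0, forall b, (b0 <= b)%O -> N b <= N b0 + eta.
  apply: contrapT => /forallNP nb.
  have /choice[g gP] b : exists b', (b <= b')%O /\ N b + eta < N b'.
    by have /existsNP[b' /not_implyP[bb' /negP]] := nb b; rewrite -ltNge; exists b'.
  have [w _] := omega1_inhabited W_omega1; pose u n := iter n g w.
  have uN n : eta *+ n <= N (u n).
    elim: n => [|n IH]; last by rewrite mulrSr (le_trans _ (ltW (gP (u n)).2))// lerD.
    rewrite mulr0n; apply: lb_le_inf; first by have [] := hq (u 0%N).
    by move=> _ [x _ <-].
  have [b bP] := seq_bounded W_omega1 u.
  have := truncnS_gt (N b / eta); set n := _.+1 => nb'.
  have := le_trans (uN n) (Nmono _ _ (ltW (bP n))).
  by rewrite leNgt -[eta *+ n]mulr_natl -ltr_pdivrMr// nb'.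
have [_ [u Cu <-] uN] := inf_adherent eta0 (hq b0).
have [a aP] := C0_omega1_eventually0 W_omega1 (JS u).
have [b] := gt_exists W_omega1 (Order.max a (Order.max b0 t)).
rewrite !gt_max => /andP[ab /andP[b0b tb]].
have [_ [v Cv <-] vN] := inf_adherent eta0 (hq b).
have Cw : C b0 (2^-1 *: (u + v)).
  move=> x tx xb0; rewrite linearZ linearD C0Z C0D.
  have ux := Cu x tx xb0; have vx := Cv x tx (le_trans xb0 (ltW b0b)).
  have -> : 2^-1 * (JS u x + JS v x) - c = 2^-1 * ((JS u x - c) + (JS v x - c)).
    rewrite addrACA -opprD mulrBr; congr (_ - _).
    by rewrite -mulr2n -[c *+ 2]mulr_natl mulKf ?pnatr_eq0.
  rewrite normrM (le_trans (ler_wpM2l (normr_ge0 _) (ler_normD _ _)))//.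
  rewrite gtr0_norm ?invr_gt0// mulrC ler_pdivrMr// mulr_natr mulr2n.
  exact: lerD ux vx.
have puv := parallelogram ipE u v.
have quv : q (u + v) + q (u - v) = 2 * q u + 2 * q v.
  have inj : injective (scalar_of R k) by exact: fmorph_inj.
  apply: inj; rewrite (rmorphD _ (q (u + v)) (q (u - v))) (rmorphD _ (2 * q u) (2 * q v)).
  by rewrite (rmorphM _ 2 (q u)) (rmorphM _ 2 (q v)) /= -!qE rmorph_nat.
have qw : 4 * N b0 <= q (u + v).
  have <- : 4 * q (2^-1 *: (u + v)) = q (u + v).
    have inj : injective (scalar_of R k) by exact: fmorph_inj.
    apply: inj; rewrite (rmorphM _ 4 (q _)) /= -!qE rmorph_nat normrZ exprMn.
    rewrite gtr0_norm ?invr_gt0// exprVn mulrA -natrX divff ?mul1r// pnatr_eq0//.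
  by rewrite ler_pM2l// Nle.
(* The squared norms of [u] and [v] are at most [N b0 + eta] and [N b0 + 2 * eta], and the midpoint
   still lies in [C b0]. The 7 in the choice of [eta] exceeds this 6 to give a strict
   contradiction. *)
have quv_le : q (u - v) <= 6 * eta.
  have Nbb := b0P b (ltW b0b); lra.
(* At [b] the image of [u] has already died out, while that of [v] is still close to [c]. *)
have JSb : JS (u - v) b = - JS v b.
  rewrite linearB; have [_ _ _ -> _] := C0E (JS u) (JS v) 0 b.
  by rewrite aP// sub0r.
have cle : `|c| / 2 <= M * `|u - v|.
  have vb := Cv b tb (lexx b).
  rewrite (le_trans _ (le_trans (C0_norm_ge _ b) (JSM (u - v))))// JSb normrN.
  rewrite -(lerD2r (`|c| / 2)) -splitr -[in leLHS](subrK (JS v b) c) addrC.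
  by rewrite (le_trans (ler_normD _ _))// lerD2l distrC.
have : scalar_abs (`|c| / 2) ^+ 2 <= scalar_abs M ^+ 2 * q (u - v).
  rewrite -(ler_scalar_of k) rmorphXn rmorphM rmorphXn /= -!normE -qE -exprMn.
  rewrite ler_pXn2r ?nnegrE ?mulr_ge0//.
  by rewrite (gtr0_norm cp) (gtr0_norm M0).
rewrite leNgt => /negP; apply; apply: (@le_lt_trans _ _ (scalar_abs M ^+ 2 * (6 * eta))).
  by rewrite ler_wpM2l// exprn_ge0// ltW.
have -> : scalar_abs (`|c| / 2) ^+ 2 = scalar_abs M ^+ 2 * (7 * eta).
  by rewrite /eta; field; rewrite gt_eqF.
by rewrite ltr_pM2l ?exprn_gt0// ltr_pM2r// ltr_nat.
Qed.

End generated_range.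

(** * Fixing copies *)

Section fixing_copies.
Variables (R : realType) (k : scalar_kind).
Local Notation K := (scalars R k).
Variables (d : Order.disp_t) (W : orderTopologicalType d).
Hypothesis W_omega1 : order_type_omega1 W.
Let wo := omega1_wo W_omega1.
Local Notation X := (C0 K W).
Local Notation ibox b := (@box K d W wo None b).

(* With [B (ibox (delta_j))] equal to the row-sum function, hence to [0], between
   [t] and [eta_j], and to [0] beyond [eta_(j+1)], the images of the [ibox (delta_j)]
   are disjointly supported beyond [eta_0], whereas a combination with [n]
   coefficients [1] followed by [n] coefficients [-1] has norm at least [n]. *)
Lemma character0_not_bounded_below (B : bounded_op X X) :
  op_character B 0 -> ~ bounded_below B.
Proof.
move=> B0 [kap kap0 Bkap].
have [s [c [t [Bc sc sB]]]] := op_character_ex W_omega1 B.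
have c0 : c = 0 by exact: op_character_unique Bc B0.
have [M M0 BM] := op_bound B.
have /choice[g gP] (h : W) : exists dh : W * W, [/\ (h < dh.1)%O, (dh.1 < dh.2)%O,
    forall x, (x <= h)%O -> B (ibox dh.1) x = s x &
    forall x, (dh.2 < x)%O -> B (ibox dh.1) x = 0].
  have [h1 h1P] := sB h; have [de] := gt_exists W_omega1 (Order.max h h1).
  rewrite gt_max => /andP[hd h1d].
  have [h2 h2P] := C0_omega1_eventually0 W_omega1 (B (ibox de)).
  have [et] := gt_exists W_omega1 (Order.max de h2).
  rewrite gt_max => /andP[de_et h2_et].
  exists (de, et); split => //= x; first by apply: h1P; exact: ltW.
  by move=> /(lt_trans h2_et); exact: h2P.
pose eta n := iter n (fun h => (g h).2) t.
pose de n := (g (eta n)).1.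
have eta_lt n : (eta n < eta n.+1)%O.
  by have [h1 h2 _ _] := gP (eta n); exact: lt_trans h2.
have eta_homo : {homo eta : m n / (m <= n)%N >-> (m <= n)%O}.
  by apply: homo_leq => [x|x y z|n]; [exact: lexx|exact: le_trans|exact: ltW].
have de_eta n : (eta n < de n)%O by have [] := gP (eta n).
have de_lt n : (de n < eta n.+1)%O by have [] := gP (eta n).
have B_low n x : (t < x)%O -> (x <= eta n)%O -> B (ibox (de n)) x = 0.
  by move=> tx xn; have [_ _ gE _] := gP (eta n); rewrite gE// sc// c0.
have B_init n x : (x <= t)%O -> B (ibox (de n)) x = s x.
  move=> xt; have [_ _ gE _] := gP (eta n); apply: gE; apply: le_trans xt _.
  exact: (eta_homo 0%N n).
have B_high n x : (eta n.+1 < x)%O -> B (ibox (de n)) x = 0.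
  by have [_ _ _] := gP (eta n); exact.
have B_norm n x : `|B (ibox (de n)) x| <= M.
  rewrite (le_trans (C0_norm_ge _ _))// (le_trans (BM _))// ler_piMr ?(ltW M0)//.
  by apply: C0_norm_le => // y; rewrite boxE normr_nat lern1 leq_b1.
have main n : kap * n%:R <= M.
  pose a (j : 'I_(n + n)) : K := if (j < n)%N then 1 else -1.
  pose F := \sum_(j < n + n) a j *: ibox (de j).
  have a0 : \sum_(j < n + n) a j = 0.
    rewrite big_split_ord /= (eq_bigr (fun=> 1)) => [|i _]; last by rewrite /a /= ltn_ord.
    rewrite [X in _ + X](eq_bigr (fun=> -1)) => [|i _].
      by rewrite sumrN subrr.
    by rewrite /a /= ltnNge leq_addr.
  have a1 j : `|a j| = 1 by rewrite /a; case: ifP => _; rewrite ?normrN normr1.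
  have Fn : n%:R <= `|F|.
    case: n @a @F a0 a1 => [|n] a F a0 a1; first by rewrite normr_ge0.
    (* At this point the indicators with coefficient 1 have ended and all those with coefficient -1
       are still 1. *)
    apply: le_trans (C0_norm_ge F (eta n.+1)); rewrite /F C0_sum.
    under eq_bigr do rewrite C0Z boxE /=.
    rewrite big_split_ord /= big1 => [|i _]; last first.
      rewrite (_ : (_ <= _)%O = false) ?mulr0//; apply/negbTE; rewrite -ltNge.
      change (de i < eta n.+1)%O; apply: lt_le_trans (de_lt i) _.
      exact: (eta_homo i.+1).
    rewrite add0r (eq_bigr (fun=> -1)) => [|i _].
      by rewrite sumrN normrN sumr_const card_ord normr_nat.
    rewrite /a /= ltnNge leq_addr /= (_ : (_ <= _)%O = true) ?mulr1//.
    apply: le_trans (ltW (de_eta _)); apply: (eta_homo n.+1).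
    exact: leq_addr.
  have BF : `|B F| <= M.
    apply: C0_norm_le => [|x]; first exact: ltW.
    rewrite /F linear_sum C0_sum; under eq_bigr do rewrite linearZ C0Z.
    (* Up to [t] all images agree with [s], so the zero sum of the coefficients cancels them; beyond
       [t] at most one image is nonzero. *)
    have [xt|tx] := leP x t.
      under eq_bigr do rewrite B_init//.
      by rewrite -mulr_suml a0 mul0r normr0 ltW.
    have zero (i : nat) : ~~ ((eta i < x)%O && (x <= eta i.+1)%O) -> B (ibox (de i)) x = 0.
      rewrite negb_and; case/orP; first by rewrite -leNgt; exact: B_low.
      by rewrite -ltNge; exact: B_high.
    have [/existsP[i /andP[ix xi]]|/existsPn nx] :=
        boolP [exists i : 'I_(n + n), (eta i < x)%O && (x <= eta i.+1)%O].
      rewrite (bigD1 i) //= big1 => [|j ji]; first by rewrite addr0 normrM a1 mul1r.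
      rewrite zero ?mulr0// negb_and -leNgt -[X in _ || X]ltNge.
      have : (j != i :> nat) by [].
      rewrite neq_ltn => /orP[j_i|i_j]; apply/orP; [right|left].
        by apply: le_lt_trans ix; exact: eta_homo.
      by apply: le_trans xi _; exact: eta_homo.
    by rewrite big1 ?normr0 ?(ltW M0)// => i _; rewrite zero ?mulr0.
  by rewrite (le_trans _ (le_trans (Bkap F) BF))// ler_wpM2l// ltW.
have [n nM] := scalar_natr_gt (M / kap).
rewrite gtr0_norm ?divr_gt0// in nM.
have := main n; rewrite mulrC -ler_pdivlMr// => nM'.
by have := le_lt_trans nM' nM; rewrite ltxx.
Qed.

(** Composing [T] with the embedding of the copy gives an operator on [C0 K W] that is bounded below
    and still vanishes on [D]. *)
Lemma character0_not_fixes_copy (T : bounded_op X X) :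
  op_character T 0 -> ~ fixes_copy T X.
Proof.
move=> [D cD TD] [Y [[U [V [_ VK]]] [c c0 Tc]]].
have [J JE] := inclusion_ex Y.
have [M M0 UM] := op_bound U.
apply: (@character0_not_bounded_below (comp_op T (comp_op J V))).
  by exists D => // f a Da; rewrite /= TD// !mul0r.
exists (c / M); first by rewrite divr_gt0.
move=> f; rewrite /= JE (le_trans _ (Tc _))// -mulrA ler_wpM2l ?(ltW c0)//.
by rewrite mulrC ler_pdivrMr// mulrC -{1}[f]VK UM.
Qed.

End fixing_copies.

(** The copy is the range of [S], described as the fixed points of the projection [S U T] so that
    closedness follows from boundedness. *)
Lemma identity_factors_fixes_copy (K : numFieldType) (X Y Z : normedModType K)
    (T : bounded_op X Y) : factors_through_op (@idfun Z) T -> fixes_copy T Z.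
Proof.
move=> [S [U UTS]]; have id z : U (T (S z)) = z by have := congr1 (@^~ z) UTS.
have [M M0 SM] := op_bound S; have [N N0 UN] := op_bound U; have [L L0 TL] := op_bound T.
have [|||W WP] := @closed_subspace_ex _ X [set x | S (U (T x)) = x].
- by rewrite /= !linear0.
- by move=> a u v /= uE vE; rewrite !linearP uE vE.
- move=> x clx; apply/eqP; rewrite -subr_eq0 -normr_le0; apply/ler_addgt0Pr => e e0.
  rewrite add0r; pose C := M * (N * L) + 1.
  have C0' : 0 < C by rewrite ltr_wpDl// !mulr_ge0// ltW.
  have eC : 0 < e / C by rewrite divr_gt0.
  have [y [yE]] := clx _ (nbhsx_ballx x _ eC); rewrite -ball_normE /= in yE * => xy.
  have -> : S (U (T x)) - x = S (U (T (x - y))) - (x - y).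
    by rewrite (linearB T) (linearB U) (linearB S) yE opprB addrA subrK.
  rewrite (le_trans (ler_normB _ _))//.
  apply: (@le_trans _ _ (C * `|x - y|)); last by rewrite mulrC -ler_pdivlMr// ltW.
  rewrite mulrDl mul1r lerD2r (le_trans (SM _))// -!mulrA ler_wpM2l ?(ltW M0)//.
  by rewrite (le_trans (UN _))// ler_wpM2l ?(ltW N0)// TL.
have SW z : S z \in W by apply/WP; rewrite /= id.
have [S' S'E] := corestriction_ex SW; have [J JE] := inclusion_ex W.
exists W; split.
  exists (comp_op U (comp_op T J)), S'; split => [w|z] /=; last by rewrite JE S'E id.
  by apply/val_inj; rewrite S'E JE; exact/(WP (\val w)).1/(valP w).
exists (M * N)^-1; first by rewrite invr_gt0 mulr_gt0.
move=> w; rewrite mulrC ler_pdivrMr ?mulr_gt0// mulrC -mulrA.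
have {1}-> : `|w| = `|S (U (T (\val w)))|.
  by rewrite (WP (\val w)).1 ?(valP w).
by rewrite (le_trans (SM _))// ler_wpM2l ?(ltW M0)// UN.
Qed.

Theorem theorem1p4 (R : realType) (k : scalar_kind) (d : Order.disp_t)
    (W : orderTopologicalType d) (W_omega1 : order_type_omega1 W)
    (T : bounded_op (C0 (scalars R k) W) (C0 (scalars R k) W)) :
  [<-> loy_willis T;
       exists2 D : set W, club D & forall a, D a -> matrix_entry T a a = 0;
       alspach_benyamini T = 0;
       factors_through T (C0 (scalars R k) (L0 W));
       exists2 Y : closed_subspace (C0 (scalars R k) W),
         hilbert_generated (@scalar_conj R k) (subspace_elt Y) &
         range T `<=` [set f | f \in Y];
       exists2 Y : closed_subspace (C0 (scalars R k) W),
         weakly_compactly_generated (subspace_elt Y) &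
         range T `<=` [set f | f \in Y];
       ~ fixes_copy T (C0 (scalars R k) W);
       ~ factors_through_op (@idfun (C0 (scalars R k) W)) T].
Proof.
tfae.
- move=> /(loy_willis_character0 W_omega1)[D cD TD]; exists D => // a Da.
  by apply: (matrix_entry_diag W_omega1) => f; exact: TD.
- move=> [D cD TD]; have [E cE TE] := alspach_benyaminiP W_omega1 T.
  have [a [Da Ea]] := clubW W_omega1 (clubI W_omega1 cD cE).
  rewrite -(TD a Da); apply/esym/(matrix_entry_diag W_omega1) => f.
  exact: TE.
- by move=> /(alspach_benyamini0P W_omega1); exact: character0_factors_L0.
- exact: factors_L0_hilbert_generated.
(* The weakly compactly generated subspace is not [Y]: it comes from the factorization through
   [C0(L0)] after character zero is known. *)
- move=> [Y HY TY]; apply: (factors_L0_weakly_compactly_generated W_omega1).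
  apply: (character0_factors_L0 W_omega1).
  exact: hilbert_generated_character0 HY TY.
- move=> [Y WY TY]; apply: (character0_not_fixes_copy W_omega1).
  exact: weakly_compactly_generated_character0 WY TY.
- by move=> nfix /identity_factors_fixes_copy.
- move=> nid; apply: (character0_loy_willis W_omega1).
  have Tc := alspach_benyaminiP W_omega1 T.
  have [c0|c0] := eqVneq (alspach_benyamini T) 0; first by rewrite c0 in Tc.
  by case: nid; exact: (character_neq0_factors W_omega1 Tc).
Qed.
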